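(* Let $r\ge1$ and let $\mathbf{a}=(a_1,\ldots,a_r,1)$ be an $(r+1)$-tuple of positive integers with exactly two odd coordinates; let $\tilde{\mathbf{a}}:=(a_1+1,a_2,\ldots,a_r)$. Let $\mathcal{M}$ be the set of pairs $(\mathfrak{m};c)$ with $\mathfrak{m}$ a map of type $\mathbf{a}$ and $c$ a distinguished corner of $f_1$. Let $\tilde{\mathcal{M}}$ be the set of triples $(\tilde{\mathfrak{m}};v,h)$ with $\tilde{\mathfrak{m}}$ a map of type $\tilde{\mathbf{a}}$, $v$ a distinguished vertex, and $h$ a half-edge incident to $f_1$ directed toward $v$. Define $\Phi^1_{\mathrm{right}}$ on $\mathcal{M}$: given $(\mathfrak{m};c)$, let $\mathbbm{p}$ be the rightmost geodesic from the unique corner of $f_{r+1}$ to $c$; slit $\mathfrak{m}$ along $\mathbbm{p}$ from that corner to $c$, let $\mathbbm{l},\mathbbm{r}$ be the left and right copies of $\mathbbm{p}$ and let $\mathbbm{r}_0$ be the unique half-edge incident to $f_{r+1}$; sew $\mathbbm{l}_{1\to[\mathbbm{p}]}$ onto $\mathbbm{r}_{0\to[\mathbbm{p}]-1}$ (identifying $\mathbbm{l}_{k}$ with $\mathbbm{r}_{k-1}$), which suppresses $f_{r+1}$. In the result let $h:=\operatorname{rev}(\mathbbm{r})_1$ and $v:=\mathbbm{l}_1^-$; calling $\tilde{\mathfrak{m}}$ the resulting map, set $\Phi^1_{\mathrm{right}}(\mathfrak{m};c):=(\tilde{\mathfrak{m}};v,h)$. Define $\Phi^1_{\mathrm{left}}$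 on $\tilde{\mathcal{M}}$: given $(\tilde{\mathfrak{m}};v,h)$, let $h_0$ be the corner delimited by $h$ and its predecessor in the contour of $f_1$, and $\mathbbm{p}'$ the leftmost geodesic from $h_0$ to $v$. Slit $\tilde{\mathfrak{m}}$ along $\mathbbm{p}'$ starting from $h_0$ and stopping at $v$ without disconnecting the map at $v$; let $\mathbbm{l}',\mathbbm{r}'$ be the left and right copies of $\mathbbm{p}'$ and sew $\mathbbm{l}'_{2\to[\mathbbm{p}']}$ onto $\mathbbm{r}'_{1\to[\mathbbm{p}']-1}$, thereby creating a new face of degree $1$, named $f_{r+1}$. Delete the dangling edge $\mathbbm{l}'_1$ and let $c$ be the corner it leaves; calling $\mathfrak{m}$ the resulting map, set $\Phi^1_{\mathrm{left}}(\tilde{\mathfrak{m}};v,h):=(\mathfrak{m};c)$. Then $\Phi^1_{\mathrm{right}}:\mathcal{M}\to\tilde{\mathcal{M}}$ and $\Phi^1_{\mathrm{left}}:\tilde{\mathcal{M}}\to\mathcal{M}$ are well-defined and are inverse bijections.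
   Context: A plane map is an embedding of a finite connected graph (multiple edges and loops allowed) into the sphere, up to orientation-preserving homeomorphisms. A map of type $(a_1,\ldots,a_k)$ is a plane map with faces numbered $f_1,\ldots,f_k$, $f_i$ of degree $a_i$, each face carrying one marked corner. Distinguishing a corner splits it into two corners. A half-edge $h$ is an oriented edge with origin $h^-$, end $h^+$ and reverse $\operatorname{rev}(h)$; a corner is viewed as a half-edge with no origin whose end $c^+$ is the vertex of the corner. A half-edge is incident to a face if it lies on its boundary with the face to its left. A path is a sequence $\mathbbm{p}=(\mathbbm{p}_1,\ldots,\mathbbm{p}_\ell)$ of half-edges with $\mathbbm{p}_k^+=\mathbbm{p}_{k+1}^-$, of length $[\mathbbm{p}]=\ell$; $\mathbbm{p}_{i\to j}=(\mathbbm{p}_i,\ldots,\mathbbm{p}_j)$ (empty if $i>j$); $\operatorname{rev}(\mathbbm{p})=(\operatorname{rev}(\mathbbm{p}_\ell),\ldots,\operatorname{rev}(\mathbbm{p}_1))$. Distances are graph distances $d$; a half-edge $h$ is directed toward a vertex or corner $v$ if $d(h^+,v)<d(h^-,v)$ (using the vertex of the corner). The leftmost geodesic from a half-edge or corner $h$ to a vertex or corner: consider all geodesics from $h^+$ to the target vertex, take the set of their first steps, and, turning clockwise around $h^+$ starting from $h$, select the first half-edge of this set met (possibly $\operatorname{rev}(h)$); iterate until the target is reached (the path may be empty). The rightmost geodesic is defined symmetrically turning counterclockwise. Slitting a map along a self-avoiding path $\mathbbm{p}$ from a corner $c$ (with $c^+=\mathbbm{p}_1^-$) to a corner $c'$ at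 its final vertex means cutting open along $\mathbbm{p}$, doubling each of its edges, the cut entering at $c$ and exiting at $c'$; this yields a left copy $\mathbbm{l}$ and a right copy $\mathbbm{r}$ of $\mathbbm{p}$. Sewing $\mathbbm{l}_{i\to j}$ onto $\mathbbm{r}_{i'\to j'}$ (same length) means identifying $\mathbbm{l}_{i+k}$ with $\mathbbm{r}_{i'+k}$ for each $k$. Marked corners of faces are carried along by the construction; the marked corner of a degree-$1$ face is its unique corner.
   Formalization: In Φ_right the sides of the slit are swapped: l is the right and r the left copy of p, and r_0 is the reverse of the half-edge incident to f_{r+1} (if p is empty, h=rev(r_0), v=r_0^-); as written h need not border f_1. In Φ_left, if [p']=1, l'_1^+ and r'_1^- are glued. *)

(* Defs.v *)
From HB Require Import structures.
From mathcomp Require Import all_boot fingroup perm.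

Set Implicit Arguments.
Unset Strict Implicit.
Unset Printing Implicit Defensive.

(* A plane map is encoded by its contours.  The elements of [dom] are the
   half-edges together with the marked corners, a corner being a half-edge
   without origin.  [rev] reverses half-edges and fixes corners.  [nxt] is the
   successor along the contour of the face lying to the left, so that its
   cycles are the faces; a marked corner is an element of the contour, sitting
   between the two half-edges (or corners) that delimit it, so it splits the
   corner it marks into two.  [lab] gives the (0-based) number of the face
   marked by a corner: label i stands for f_(i+1).
   Elements outside [dom] are leftovers of surgery. *)
Record pmap := PMap {
  elt : finType;
  dom : {set elt};
  rev : elt -> elt;
  nxt : elt -> elt;
  lab : elt -> option nat }.

Definition is_dart (m : pmap) (x : elt m) : bool :=
  (x \in dom m) && (rev x != x).

(* Clockwise rotation around a vertex: of half-edges around their origin, and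
   of corners around their end.  Indeed nxt (rev x) is the half-edge leaving the
   origin of x that borders the face to the left of rev x.  The vertices are the
   cycles of [cw]; a vertex is denoted by any element of its cycle, so that the
   origin of a half-edge x is denoted by x itself, while rev x denotes the end
   x^+ of x, be x a half-edge or a corner. *)
Definition cw (m : pmap) (x : elt m) : elt m := nxt (rev x).
Definition ccw (m : pmap) : elt m -> elt m := finv (@cw m).

Definition same_vertex (m : pmap) (x y : elt m) : bool := fconnect (@cw m) x y.
Definition same_face (m : pmap) (x y : elt m) : bool := fconnect (@nxt m) x y.

(* Planarity is Euler's relation #vertices + #faces = #edges + 2. *)
Record plane_map (m : pmap) : Prop := PlaneMap {
  _ : involutive (@rev m);
  _ : injective (@nxt m);
  _ : forall x : elt m, x \notin dom m -> rev x = x /\ nxt x = x;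
  _ : forall x : elt m, x \in dom m -> (rev x == x) = isSome (lab x);
  _ : forall x y : elt m, x \in dom m -> y \in dom m ->
      connect [rel u w | (w == rev u) || (w == nxt u)] x y;
  _ : fcard (@cw m) (mem (dom m)) + fcard (@nxt m) (mem (dom m)) =
      #|[set x : elt m | is_dart x]|./2 + 2 }.

Definition is_mark (m : pmap) (i : nat) (x : elt m) : bool :=
  (x \in dom m) && (lab x == Some i).

Definition in_face (m : pmap) (i : nat) (x : elt m) : bool :=
  (x \in dom m) && [exists y, is_mark i y && same_face x y].

Definition map_of_type (a : seq nat) (m : pmap) : Prop :=
  [/\ plane_map m,
      forall (x : elt m) i, is_mark i x -> i < size a,
      forall i, i < size a -> exists! x : elt m, is_mark i x,
      forall x : elt m, x \in dom m -> exists! i, in_face i x &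
      forall i, i < size a ->
        #|[set x : elt m | is_dart x && in_face i x]| = nth 0 a i].

Definition map_iso (m m' : pmap) (f : elt m -> elt m') : Prop :=
  [/\ {in dom m &, injective f},
      f @: dom m = dom m',
      {in dom m, forall x, f (rev x) = rev (f x)},
      {in dom m, forall x, f (nxt x) = nxt (f x)} &
      {in dom m, forall x, lab (f x) = lab x}].

(* [walk x p y]: p is a path of half-edges from the vertex of x to that of y. *)
Fixpoint walk (m : pmap) (x : elt m) (p : seq (elt m)) (y : elt m) : bool :=
  if p is e :: q then [&& is_dart e, same_vertex x e & walk (rev e) q y]
  else same_vertex x y.

Definition self_avoiding (m : pmap) (x : elt m) (p : seq (elt m)) : bool :=
  pairwise (fun y z => ~~ same_vertex y z) (x :: map (@rev m) p).

(* Graph distance: the least length of a path (which is less than the number of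
   vertices, hence than #|elt m|, as soon as there is a path). *)
Definition dist (m : pmap) (x y : elt m) : nat :=
  find (fun n => [exists p : n.-tuple (elt m), walk x p y]) (iota 0 #|elt m|).

Definition directed_toward (m : pmap) (h v : elt m) : bool :=
  dist (rev h) v < dist h v.

(* e is the first step of a geodesic from the vertex of x to that of y. *)
Definition first_step (m : pmap) (x y e : elt m) : bool :=
  [exists p : (dist x y).-tuple (elt m), walk x p y && (ohead p == Some e)].

(* [turn h] lists what is met around h^+ when turning from h: it is a whole
   cycle of [cw] or [ccw], ending with rev h. *)
Fixpoint extremal_path (m : pmap) (turn : elt m -> seq (elt m))
    (n : nat) (h y : elt m) : seq (elt m) :=
  if n is n'.+1 then
    let e := head h [seq e <- turn h | first_step (rev h) y e] in
    e :: extremal_path turn n' e y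
  else [::].

Definition leftmost (m : pmap) (h y : elt m) : seq (elt m) :=
  extremal_path (fun x => orbit (@cw m) (cw (rev x))) (dist (rev h) y) h y.

Definition rightmost (m : pmap) (h y : elt m) : seq (elt m) :=
  extremal_path (fun x => orbit (@ccw m) (ccw (rev x))) (dist (rev h) y) h y.

(* Keep only the elements of D: contours g skip the others. *)
Definition carve (T : finType) (D : {set T}) (rv g : T -> T)
    (lb : T -> option nat) : pmap :=
  PMap D (fun x => if x \in D then rv x else x)
         (fun x => if x \in D then head x [seq y <- orbit g (g x) | y \in D]
                   else x) lb.

(* Insert a corner [None], labelled o, right after s in the contour of s.
   Thus s denotes the corner delimited by s and nxt s. *)
Definition add_corner (m : pmap) (s : elt m) (o : option nat) : pmap :=
  @PMap (option (elt m))
    [set z | if z is Some x then x \in dom m else true]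
    (omap (@rev m))
    (fun z => if z is Some x then (if x == s then None else Some (nxt x))
              else Some (nxt s))
    (fun z => if z is Some x then lab x else o).

Definition delete_edge (m : pmap) (e : elt m) : pmap :=
  carve (dom m :\: [set e; rev e]) (@rev m) (@nxt m) (@lab m).

(* g with the successors along z0, s_1, ..., s_n, z1 redefined. *)
Definition thread (T : eqType) (z0 : T) (s : seq T) (z1 : T) (g : T -> T) :
    T -> T :=
  fun z => if z \in z0 :: s then nth z1 s (index z (z0 :: s)) else g z.

(* Slit m along the path p, entering at the corner c and exiting at the corner
   c' if oc = Some c', or stopping at the end of p, without disconnecting that
   vertex, if oc = None.  These corners are used up.  Every half-edge x of an
   edge of p is doubled: [inl x] keeps the face of x on its left while [inr x]
   borders the slit.  Hence the left copy of p is [map inl p], the right copy is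
   [map inr p], and inl x is now the reverse of inr (rev x).  The border of the
   slit consists of the right copy, and of the left one travelled backwards. *)
Definition slit (m : pmap) (c : elt m) (oc : option (elt m))
    (p : seq (elt m)) : pmap :=
  let T := (elt m + elt m)%type : finType in
  let doubled x := (x \in p) || (rev x \in p) in
  let rside : seq T := [seq inr x | x <- p] in
  let lside : seq T := [seq inr (rev x) | x <- seq.rev p] in
  let g0 (z : T) : T := if z is inl x then inl (nxt x) else z in
  let g : T -> T :=
    if oc is Some c' then
      thread (inl c) rside (inl (nxt c'))
        (thread (inl c') lside (inl (nxt c)) g0)
    else thread (inl c) (rside ++ lside) (inl (nxt c)) g0 in
  carve [set z : T | match z with
                     | inl x => [&& x \in dom m, x != c & oc != Some x]
                     | inr x => doubled x
                     end]
    (fun z : T => match z with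
                  | inl x => if doubled x then inr (rev x) else inl (rev x)
                  | inr x => inl (rev x)
                  end)
    g (fun z : T => if z is inl x then lab x else None).

(* Sew the path L onto the path R, two sides of a same face (the slit) lying to
   the right of L and to the left of R.  The half-edges L_k and R_k become one,
   denoted by L_k, and so do their reverses, denoted by rev R_k; thus the
   borders R_k and rev L_k of the slit disappear, and a contour arriving at one
   of them carries on after the other.  The origins of L and R, given by the
   corners of the slit that precede t and s, are first identified: this is
   implied by the identification of L_1 with R_1, but it has to be done when
   the paths are empty.  If s = t they already coincide. *)
Definition sew (m : pmap) (s t : elt m) (L R : seq (elt m)) : pmap :=
  let L' := map (@rev m) L in
  let mate z := if z \in L' then nth z R (index z L')
                else if z \in R then nth z L' (index z R) else z in
  let sewn z := (z \in L') || (z \in R) in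
  carve [set z in dom m | ~~ sewn z]
    (fun z => if sewn (rev z) then rev (mate (rev z)) else rev z)
    (fun z => tperm s t (nxt (mate z))) (@lab m).

(* (m; c), the corner c being the one delimited by s and nxt s. *)
Record cornered := Cornered { cmap : pmap; ccor : elt cmap }.

(* (m; v, h), the vertex v being denoted by any element of its cycle. *)
Record pointed := Pointed { vmap : pmap; vver : elt vmap; vhe : elt vmap }.

(* Maps are considered up to isomorphism. *)
Definition cornered_iso (X Y : cornered) : Prop :=
  exists2 f : elt (cmap X) -> elt (cmap Y),
    map_iso f & f (ccor X) = ccor Y.

Definition pointed_iso (X Y : pointed) : Prop :=
  exists2 f : elt (vmap X) -> elt (vmap Y),
    map_iso f & same_vertex (f (vver X)) (vver Y) /\ f (vhe X) = vhe Y.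

(* Below a = (a_1, ..., a_r). *)
Definition calM (a : seq nat) (X : cornered) : Prop :=
  map_of_type (rcons a 1) (cmap X) /\ in_face 0 (ccor X).

Definition calMt (a : seq nat) (Y : pointed) : Prop :=
  [/\ map_of_type (incr_nth a 0) (vmap Y),
      vver Y \in dom (vmap Y), is_dart (vhe Y), in_face 0 (vhe Y) &
      directed_toward (vhe Y) (vver Y)].

Definition right_m1 (X : cornered) : pmap := add_corner (ccor X) None.
Definition right_c (X : cornered) : elt (right_m1 X) := None.
(* The corner of f_(r+1), represented by its mark. *)
Definition right_c0 (r : nat) (X : cornered) : elt (right_m1 X) :=
  odflt (right_c X) [pick x : elt (right_m1 X) | is_mark r x].
Definition right_path (r : nat) (X : cornered) : seq (elt (right_m1 X)) :=
  rightmost (right_c0 r X) (right_c X).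

Definition right_slit (r : nat) (X : cornered) : pmap :=
  slit (right_c0 r X) (Some (right_c X)) (right_path r X).
(* The half-edge incident to f_(r+1); it comes after the marked corner. *)
Definition right_loop (r : nat) (X : cornered) : elt (right_slit r X) :=
  inl (nxt (right_c0 r X)).

(* The sides of the slit are named as they are seen when walking from c to
   f_(r+1), which is the direction of the path of the converse construction:
   [right_l] is on the right-hand side, and [right_r] on the left-hand side, of
   the path oriented from f_(r+1) to c.  The loop bounding f_(r+1) is oriented
   in such a way that it ends where [right_r] begins. *)
Definition right_l (r : nat) (X : cornered) : seq (elt (right_slit r X)) :=
  [seq inr x | x <- right_path r X].
Definition right_r (r : nat) (X : cornered) : seq (elt (right_slit r X)) :=
  [seq inl x | x <- right_path r X].
Definition right_r0 (r : nat) (X : cornered) : elt (right_slit r X) :=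
  rev (right_loop r X).

(* r_0, ..., r_([p]-1) receive l_1, ..., l_[p]; the vertices r_0^- and l_1^- are
   equal, and their corner in the slit comes after [right_loop]. *)
Definition right_sewn (r : nat) (X : cornered) : pmap :=
  sew (nxt (right_loop r X)) (nxt (right_loop r X))
    (belast (right_r0 r X) (right_r r X)) (right_l r X).

(* v = l_1^- = r_0^- and h = rev(r)_1 is the reverse of the last edge. *)
Definition Phi_right (r : nat) (X : cornered) : pointed :=
  @Pointed (right_sewn r X) (right_r0 r X)
    (@rev (right_sewn r X) (last (right_r0 r X) (right_r r X))).

(* The slit is made along a self-avoiding path with the required ends. *)
Definition right_legit (r : nat) (X : cornered) : Prop :=
  [/\ is_mark r (right_c0 r X),
      walk (rev (right_c0 r X)) (right_path r X) (right_c X) &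
      self_avoiding (rev (right_c0 r X)) (right_path r X)].

(* The distinguished corner h_0 sits between h and its predecessor. *)
Definition left_m1 (Y : pointed) : pmap :=
  add_corner (finv (@nxt (vmap Y)) (vhe Y)) None.
Definition left_h0 (Y : pointed) : elt (left_m1 Y) := None.
Definition left_v (Y : pointed) : elt (left_m1 Y) := Some (vver Y).
Definition left_path (Y : pointed) : seq (elt (left_m1 Y)) :=
  leftmost (left_h0 Y) (left_v Y).

Definition left_slit (Y : pointed) : pmap :=
  slit (left_h0 Y) None (left_path Y).
Definition left_l (Y : pointed) : seq (elt (left_slit Y)) :=
  [seq inl x | x <- left_path Y].
Definition left_r (Y : pointed) : seq (elt (left_slit Y)) :=
  [seq inr x | x <- left_path Y].
Definition left_l1 (Y : pointed) : elt (left_slit Y) :=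
  head (inl (Some (vhe Y))) (left_l Y).
Definition left_r1 (Y : pointed) : elt (left_slit Y) :=
  head (inr (Some (vhe Y))) (left_r Y).

(* l'_2, ..., l'_[p'] are sewn onto r'_1, ..., r'_([p']-1).  The slit, followed
   along its border, meets the vertex l'_1^+ right before rev l'_1. *)
Definition left_sewn (Y : pointed) : pmap :=
  sew (left_r1 Y) (rev (left_l1 Y))
    (behead (left_l Y)) (belast (left_r1 Y) (behead (left_r Y))).

(* The new face of degree 1 has r'_[p'] on its border; its corner is marked. *)
Definition left_loop (Y : pointed) : elt (left_sewn Y) :=
  last (left_r1 Y) (left_r Y).
Definition left_marked (r : nat) (Y : pointed) : pmap :=
  add_corner (left_loop Y) (Some r).
Definition left_dangling (r : nat) (Y : pointed) : elt (left_marked r Y) :=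
  Some (left_l1 Y).
Definition left_final (r : nat) (Y : pointed) : pmap :=
  delete_edge (left_dangling r Y).

(* In the contour of f_1, the dangling edge is met as rev l'_1, l'_1; the corner
   that it leaves comes after the predecessor of rev l'_1. *)
Definition Phi_left (r : nat) (Y : pointed) : cornered :=
  @Cornered (left_final r Y)
    (finv (@nxt (left_marked r Y)) (rev (left_dangling r Y))).

(* Moreover a face of degree 1 is created and the edge deleted is dangling. *)
Definition left_legit (r : nat) (Y : pointed) : Prop :=
  [/\ walk (rev (left_h0 Y)) (left_path Y) (left_v Y),
      self_avoiding (rev (left_h0 Y)) (left_path Y),
      left_path Y != [::],
      nxt (left_loop Y) = left_loop Y &
      is_dart (left_dangling r Y) /\
        cw (left_dangling r Y) = left_dangling r Y].

(* Main.v *)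
(* Both constructions are the same local change of the contours, read in opposite
   directions.  Let p_1, ..., p_l be the rightmost geodesic from the marked corner
   c0 of f_(r+1) to c, let q_k be the reverse of p_k, and let q_0 be the loop
   bounding f_(r+1), with reverse p_0.  Sliding one side of the geodesic by one
   step matches p_k with q_(k+1) for k < l and p_l with q_0, removes c0 from the
   contours, and inserts q_0 in the contour of f_1 at c.  Planarity is preserved:
   a face disappears and a vertex appears, as the q_k represent the vertices of the
   path before, and the p_k together with c those of the path after.

   The heart of the matter is that the slid path is again extremal, a leftmost
   geodesic from h to v, and conversely.  If F is the distance to c (or to v)
   before the surgery, then l + eps - F, where eps z in {0, 1} says on which side
   of the path z lies, is constant on the vertices of the other map and changes by
   at most one along its edges; this bounds from below the distances to the new
   target.  A competing geodesic would have to leave the path on the wrong side,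
   and the extremality of the original path prevents it from ever coming back.
   The other half of the argument is a uniqueness statement: the slid map
   determines the original one, and conversely, since extremal geodesics are
   determined by their ends. *)

From mathcomp Require Import all_boot perm zify.
Require Import Defs.

Set Implicit Arguments.
Unset Strict Implicit.
Unset Printing Implicit Defensive.

(** * Vertices, walks and distances *)

(** At the k-th vertex of the path, [q k] and [p k.+1] cut the rotation into two sectors. The
    surgery glues the sector that follows [q k] at one vertex to the sector that follows [p k.+2] at
    the next one: a new vertex is made of halves of two consecutive old ones. The old distance thus
    jumps by one inside each new vertex, and the correction [eps] has to compensate exactly for this
    jump. The obstacle is that an arc does not separate the sphere, so the side of the path has no
    meaning away from it. Reachability replaces it: [eps z] asks whether turning and descending from
    [z] can end on the arrival elements of the path. Extremality is what makes this notion constant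
    along each sector. The carriers produced by slitting and sewing are nested sums, so the two
    constructions are never composed. Each is compared with one abstract relation between two maps
    living on the same carrier, and that relation is shown to be functional in both directions up to
    isomorphism. *)

Record sound (m : pmap) : Prop := Sound {
  revK : involutive (@rev m);
  nxt_inj : injective (@nxt m);
  sound_out : forall x : elt m, x \notin dom m -> rev x = x /\ nxt x = x;
  sound_conn : forall x y : elt m, x \in dom m -> y \in dom m ->
      connect [rel u w | (w == rev u) || (w == nxt u)] x y }.

(** [plane_map] does not survive the insertion of the distinguished corner, an element fixed by
    [rev] that bears no label. [sound] retains what distances and geodesics rest on; labels and
    Euler's relation are treated separately. *)
Lemma plane_sound m : plane_map m -> sound m.
Proof. by case=> *; split. Qed.

Lemma fconnect_iter_ex (T : finType) (f : T -> T) x y :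
  fconnect f x y -> exists n, y = iter n f x.
Proof. by move=> /iter_findex <-; eexists. Qed.

Lemma fconnect_invariant (T : finType) (A : Type) (f : T -> T) (F : T -> A) x y :
  (forall z, F (f z) = F z) -> fconnect f x y -> F y = F x.
Proof. by move=> h /fconnect_iter_ex [n ->]; elim: n => //= n ih; rewrite h. Qed.

Section SoundTheory.
Variables (m : pmap) (hm : sound m).
Implicit Types (x y z e : elt m) (p : seq (elt m)).

Lemma rev_inj : injective (@rev m). Proof. exact: can_inj (revK hm). Qed.

Lemma cw_inj : injective (@cw m).
Proof. by move=> x y /(nxt_inj hm) /rev_inj. Qed.

Lemma rev_dom x : (rev x \in dom m) = (x \in dom m).
Proof.
have [hx|hx] := boolP (x \in dom m); last first.
  by rewrite (proj1 (sound_out hm hx)) (negPf hx).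
apply: contraTT hx => h; have [+ _] := sound_out hm h.
by rewrite (revK hm) => E; rewrite E.
Qed.

Lemma nxt_dom x : (nxt x \in dom m) = (x \in dom m).
Proof.
have [hx|hx] := boolP (x \in dom m); last first.
  by rewrite (proj2 (sound_out hm hx)) (negPf hx).
apply: contraTT hx => h; have [_ +] := sound_out hm h.
by move/(nxt_inj hm) => E; rewrite -E.
Qed.

Lemma cw_dom x : (cw x \in dom m) = (x \in dom m).
Proof. by rewrite /cw nxt_dom rev_dom. Qed.

Lemma ccwK : cancel (@ccw m) (@cw m). Proof. exact: (f_finv cw_inj). Qed.
Lemma cwK : cancel (@cw m) (@ccw m). Proof. exact: (finv_f cw_inj). Qed.

Lemma same_vertex_refl x : same_vertex x x. Proof. exact: connect0. Qed.
Lemma same_vertex_sym x y : same_vertex x y = same_vertex y x.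
Proof. exact: (fconnect_sym cw_inj). Qed.
Lemma same_vertex_trans x y z :
  same_vertex x y -> same_vertex y z -> same_vertex x z.
Proof. exact: connect_trans. Qed.
Lemma same_vertex_l x y z : same_vertex x y -> same_vertex x z = same_vertex y z.
Proof. by move=> h; apply: (same_connect (fconnect_sym cw_inj)). Qed.
Lemma same_vertex_r x y z : same_vertex x y -> same_vertex z x = same_vertex z y.
Proof. by move=> h; apply: (same_connect_r (fconnect_sym cw_inj)). Qed.
Lemma same_vertex_cw x : same_vertex x (cw x). Proof. exact: fconnect1. Qed.
Lemma same_vertex_iter n x : same_vertex x (iter n (@cw m) x).
Proof. exact: fconnect_iter. Qed.

Lemma same_vertex_dom x y : same_vertex x y -> (x \in dom m) = (y \in dom m).
Proof.
move=> h; symmetry.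
exact: (fconnect_invariant (F := fun z => z \in dom m) cw_dom h).
Qed.

Lemma dart_dom e : is_dart e -> e \in dom m. Proof. by case/andP. Qed.
Lemma dart_rev e : is_dart (rev e) = is_dart e.
Proof. by rewrite /is_dart rev_dom (revK hm) eq_sym. Qed.

Lemma walk_l x x' p y : same_vertex x x' -> walk x p y = walk x' p y.
Proof. by case: p => [|e p] /= h; rewrite (same_vertex_l _ h). Qed.

Lemma walk_r x p y y' : same_vertex y y' -> walk x p y = walk x p y'.
Proof.
move=> h; elim: p x => [|e p ih] x /=; first exact: same_vertex_r.
by rewrite ih.
Qed.

(** Connectedness is expressed with [rev] and [nxt]. A step by [rev] traverses a half-edge, or stays
    put at a corner; a step by [nxt] traverses it and then turns, because [nxt x] is
    [cw (rev x)]. *)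
Lemma walk_ex x y : x \in dom m -> y \in dom m -> exists p, walk x p y.
Proof.
move=> hx hy; have /connectP [s] := sound_conn hm hx hy.
elim: s x hx => [|z s ih] x hx /= => [_ ->|/andP [/orP [] /eqP -> hs] hl].
- by exists [::]; rewrite /= same_vertex_refl.
- have [|p hp] := ih _ _ hs hl; first by rewrite rev_dom.
  have [hd|hd] := boolP (is_dart x); last first.
    exists p; move: hd hp; rewrite /is_dart hx negbK /= => /eqP {1}->; exact: id.
  by exists (x :: p); rewrite /= hd same_vertex_refl.
- have [|p hp] := ih _ _ hs hl; first by rewrite nxt_dom.
  have e1 : walk (rev x) p y.
    by rewrite (walk_l p y (same_vertex_cw (rev x))) /cw (revK hm).
  have [hd|hd] := boolP (is_dart x).
    by exists (x :: p); rewrite /= hd same_vertex_refl.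
  exists p; move: hd e1; rewrite /is_dart hx negbK /= => /eqP {1}->; exact: id.
Qed.

(** Turns a walk into a path of elements, namely the reverses of its half-edges; in this form
    repetitions can be removed by [shortenP]. *)
Definition adj x y : bool :=
  [exists e, [&& is_dart e, same_vertex x e & y == rev e]].

Lemma walk_path x p y : walk x p y ->
  exists2 s, path adj x s /\ same_vertex (last x s) y & size s = size p.
Proof.
elim: p x => [|e p ih] x /=; first by exists [::].
case/and3P=> h1 h2 /ih [s [h3 h4] h5]; exists (rev e :: s) => /=; last by rewrite h5.
by rewrite h3 h4; split=> //; rewrite andbT; apply/existsP; exists e; rewrite h1 h2 eqxx.
Qed.

Lemma path_walk x s y : path adj x s -> same_vertex (last x s) y ->
  exists2 p, walk x p y & size p = size s.
Proof.
elim: s x => [|z s ih] x /=; first by exists [::].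
case/andP=> /existsP [e /and3P [h1 h2 /eqP ->]] h3 /(ih _ h3) [p h4 h5].
by exists (e :: p); rewrite /= ?h1 ?h2 ?h5.
Qed.

Lemma dist_le x p y : walk x p y -> dist x y <= size p.
Proof.
move=> hp; rewrite /dist; set P := (X in find X _); set N := #|elt m|.
(* A walk longer than the range searched by [dist] satisfies the bound trivially, since [find] never
   exceeds the length of that range. *)
have [hN|hN] := ltnP (size p) N; last first.
  by apply: leq_trans hN; rewrite -{2}(size_iota 0 N) find_size.
rewrite leqNgt; apply/negP => /(before_find 0) /negbT/negP; apply.
rewrite nth_iota //; apply/existsP; exists (in_tuple p); exact: hp.
Qed.

Lemma dist_walk x y : x \in dom m -> y \in dom m ->
  exists2 p, walk x p y & size p = dist x y.
Proof.
move=> hx hy; have [p0 /walk_path [s0 [hs0 hl0] _]] := walk_ex hx hy.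
(* Without repetitions the walk is shorter than the number of elements, hence within the range that
   [dist] searches. *)
case/shortenP: hs0 hl0 => s hs hu _ /(path_walk hs) [p hp hsz].
have hN : size p < #|elt m|.
  by rewrite hsz; have := max_card (mem (x :: s)); rewrite (card_uniqP hu).
rewrite /dist; set P := (X in find X _); set N := #|elt m| in hN *.
have hh : has P (iota 0 N).
  apply/hasP; exists (size p); first by rewrite mem_iota.
  by apply/existsP; exists (in_tuple p); exact: hp.
have := nth_find 0 hh; rewrite nth_iota ?add0n; last first.
  by move: hh; rewrite has_find size_iota.
by case/existsP=> q hq; exists q => //; rewrite size_tuple.
Qed.

Lemma dist_eq0 x y : x \in dom m -> y \in dom m ->
  (dist x y == 0) = same_vertex x y.
Proof.
move=> hx hy; apply/idP/idP => h; last first.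
  by rewrite -leqn0; apply: (@dist_le x [::]).
by have [[|//]] := dist_walk hx hy; rewrite (eqP h).
Qed.

Lemma dist_l x x' y : same_vertex x x' -> dist x y = dist x' y.
Proof.
move=> h; rewrite /dist; apply: eq_find => n; apply: eq_existsb => p.
exact: walk_l.
Qed.

Lemma dist_r x y y' : same_vertex y y' -> dist x y = dist x y'.
Proof.
move=> h; rewrite /dist; apply: eq_find => n; apply: eq_existsb => p.
exact: walk_r.
Qed.

Lemma dist_cw x y : dist (cw x) y = dist x y.
Proof. by apply: dist_l; rewrite same_vertex_sym same_vertex_cw. Qed.

Lemma dist_rev x y : x \in dom m -> y \in dom m -> dist x y <= (dist (rev x) y).+1.
Proof.
move=> hx hy; have [h|] := eqVneq (rev x) x; first by rewrite h.
move=> h; have hr : rev x \in dom m by rewrite rev_dom.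
have [p hp <-] := dist_walk hr hy.
by apply: (@dist_le x (x :: p)); rewrite /= hp /is_dart hx h same_vertex_refl.
Qed.

Lemma directed_dart e y : directed_toward e y -> is_dart e.
Proof.
rewrite /directed_toward /is_dart => h; apply/andP; split.
  by apply: contraLR h => /(sound_out hm) [-> _]; rewrite ltnn.
by apply: contraTneq h => ->; rewrite ltnn.
Qed.

(** Replaces the existence of a geodesic by a comparison of two distances, so that extremal paths
    can be described locally. A geodesic from [rev e] preceded by [e] has the right length because
    distances drop by at most one along [e]. *)
Lemma first_stepE x y e : x \in dom m -> y \in dom m -> same_vertex x e ->
  first_step x y e = directed_toward e y.
Proof.
move=> hx hy he; have he' : e \in dom m by rewrite -(same_vertex_dom he).
apply/existsP/idP => [[p] /andP [hp ho]|h].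
  case: p hp ho => [[|e' p]] //= /eqP sz /and3P [h1 h2 h3] /eqP [E].
  rewrite /directed_toward -(dist_l y he) -E (leq_ltn_trans (dist_le h3)) //.
  by rewrite -sz.
have [p hp hs] := @dist_walk (rev e) y (etrans (rev_dom e) he') hy.
have hsz : size (e :: p) == dist x y.
  rewrite /= hs eqn_leq (dist_l y he) (dist_rev he' hy).
  by move: h; rewrite /directed_toward => ->.
exists (Tuple hsz); rewrite /= eqxx andbT hp he; by rewrite (directed_dart h).
Qed.

End SoundTheory.

(** * Extremal geodesics *)

(** The search begins one step after [x], and [x] itself is examined only after a full turn: this is
    how [rev h] comes last when turning from [h]. *)
Definition first_after (T : Type) (g : T -> T) (P : pred T) (x e : T) : Prop :=
  exists n, [/\ e = iter n.+1 g x, P e & forall i, i < n -> ~~ P (iter i.+1 g x)].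

Lemma first_after_uniq (T : Type) (g : T -> T) (P : pred T) x e e' :
  first_after g P x e -> first_after g P x e' -> e = e'.
Proof.
case=> n [-> h1 h2] [n' [-> h1' h2']].
have [h|h|->//] := ltngtP n n'.
  by case/negP: (h2' _ h).
by case/negP: (h2 _ h).
Qed.

Lemma head_filter_nth (T : Type) (P : pred T) h s :
  head h (filter P s) = nth h s (find P s).
Proof. by elim: s => //= x s ih; case: (P x). Qed.

Lemma first_after_head (T : finType) (g : T -> T) (P : pred T) x y h :
  injective g -> fconnect g x y -> P y ->
  first_after g P x (head h [seq e <- orbit g (g x) | P e]).
Proof.
move=> gi hy Py; rewrite head_filter_nth; set s := orbit g (g x).
have hh : has P s.
  by apply/hasP; exists y => //; rewrite -fconnect_orbit -same_fconnect1.
have hnth i : i < size s -> nth h s i = iter i.+1 g x.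
  move=> hi; rewrite (set_nth_default (g x)) //.
  by move: hi; rewrite size_orbit /s /orbit => hi; rewrite nth_traject // -iterSr.
exists (find P s); split.
- by rewrite hnth -?has_find.
- exact: nth_find.
- move=> i hi; rewrite -hnth; last by rewrite (leq_trans hi) ?find_size.
  by rewrite (before_find _ hi).
Qed.

Lemma first_after_eq (T : Type) (g : T -> T) (P P' : pred T) x e :
  (forall n, P (iter n.+1 g x) = P' (iter n.+1 g x)) ->
  first_after g P x e -> first_after g P' x e.
Proof.
move=> hP [n [-> h1 h2]]; exists n; split=> //; first by rewrite -hP.
by move=> i /h2; rewrite hP.
Qed.

(** Extremal geodesics without lengths or lists of candidates: [g] is [cw] for leftmost ones and
    [ccw] for rightmost ones. The path starts around the end of [h], which may be a corner. *)
Fixpoint steered (m : pmap) (g : elt m -> elt m) (y h : elt m) (p : seq (elt m)) :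
    Prop :=
  if p is e :: q then
    first_after g (fun z => directed_toward z y) (rev h) e /\ steered g y e q
  else same_vertex (rev h) y.

Lemma steeredP (m : pmap) (g : elt m -> elt m) y h p :
  steered g y h p <->
  (forall k, k < size p ->
     first_after g (fun z => directed_toward z y) (rev (nth h (h :: p) k)) (nth h p k)) /\
  same_vertex (rev (last h p)) y.
Proof.
elim: p h => [|e p ih] h /=; first by split=> // [] [].
rewrite ih; split=> [[h1 [h2 h3]]|[h1 h2]].
  split=> // [] [|k] //= hk; have := h2 _ hk.
  by rewrite !(set_nth_default h) //= ltnS ltnW.
split; first exact: (h1 0).
split=> // k hk; have := h1 k.+1 hk.
by rewrite /= !(set_nth_default e) //= ltnS ltnW.
Qed.

Section Steered.
Variables (m : pmap) (hm : sound m) (g : elt m -> elt m).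
Hypotheses (gi : injective g) (gE : fconnect g =2 @same_vertex m).
Variables (y : elt m) (hy : y \in dom m).
Implicit Types (x z e h : elt m) (p : seq (elt m)).

Lemma directed_ex x : x \in dom m -> 0 < dist x y ->
  exists2 e, same_vertex x e & directed_toward e y.
Proof.
move=> hx h0; have [p hp hs] := dist_walk hm hx hy.
case: p hp hs => [|e p] /=; first by move=> _ h; rewrite -h in h0.
case/and3P=> h1 h2 h3 h4; exists e => //.
by rewrite /directed_toward -(dist_l hm y h2) -h4 ltnS (dist_le h3).
Qed.

Lemma directed_dist e n : directed_toward e y -> dist e y = n.+1 -> dist (rev e) y = n.
Proof.
move=> h1 h2; have := dist_rev hm (dart_dom (directed_dart hm h1)) hy.
by move: h1; rewrite /directed_toward h2 !ltnS => h3 h4; apply/eqP; rewrite eqn_leq h3.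
Qed.

Lemma first_after_vertex P x e : first_after g P x e -> same_vertex x e.
Proof. by case=> n [-> _ _]; rewrite -gE fconnect_iter. Qed.

Lemma extremal_steered h : h \in dom m ->
  steered g y h
    (extremal_path (fun x => orbit g (g (rev x))) (dist (rev h) y) h y).
Proof.
move En: (dist (rev h) y) => n; elim: n h En => [|n ih] h hn hd /=.
  by rewrite -(dist_eq0 hm) ?rev_dom ?hn.
have hd' : rev h \in dom m by rewrite rev_dom.
have [||e0 h1 h2] := @directed_ex (rev h); rewrite ?rev_dom ?hn //.
set e := head _ _; have fa : first_after g (fun z => directed_toward z y) (rev h) e.
  apply: (@first_after_eq _ _ (first_step (rev h) y)) => [k|].
    by rewrite (first_stepE hm) // -gE fconnect_iter.
  by apply: (first_after_head _ gi (y := e0)); rewrite ?gE // first_stepE.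
split=> //; have he := first_after_vertex fa.
have hde : directed_toward e y by case: fa => k [].
apply: ih; last by rewrite -(same_vertex_dom hm he).
by apply: directed_dist hde _; rewrite -(dist_l hm y he).
Qed.

(** Each step is forced by [first_after_uniq], and the stopping time too, since no half-edge leaving
    the target vertex can be directed toward it. *)
Lemma steered_uniq h p p' : h \in dom m ->
  steered g y h p -> steered g y h p' -> p = p'.
Proof.
have aux h1 e q : steered g y h1 (e :: q) -> same_vertex (rev h1) y ->
    h1 \in dom m -> False.
  case=> fa _ hv hd; have := first_after_vertex fa; case: fa => n [_ hde _] hv'.
  have hd' : rev h1 \in dom m by rewrite rev_dom.
  move: hde; rewrite /directed_toward -(dist_l hm y hv').
  by have := dist_eq0 hm hd' hy; rewrite hv => /eqP ->.
elim: p h p' => [|e p ih] h [|e' p'] hd h1 h2 //.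
- by case: (aux _ _ _ h2 h1 hd).
- by case: (aux _ _ _ h1 h2 hd).
case: h1 h2 => fa1 h1 [fa2 h2].
have E := first_after_uniq fa1 fa2; rewrite -E in h2 *.
rewrite (ih _ _ _ h1 h2) //.
by case: fa1 => n [_ /(directed_dart hm)/dart_dom].
Qed.

Lemma steered_size h p : h \in dom m -> steered g y h p -> size p = dist (rev h) y.
Proof.
elim: p h => [|e p ih] h hd /=.
  by move=> hv; apply/esym/eqP; rewrite (dist_eq0 hm) ?rev_dom.
case=> fa /ih ->; last by case: fa => n [_ /(directed_dart hm)/dart_dom].
have hv := first_after_vertex fa; rewrite (dist_l hm y hv); case: fa => n [_ hde _].
case E: (dist e y) => [|k]; first by move: hde; rewrite /directed_toward E.
by rewrite (directed_dist hde E).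
Qed.

Lemma steered_walk h p : steered g y h p -> walk (rev h) p y.
Proof.
elim: p h => [|e p ih] h //= [fa /ih ->].
by rewrite (first_after_vertex fa); case: fa => n [_ /(directed_dart hm) ->].
Qed.

Lemma steered_lt h p : h \in dom m -> steered g y h p ->
  all (fun z => dist (rev z) y < dist (rev h) y) p.
Proof.
elim: p h => [|e p ih] h hd //= [fa hs].
have hde : directed_toward e y by case: fa => n [].
have lt : dist (rev e) y < dist (rev h) y.
  by rewrite (dist_l hm y (first_after_vertex fa)).
rewrite lt; apply: sub_all (ih _ _ hs); last exact: dart_dom (directed_dart hm hde).
by move=> z /ltn_trans; apply.
Qed.

(** The distance to the target decreases strictly along the path and depends only on the vertex. *)
Lemma steered_avoiding h p : h \in dom m -> steered g y h p ->
  self_avoiding (rev h) p.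
Proof.
rewrite /self_avoiding; elim: p h => [|e p ih] h hd // hs.
rewrite map_cons pairwise_cons ih; last by case: hs.
- have := steered_lt hd hs; rewrite andbT -map_cons all_map; apply: sub_all => z /=.
  by apply: contraTN => /(dist_l hm y) ->; rewrite ltnn.
- by case: hs => [[n [_ /(directed_dart hm)/dart_dom]]].
Qed.

Lemma steered_dist h p k : h \in dom m -> steered g y h p -> k <= size p ->
  dist (rev (nth h (h :: p) k)) y = size p - k.
Proof.
elim: p h k => [|e p ih] h [|k] hd hs hk //; rewrite ?subn0.
- by rewrite (steered_size hd hs).
- by rewrite (steered_size hd hs).
- case: hs => fa hs; have he : e \in dom m.
    by case: fa => n [_ /(directed_dart hm)/dart_dom].
  have := ih e k he hs hk; rewrite subSS => <-; congr (dist (rev _) _) => /=.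
  by rewrite (set_nth_default e) /= ?ltnS.
Qed.

End Steered.

Lemma cw_same_vertex m : fconnect (@cw m) =2 @same_vertex m. Proof. by []. Qed.

Lemma ccw_inj m : sound m -> injective (@ccw m).
Proof. by move=> hm; apply: (finv_inj (cw_inj hm)). Qed.

Lemma ccw_same_vertex m : sound m -> fconnect (@ccw m) =2 @same_vertex m.
Proof. by move=> hm x y; rewrite /ccw (same_fconnect_finv (cw_inj hm)). Qed.

Lemma leftmost_steered m (h y : elt m) : sound m -> h \in dom m -> y \in dom m ->
  steered (@cw m) y h (leftmost h y).
Proof.
by move=> hm hh hy; apply: (extremal_steered hm (cw_inj hm)) => //.
Qed.

Lemma rightmost_steered m (h y : elt m) : sound m -> h \in dom m -> y \in dom m ->
  steered (@ccw m) y h (rightmost h y).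
Proof.
move=> hm hh hy.
by apply: (extremal_steered hm (ccw_inj hm) (ccw_same_vertex hm)).
Qed.

(** * The potential of the surgery *)

(* [sg] and [ta] are [cw] and [rev], and A and Z consist of what the surgery
   changes: A holds c and the p_k with k > 0, and Z holds c0, p_0 and the q_k.
   [eps z] says that turning from z, possibly crossing
   edges that get closer to the target, leads to A; it tells which side of the
   path z lies on.  [shifted] is the potential in the other map. *)
Section Potential.
Variables (T : finType) (A Z : pred T) (sg ta : T -> T) (F : T -> nat) (L : nat).
Let K := predU A Z.
Let desc z := F (ta z) < F z.
Hypotheses (sg_inj : injective sg) (AZ : forall z, A z -> ~~ Z z).
Hypotheses (F_sg : forall z, F (sg z) = F z)
           (F_ta : forall z, ~~ K z -> F z <= (F (ta z)).+1).
Hypotheses (taK : forall z, ~~ K z -> ta (ta z) = z)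
           (K_ta : forall z, ~~ K z -> ~~ K (ta z)).
Hypothesis no_desc : forall z n, desc z ->
  (forall j, j <= n -> ~~ K (iter j sg z)) -> ~~ Z (iter n.+1 sg z).

(** Steps leave only from outside [K], so a chain ends as soon as it touches the path. All that is
    retained of extremality is [no_desc]: when one turns from a descending element outside [K], the
    first element of [K] met is not in [Z]. *)
Definition eps_step : rel T := fun z w =>
  ~~ K z && ((w == sg z) || (F (ta z) < F z) && (w == ta z)).

Definition eps z : bool := [exists a, A a && connect eps_step z a].

Lemma eps_A z : A z -> eps z.
Proof. by move=> h; apply/existsP; exists z; rewrite h connect0. Qed.

Lemma eps_Z z : Z z -> ~~ eps z.
Proof.
move=> h; apply/existsP => - [a /andP [ha /connectP [[|w s]]]] /=.
  by move=> _ E; move: (AZ ha); rewrite E h.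
by rewrite /eps_step /K /= h orbT.
Qed.

Lemma eps_stepP z w : eps_step z w -> eps w -> eps z.
Proof.
move=> h /existsP [a /andP [ha hc]]; apply/existsP; exists a.
by rewrite ha (connect_trans (connect1 h)).
Qed.

Lemma eps_sgW z : ~~ K z -> eps (sg z) -> eps z.
Proof. by move=> h; apply: eps_stepP; rewrite /eps_step h eqxx. Qed.

Lemma eps_ta z : ~~ K z -> desc z -> eps (ta z) -> eps z.
Proof. by move=> h hd; apply: eps_stepP; rewrite /eps_step h -/(desc z) hd eqxx orbT. Qed.

Lemma eps_iterW z n : (forall j, j < n -> ~~ K (iter j sg z)) ->
  eps (iter n sg z) -> eps z.
Proof.
elim: n => [|n ih] // h1 h2; apply: ih => [j hj|]; first by apply: h1; apply: ltnW.
exact: (eps_sgW (h1 n (ltnSn n)) h2).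
Qed.

(** The point is that turning does not lose [eps]. Consider the first element of [K] met when
    turning from [z]. If there is none, the turn from [sg z] comes back to [z]. If it is in [A], it
    is reached from [sg z] too. If it is in [Z], then [z] does not descend, so any chain from [z] to
    [A] starts by turning. *)
Lemma eps_sg z : ~~ K z -> eps (sg z) = eps z.
Proof.
move=> hz; apply/idP/idP; first exact: eps_sgW.
move=> he.
pose hit n := K (iter n.+1 sg z).
have [/existsP [n0 hn0]|hno] := boolP [exists n : 'I_(order sg z), hit n]; last first.
  have ho : 0 < order sg z by rewrite order_gt0.
  apply: (@eps_iterW (sg z) (order sg z).-1) => [j hj|]; last first.
    by rewrite -iterSr prednK // iter_order.
  rewrite -iterSr; move: hno; rewrite negb_exists => /forallP.
  have hj' : j < order sg z by lia.
  exact: (fun H => H (Ordinal hj')).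
have hex : exists n, hit n by exists n0.
case: (ex_minnP hex) => n hn hmin.
have hfree j : j <= n -> ~~ K (iter j sg z).
  case: j => [|j] // hj; apply/negP => /(hmin j); lia.
case/orP: hn => [hA|hZ].
  apply: (@eps_iterW _ n) => [j hj|]; first by rewrite -iterSr hfree.
  by rewrite -iterSr; apply: eps_A.
case/existsP: he => a /andP [ha /connectP [[|w s]]] /=.
  by move=> _ E; move: hz; rewrite /K /= -E ha.
case/andP=> /andP [_ /orP [/eqP -> |/andP [hd _]]] hp hl.
  by apply/existsP; exists a; rewrite ha; apply/connectP; exists s.
by case/negP: (no_desc hd hfree).
Qed.

Lemma eps_iter z n : (forall j, j < n -> ~~ K (iter j sg z)) ->
  eps (iter n sg z) = eps z.
Proof.
elim: n => [|n ih] // h1; rewrite iterS eps_sg ?h1 //.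
by apply: ih => j hj; apply: h1; apply: ltnW.
Qed.

Definition shifted z := L + eps z - F z.

Lemma shifted_sg z : ~~ K z -> shifted (sg z) = shifted z.
Proof. by move=> h; rewrite /shifted F_sg eps_sg. Qed.

Lemma eps_le z : ~~ K z -> F (ta z) < F z -> eps (ta z) <= eps z.
Proof.
move=> hz hd; case E: (eps (ta z)) => //.
by rewrite (eps_ta hz hd E).
Qed.

(** [F] and [eps] may each contribute a change of one, but not in the same bad direction: if [F]
    rises from [z] to [ta z], then [ta z] descends to [z], so [eps z] implies [eps (ta z)]. *)
Lemma shifted_ta z : ~~ K z -> shifted z <= (shifted (ta z)).+1.
Proof.
move=> hz; rewrite /shifted; have hz' := K_ta hz.
have h1 := F_ta hz; have := F_ta hz'; rewrite (taK hz) => h2.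
have h3 : F z < F (ta z) -> eps z <= eps (ta z).
  by move=> h; rewrite -{1}(taK hz); apply: (eps_le hz'); rewrite taK.
have := leq_b1 (eps z); have := leq_b1 (eps (ta z)).
case: (ltngtP (F z) (F (ta z))) => [/h3||]; lia.
Qed.

(* The extremality hypothesis [no_desc] keeps what tends to the target without
   reaching A away from the vertices of K. *)
Lemma shifted_trap z : ~~ K z -> ~~ eps z -> shifted (ta z) < shifted z ->
  ~~ eps (ta z) /\ forall n, ~~ K (iter n sg (ta z)).
Proof.
move=> hz he; have hz' := K_ta hz; rewrite /shifted (negPf he) addn0 => hlt.
have := F_ta hz'; rewrite (taK hz) => h2.
have hF : F z < F (ta z) by lia.
have he' : ~~ eps (ta z) by apply/negP => h; rewrite h in hlt; lia.
split=> //; elim/ltn_ind => -[|n] // ih.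
apply/negP => /orP [/eps_A|].
  rewrite eps_iter; first exact/negP.
  by move=> j hj; apply: ih.
apply/negP; apply: no_desc; first by rewrite /desc taK.
by move=> j hj; apply: ih.
Qed.

End Potential.

(** The source of all lower bounds on distances in the new map, with [f] vanishing at the new
    target. *)
Lemma walk_potential (m : pmap) (f : elt m -> nat) x p y :
  (forall z, f (cw z) = f z) -> (forall z, is_dart z -> f z <= (f (rev z)).+1) ->
  walk x p y -> f x <= size p + f y.
Proof.
move=> h1 h2; have hv z w : same_vertex z w -> f w = f z by apply: fconnect_invariant.
elim: p x => [|e p ih] x /=; first by move/hv->.
case/and3P=> /h2 h3 /hv <- /ih; lia.
Qed.

(** * Positions from which no walk of minimal length reaches the target *)

Section Trap.
Variables (m : pmap) (A Z : pred (elt m)) (sg ta : elt m -> elt m).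
Variables (F f : elt m -> nat) (L : nat).
Let K := predU A Z.
Let desc z := F (ta z) < F z.
Hypotheses (sg_inj : injective sg) (AZ : forall z, A z -> ~~ Z z).
Hypotheses (F_sg : forall z, F (sg z) = F z)
           (F_ta : forall z, ~~ K z -> F z <= (F (ta z)).+1).
Hypotheses (taK : forall z, ~~ K z -> ta (ta z) = z)
           (K_ta : forall z, ~~ K z -> ~~ K (ta z)).
Hypothesis no_desc : forall z n, desc z ->
  (forall j, j <= n -> ~~ K (iter j sg z)) -> ~~ Z (iter n.+1 sg z).
Hypotheses (f_cw : forall z, f (cw z) = f z)
           (f_rev : forall z, is_dart z -> f z <= (f (rev z)).+1).
Hypotheses (cwE : forall z, ~~ K z -> cw z = sg z)
           (revE : forall z, ~~ K z -> rev z = ta z)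
           (fE : forall z, ~~ K z -> f z = shifted A Z sg ta F L z).
Variable y : elt m.
Hypotheses (fy : f y = 0) (Ky : forall x, (forall n, ~~ K (iter n (@cw m) x)) ->
  ~~ same_vertex x y).
Let eps := eps A Z sg ta F.

Lemma iter_cwE x n : (forall j, j < n -> ~~ K (iter j sg x)) ->
  iter n (@cw m) x = iter n sg x.
Proof.
elim: n => // n ih h; rewrite !iterS ih; last by move=> j hj; apply: h; apply: ltnW.
by rewrite cwE // h.
Qed.

(** A walk of length at most [f x] to a zero of [f] must lower [f] at every step. By [shifted_trap],
    such a step from a vertex off the path where [eps] fails leads to another vertex of the same
    kind, and [y] is not at such a vertex. *)
Lemma trapped p x : ~~ eps x -> (forall n, ~~ K (iter n sg x)) ->
  size p <= f x -> ~~ walk x p y.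
Proof.
have hE z : (forall n, ~~ K (iter n sg z)) -> forall n, iter n (@cw m) z = iter n sg z.
  by move=> h n; apply: iter_cwE.
elim: p x => [|e p ih] x he hK hs.
  by apply: Ky => n; rewrite hE.
apply/negP => /= /and3P [h1 h2 h3].
have hfx := fconnect_invariant f_cw h2.
have := walk_potential f_cw f_rev h3; rewrite fy addn0 => h4.
have [n En] := fconnect_iter_ex h2; rewrite hE // in En.
have hKe : ~~ K e by rewrite En.
have hee : ~~ eps e.
  by rewrite En /eps (eps_iter sg_inj no_desc).
have hlt : f (rev e) < f e by move: hs => /=; lia.
rewrite (revE hKe) in hlt h3 h4.
rewrite !fE ?K_ta // in hlt.
have [h5 h6] := shifted_trap sg_inj F_ta taK K_ta no_desc hKe hee hlt.
move: h3; apply/negP; apply: ih => //.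
rewrite -hfx in hs; have := f_rev h1; rewrite (revE hKe); move: hs => /=; lia.
Qed.

(** Here the walk may leave from a vertex of the path, as long as its first half-edge [z] is outside
    [K]. This is what discards a competing geodesic that leaves the path on the wrong side. *)
Lemma trapped_dart p z : ~~ K z -> ~~ eps z -> is_dart z -> size p < f z ->
  ~~ walk (rev z) p y.
Proof.
move=> hK he hd hs; have h := f_rev hd.
apply/negP => hw; have := walk_potential f_cw f_rev hw; rewrite fy addn0 => hs'.
have hlt : f (rev z) < f z by lia.
rewrite (revE hK) !fE ?K_ta // in hlt.
have [h5 h6] := shifted_trap sg_inj F_ta taK K_ta no_desc hK he hlt.
by move: hw; apply/negP; rewrite (revE hK); apply: trapped => //; rewrite -(revE hK); lia.
Qed.

End Trap.

(** * Slid maps and their vertices *)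

(** The cycles that avoid [K] are common to [f] and [g]. Those that meet [K] are counted by systems
    of representatives, [R] for [f] and [S] for [g]. *)
Lemma fcard_reps (T : finType) (f g : T -> T) (D E K : pred T) (R S : seq T) :
  injective f -> injective g ->
  (forall z, D (f z) = D z) -> (forall z, E (g z) = E z) ->
  (forall z, ~~ K z -> f z = g z /\ D z = E z) ->
  uniq R -> all K R -> all D R -> {in R &, forall x y, fconnect f x y -> x = y} ->
  (forall z, D z -> K z -> exists2 r, r \in R & fconnect f z r) ->
  uniq S -> all K S -> all E S -> {in S &, forall x y, fconnect g x y -> x = y} ->
  (forall z, E z -> K z -> exists2 r, r \in S & fconnect g z r) ->
  fcard f D + size S = fcard g E + size R.
Proof.
pose M (h : T -> T) := [pred x | [exists z, K z && fconnect h x z]].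
have aux h (B : pred T) Q : injective h -> (forall z, B (h z) = B z) ->
    uniq Q -> all K Q -> all B Q ->
    {in Q &, forall x y, fconnect h x y -> x = y} ->
    (forall z, B z -> K z -> exists2 r, r \in Q & fconnect h z r) ->
    fcard h B = size Q + #|[pred x | [&& froots h x, B x & ~~ M h x]]|.
  move=> hi hB uQ KQ BQ sepQ repQ; have sym := fconnect_sym hi.
  have Bc x y : fconnect h x y -> B y = B x by apply: fconnect_invariant.
  rewrite /n_comp_mem.
  rewrite -(cardID (M h)); congr (_ + _); last first.
    by apply: eq_card => x; rewrite !inE /= andbC -andbA.
  have uQ' : uniq (map (froot h) Q).
    rewrite map_inj_in_uniq // => x y hx hy /eqP; rewrite root_connect //.
    exact: sepQ.
  rewrite -(size_map (froot h)) -(card_uniqP uQ').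
  apply: eq_card => x; rewrite !inE; apply/idP/mapP.
    case/andP=> /andP [hx hBx] /existsP [z /andP [Kz hz]].
    have [r hr1 hr2] := repQ z (etrans (Bc _ _ hz) hBx) Kz.
    exists r => //; rewrite -(eqP hx); apply/eqP; rewrite root_connect //.
    exact: connect_trans hz hr2.
  case=> r hr ->; rewrite roots_root // /=.
  have hc : fconnect h (froot h r) r by rewrite sym connect_root.
  have -> /= : froot h r \in B by rewrite unfold_in /= -(Bc _ _ hc); apply: (allP BQ).
  apply/existsP; exists r.
  by rewrite (allP KQ).
move=> fi gi hD hE hK uR KR DR sR rR uS KS ES sS rS.
rewrite (aux f D R) // (aux g E S) //.
suff -> : #|[pred x | [&& froots f x, D x & ~~ M f x]]| =
          #|[pred x | [&& froots g x, E x & ~~ M g x]]|.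
  by rewrite addnAC (addnC (size R)) addnAC.
(* On a cycle that avoids [K] the two maps have the same iterates, hence the same cycle and the same
   root. *)
have aux2 h k x : (forall z, ~~ K z -> h z = k z) -> ~~ M h x ->
    fconnect h x =1 fconnect k x.
  move=> hk; rewrite /M /= negb_exists => /forallP hM.
  have it n : iter n h x = iter n k x.
    elim: n => //= n <-; apply: hk.
    by have := hM (iter n h x); rewrite fconnect_iter andbT.
  move=> y; apply/idP/idP => /fconnect_iter_ex [n ->].
    by rewrite it fconnect_iter.
  by rewrite -it fconnect_iter.
have aux3 h k (B C : pred T) x : (forall z, ~~ K z -> h z = k z) ->
    (forall z, ~~ K z -> B z = C z) ->
    [&& froots h x, B x & ~~ M h x] -> [&& froots k x, C x & ~~ M k x].
  move=> hk hBC /and3P [h1 h2 h3]; have E1 := aux2 h k x hk h3.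
  have E2 : M k x = M h x.
    by apply: eq_existsb => z; rewrite E1.
  rewrite E2 h3; rewrite -hBC ?h2 ?andbT.
    rewrite /roots /= /root -(eq_pick (P := fconnect h x)) //.
  move: h3; rewrite /M /= negb_exists => /forallP /(_ x).
  by rewrite connect0 andbT.
apply: eq_card => x; rewrite !inE; apply/idP/idP; apply: aux3 => z /hK [] //.
Qed.

(* [p k] and [q k] are the two half-edges of the k-th edge of the path, with
   [q 0] the contour of the face of degree 1 (respectively the half-edge h of
   the slid map), and [p l.+1] is the distinguished corner. *)
Record slid_marked (T : finType) (D1 D2 : {set T}) (r1 n1 r2 n2 : T -> T)
    (l : nat) (p q : nat -> T) (c0 : T) : Prop := SlidMarked {
  sm_r1K : involutive r1;
  sm_r2K : involutive r2;
  sm_n1 : injective n1;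
  sm_n2 : injective n2;
  sm_r1p : forall k, k <= l -> r1 (p k) = q k;
  sm_r1c : r1 (p l.+1) = p l.+1;
  sm_r1c0 : r1 c0 = c0;
  sm_r2p : forall k, k < l -> r2 (p k) = q k.+1;
  sm_r2pl : r2 (p l) = q 0;
  sm_r2c : r2 (p l.+1) = p l.+1;
  sm_r2c0 : r2 c0 = c0;
  sm_rE : forall z, z != c0 -> (forall k, k <= l.+1 -> z != p k) ->
    (forall k, k <= l -> z != q k) -> r2 z = r1 z;
  sm_n1q : n1 (q 0) = c0;
  sm_n1c0 : n1 c0 = q 0;
  sm_n2c : n2 (p l.+1) = q 0;
  sm_n2q : n2 (q 0) = n1 (p l.+1);
  sm_n2c0 : n2 c0 = c0;
  sm_nE : forall z, z != c0 -> z != q 0 -> z != p l.+1 -> n2 z = n1 z;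
  sm_p : forall i j, i <= l.+1 -> j <= l.+1 -> p i = p j -> i = j;
  sm_q : forall i j, i <= l -> j <= l -> q i = q j -> i = j;
  sm_pq : forall i j, i <= l.+1 -> j <= l -> p i != q j;
  sm_pc0 : forall i, i <= l.+1 -> p i != c0;
  sm_qc0 : forall i, i <= l -> q i != c0;
  sm_Dp : forall i, i <= l.+1 -> p i \in D1;
  sm_Dq : forall i, i <= l -> q i \in D1;
  sm_Dc0 : c0 \in D1;
  sm_D2 : D2 = D1 :\ c0;
  sm_out : forall z, z \notin D1 -> r1 z = z /\ n1 z = z }.

Section SlidMarked.
Variables (T : finType) (D1 D2 : {set T}) (r1 n1 r2 n2 : T -> T).
Variables (b1 b2 : T -> option nat) (l : nat) (p q : nat -> T) (c0 : T).
Hypothesis sm : slid_marked D1 D2 r1 n1 r2 n2 l p q c0.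
Let m1 := @PMap T D1 r1 n1 b1.
Let m2 := @PMap T D2 r2 n2 b2.
Let s1 : T -> T := @cw m1.
Let s2 : T -> T := @cw m2.

(** [arr] and [stp] are the sets A and Z of the potential; the index runs up to [l.+1], so that
    [arr] contains the distinguished corner. *)
Definition arr (z : T) : bool := [exists k : 'I_l.+1, z == p k.+1].
Definition stp (z : T) : bool :=
  [|| z == p 0, z == c0 | [exists k : 'I_l.+1, z == q k]].
Definition trk : pred T := predU arr stp.

Variant trk_spec z : Prop :=
  | TrkP k of k <= l.+1 & z = p k
  | TrkQ k of k <= l & z = q k
  | TrkC of z = c0.

Lemma trkP z : trk z -> trk_spec z.
Proof.
case/orP=> [/existsP [k /eqP ->]|/or3P [/eqP ->|/eqP ->|/existsP [k /eqP ->]]].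
- by apply: (@TrkP _ k.+1).
- by apply: (@TrkP _ 0).
- exact: TrkC.
- by apply: (@TrkQ _ k); first exact: ltn_ord k.
Qed.

Lemma arr_p k : k <= l -> arr (p k.+1).
Proof. by move=> hk; apply/existsP; exists (Ordinal (hk : k < l.+1)). Qed.
Lemma stp_q k : k <= l -> stp (q k).
Proof.
by move=> hk; apply/or3P/Or33/existsP; exists (Ordinal (hk : k < l.+1)).
Qed.
Lemma stp_p0 : stp (p 0). Proof. by rewrite /stp eqxx. Qed.
Lemma stp_c0 : stp c0. Proof. by rewrite /stp eqxx orbT. Qed.
Lemma trk_p k : k <= l.+1 -> trk (p k).
Proof.
by case: k => [|k] hk; rewrite /trk /= ?stp_p0 ?orbT // arr_p.
Qed.
Lemma trk_q k : k <= l -> trk (q k).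
Proof. by move=> hk; rewrite /trk /= stp_q ?orbT. Qed.
Lemma trk_c0 : trk c0. Proof. by rewrite /trk /= stp_c0 orbT. Qed.

Lemma arr_stp z : arr z -> ~~ stp z.
Proof.
case/existsP=> k /eqP ->; have hk : k.+1 <= l.+1 := ltn_ord k.
apply/negP => /or3P [/eqP|/eqP|/existsP [j /eqP]].
- by move/(sm_p sm hk (leq0n _)).
- by apply/eqP; apply: (sm_pc0 sm).
- by apply/eqP; apply: (sm_pq sm hk (ltn_ord j)).
Qed.

Lemma r1q k : k <= l -> r1 (q k) = p k.
Proof. by move=> hk; rewrite -(sm_r1p sm hk) (sm_r1K sm). Qed.
Lemma r2q k : k < l -> r2 (q k.+1) = p k.
Proof. by move=> hk; rewrite -(sm_r2p sm hk) (sm_r2K sm). Qed.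
Lemma r2q0 : r2 (q 0) = p l.
Proof. by rewrite -(sm_r2pl sm) (sm_r2K sm). Qed.

Lemma trk_out z : ~~ trk z -> [/\ z != c0, forall k, k <= l.+1 -> z != p k &
    forall k, k <= l -> z != q k].
Proof.
move=> h; split=> [|k hk|k hk]; apply: contraNneq h => ->;
  [exact: trk_c0 | exact: trk_p | exact: trk_q].
Qed.

Lemma trk_r1 z : trk (r1 z) = trk z.
Proof.
have h w : trk w -> trk (r1 w).
  case/trkP=> [k hk ->|k hk ->|->].
  - have [hk'|->] : k <= l \/ k = l.+1 by lia.
      by rewrite (sm_r1p sm) // trk_q.
    by rewrite (sm_r1c sm) trk_p.
  - by rewrite r1q // trk_p // ltnW.
  - by rewrite (sm_r1c0 sm) trk_c0.
by apply/idP/idP => [/h|/h //]; rewrite (sm_r1K sm).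
Qed.

Lemma r2E z : ~~ trk z -> r2 z = r1 z.
Proof. by case/trk_out=> h1 h2 h3; apply: (sm_rE sm). Qed.

Lemma s2E z : ~~ trk z -> s2 z = s1 z.
Proof.
move=> hz; rewrite /s1 /s2 /cw /= r2E //.
have /trk_out [h1 h2 h3] : ~~ trk (r1 z) by rewrite trk_r1.
by apply: (sm_nE sm); [|apply: h3|apply: h2].
Qed.

Lemma nE_p k : k <= l -> n2 (p k) = n1 (p k).
Proof.
move=> hk; apply: (sm_nE sm); [apply: (sm_pc0 sm); lia|apply: (sm_pq sm); lia|].
apply/eqP => /(sm_p sm (leqW hk) (leqnn _)); lia.
Qed.

Lemma nE_q k : 0 < k -> k <= l -> n2 (q k) = n1 (q k).
Proof.
move=> h0 hk; apply: (sm_nE sm); [apply: (sm_qc0 sm); lia| |].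
  apply/eqP => /(sm_q sm hk (leq0n _)); lia.
by rewrite eq_sym (sm_pq sm).
Qed.

(** With [s2p], this is the regluing of sectors: in the new rotation [q k.+1] is followed by the
    sector that followed [q k], which ends at [p k.+1], and then comes the sector that followed
    [p k.+2]. The exceptions at the two ends are [s2q0] and [s2c]. *)
Lemma s2q k : k < l -> s2 (q k.+1) = s1 (q k).
Proof. by move=> hk; rewrite /s1 /s2 /cw /= r2q // r1q ?nE_p // ltnW. Qed.
Lemma s2q0 : s2 (q 0) = s1 (q l).
Proof. by rewrite /s1 /s2 /cw /= r2q0 r1q ?nE_p. Qed.
Lemma s2p k : k <= l -> s2 (p k) = s1 (p k.+1).
Proof.
move=> hk; rewrite /s1 /s2 /cw /=; have [hk'|->] : k < l \/ k = l by lia.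
  by rewrite (sm_r2p sm hk') (sm_r1p sm hk') nE_q.
by rewrite (sm_r2pl sm) (sm_r1c sm) (sm_n2q sm).
Qed.
Lemma s2c : s2 (p l.+1) = q 0.
Proof. by rewrite /s2 /cw /= (sm_r2c sm) (sm_n2c sm). Qed.
Lemma s2c0 : s2 c0 = c0.
Proof. by rewrite /s2 /cw /= (sm_r2c0 sm) (sm_n2c0 sm). Qed.
Lemma s1p0 : s1 (p 0) = c0.
Proof. by rewrite /s1 /cw /= (sm_r1p sm) // (sm_n1q sm). Qed.
Lemma s1c0 : s1 c0 = q 0.
Proof. by rewrite /s1 /cw /= (sm_r1c0 sm) (sm_n1c0 sm). Qed.

Lemma s1_inj : injective s1.
Proof. by move=> x y /(sm_n1 sm) /(can_inj (sm_r1K sm)). Qed.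
Lemma s2_inj : injective s2.
Proof. by move=> x y /(sm_n2 sm) /(can_inj (sm_r2K sm)). Qed.

Lemma D2E z : (z \in D2) = (z != c0) && (z \in D1).
Proof. by rewrite (sm_D2 sm) !inE. Qed.
Lemma D2p k : k <= l.+1 -> p k \in D2.
Proof. by move=> hk; rewrite D2E (sm_pc0 sm) // (sm_Dp sm). Qed.
Lemma D2q k : k <= l -> q k \in D2.
Proof. by move=> hk; rewrite D2E (sm_qc0 sm) // (sm_Dq sm). Qed.

Lemma out2 z : z \notin D2 -> r2 z = z /\ n2 z = z.
Proof.
rewrite D2E negb_and negbK => /orP [/eqP ->|hz].
  by rewrite (sm_r2c0 sm) (sm_n2c0 sm).
have [h1 h2] := sm_out sm hz.
have hK : ~~ trk z.
  apply: contra hz => /trkP [k hk ->|k hk ->|->].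
  - exact: (sm_Dp sm).
  - exact: (sm_Dq sm).
  - exact: (sm_Dc0 sm).
rewrite r2E // h1; split=> //; rewrite -{2}h2.
by have [H1 H2 H3] := trk_out hK; apply: (sm_nE sm); [|apply: H3|apply: H2].
Qed.

Lemma closed1 z : (r1 z \in D1) = (z \in D1).
Proof.
have h w : w \notin D1 -> r1 w \notin D1 by move=> hw; rewrite (proj1 (sm_out sm hw)).
by apply/idP/idP => [|hz]; [apply: contraTT; apply: h
  |move: (hz); rewrite -{1}(sm_r1K sm z); apply: contraTT; apply: h].
Qed.

Lemma closedn1 z : (n1 z \in D1) = (z \in D1).
Proof.
have h w : w \notin D1 -> n1 w \notin D1 by move=> hw; rewrite (proj2 (sm_out sm hw)).
apply/idP/idP => [|hz]; first by apply: contraTT; apply: h.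
by apply: contraTT hz => hz; have [_ /(sm_n1 sm) E] := sm_out sm hz; rewrite -E.
Qed.

Lemma closed_s1 z : (s1 z \in D1) = (z \in D1).
Proof. by rewrite /s1 /cw /= closedn1 closed1. Qed.

Lemma closed_s2 z : (s2 z \in D2) = (z \in D2).
Proof.
have h w : w \notin D2 -> s2 w = w.
  by move=> hw; have [h1 h2] := out2 hw; rewrite /s2 /cw /= h1 h2.
apply/idP/idP => [|hz]; first by apply: contraTT => hz; rewrite h.
by apply: contraTT hz => hz; have /s2_inj E := h _ hz; rewrite -E.
Qed.

Definition vertices1 : Prop :=
  (forall k, k <= l -> @same_vertex m1 (q k) (p k.+1)) /\
  (forall i j, i <= l -> j <= l -> @same_vertex m1 (q i) (q j) -> i = j).
Definition vertices2 : Prop :=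
  (forall k, 0 < k -> k <= l -> @same_vertex m2 (p k) (q k)) /\
  (forall i j, i <= l.+1 -> j <= l.+1 -> @same_vertex m2 (p i) (p j) -> i = j).

Lemma slid_vertex_count : vertices1 -> vertices2 ->
  fcard s2 (mem D2) = (fcard s1 (mem D1)).+1.
Proof.
move=> [v1 u1] [v2 u2].
have uq : uniq (mkseq q l.+1).
  by apply/mkseq_uniqP => i j /= hi hj; apply: (sm_q sm).
have up : uniq (mkseq p l.+2).
  by apply/mkseq_uniqP => i j /= hi hj; apply: (sm_p sm).
have := @fcard_reps T s1 s2 (mem D1) (mem D2) trk (mkseq q l.+1) (mkseq p l.+2).
rewrite !size_mkseq => H.
suff E : fcard s1 (mem D1) + l.+2 = fcard s2 (mem D2) + l.+1.
  by apply/eqP; rewrite -(eqn_add2r l.+1) -E addSnnS.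
apply: H; try by [].
- exact: s1_inj.
- exact: s2_inj.
- exact: closed_s1.
- exact: closed_s2.
- move=> z hz; rewrite s2E //; split=> //=; rewrite D2E.
  by have [-> _ _] := trk_out hz.
- by apply/allP => z /mapP [k]; rewrite mem_iota => hk ->; apply: trk_q.
- by apply/allP => z /mapP [k]; rewrite mem_iota => hk ->; apply: (sm_Dq sm).
- move=> x y /mapP [i]; rewrite mem_iota => hi -> /mapP [j]; rewrite mem_iota => hj ->.
  by move/u1 => ->.
- have hq0 : q 0 \in mkseq q l.+1 by apply: (map_f q (_ : 0 \in iota 0 l.+1)).
  have hp0 : fconnect s1 c0 (q 0) by rewrite -s1c0 fconnect1.
  move=> z hD /trkP [[|k] hk ->|k hk ->|->].
  + by exists (q 0) => //; apply: connect_trans (fconnect1 _ _) _; rewrite s1p0.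
  + exists (q k); last by rewrite (fconnect_sym s1_inj); apply: v1.
    by apply: map_f; rewrite mem_iota.
  + by exists (q k); rewrite ?connect0 //; apply: map_f; rewrite mem_iota.
  + by exists (q 0).
- by apply/allP => z /mapP [k]; rewrite mem_iota => hk ->; apply: trk_p.
- by apply/allP => z /mapP [k]; rewrite mem_iota => hk ->; apply: D2p.
- move=> x y /mapP [i]; rewrite mem_iota => hi -> /mapP [j]; rewrite mem_iota => hj ->.
  by move/u2 => ->.
- move=> z hD /trkP [k hk ->|[|k] hk ->|E].
  + by exists (p k); rewrite ?connect0 //; apply: map_f; rewrite mem_iota.
  + exists (p l.+1); last by rewrite (fconnect_sym s2_inj) -s2c fconnect1.
    by apply: map_f; rewrite mem_iota; lia.
  + exists (p k.+1); last by rewrite (fconnect_sym s2_inj); apply: v2.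
    by apply: map_f; rewrite mem_iota; lia.
  + by move: hD; rewrite /= D2E E eqxx.
Qed.

(** Successors change only at [p l.+1], [q 0] and [c0]. Before the surgery these lie on two
    contours, represented by [p l.+1] and [q 0]; after it, those that remain lie on a single one. *)
Lemma slid_face_count : ~~ fconnect n1 (p l.+1) (q 0) ->
  fcard n1 (mem D1) = (fcard n2 (mem D2)).+1.
Proof.
move=> hf; have pq : p l.+1 != q 0 by apply: (sm_pq sm).
pose Kf : pred T := pred3 (p l.+1) (q 0) c0.
have K1 : Kf (p l.+1) by rewrite /Kf /= eqxx.
have K2 : Kf (q 0) by rewrite /Kf /= eqxx orbT.
have hn2 z : n2 z \in D2 = (z \in D2).
  have h w : w \notin D2 -> n2 w = w by move=> hw; have [] := out2 hw.
  apply/idP/idP => [|hz]; first by apply: contraTT => hz; rewrite h.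
  by apply: contraTT hz => hz; have /(sm_n2 sm) E := h _ hz; rewrite -E.
have := @fcard_reps T n1 n2 (mem D1) (mem D2) Kf [:: p l.+1; q 0] [:: p l.+1].
rewrite /= addn1 addn2 => H.
apply: succn_inj; apply: etrans (H _ _ _ _ _ _ _ _ _ _ _ _ _ _ _) _ => //.
- exact: (sm_n1 sm).
- exact: (sm_n2 sm).
- exact: closedn1.
- by move=> z; rewrite /Kf /= !negb_or => /and3P [h1 h2 h3]; rewrite (sm_nE sm) // D2E h3.
- by rewrite inE pq.
- by rewrite /= K1 K2.
- by rewrite (sm_Dp sm) // (sm_Dq sm).
- move=> x y; rewrite !inE => /orP [] /eqP -> /orP [] /eqP -> //.
    by rewrite (negPf hf).
  by rewrite (fconnect_sym (sm_n1 sm)) (negPf hf).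
- move=> z _ /or3P [] /eqP ->.
  + by exists (p l.+1); rewrite ?connect0 // !inE eqxx.
  + by exists (q 0); rewrite ?connect0 // !inE eqxx orbT.
  + by exists (q 0); rewrite ?inE ?eqxx ?orbT // -(sm_n1c0 sm) fconnect1.
- by rewrite /= K1.
- by rewrite D2p.
- by move=> x y; rewrite !inE => /eqP -> /eqP ->.
- move=> z hz /or3P [] /eqP E; rewrite E in hz *.
  + by exists (p l.+1); rewrite ?connect0 // !inE eqxx.
  + exists (p l.+1); rewrite ?inE ?eqxx // (fconnect_sym (sm_n2 sm)).
    by rewrite -(sm_n2c sm) fconnect1.
  + by move: hz; rewrite /= D2E eqxx.
Qed.

End SlidMarked.

Arguments s1c0 {T D1 D2 r1 n1 r2 n2 b1 l p q c0} sm.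
Arguments s1p0 {T D1 D2 r1 n1 r2 n2 b1 l p q c0} sm.
Arguments s2E {T D1 D2 r1 n1 r2 n2 b1 b2 l p q c0} sm [z].
Arguments s2q {T D1 D2 r1 n1 r2 n2 b1 b2 l p q c0} sm [k].
Arguments s2q0 {T D1 D2 r1 n1 r2 n2 b1 b2 l p q c0} sm.
Arguments s2p {T D1 D2 r1 n1 r2 n2 b1 b2 l p q c0} sm [k].
Arguments s2c {T D1 D2 r1 n1 r2 n2 b2 l p q c0} sm.
Arguments s2c0 {T D1 D2 r1 n1 r2 n2 b2 l p q c0} sm.
Arguments stp_q {T l p q c0} [k].
Arguments stp_p0 {T l p q c0}.
Arguments arr_p {T l p} [k].

(** * Connectivity *)

(** What precedes the k-th half-edge of a path: the starting corner [h] counts as predecessor of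
    [a 0], so that all steps obey the same formula. *)
Definition before (T : Type) (h : T) (a : nat -> T) (k : nat) : T :=
  if k is k'.+1 then a k' else h.

Lemma nth_before (T : Type) (h : T) a n k :
  k <= n -> nth h (h :: mkseq a n) k = before h a k.
Proof. by case: k => //= k hk; rewrite nth_mkseq. Qed.

Lemma steered_mkseq (m : pmap) (g : elt m -> elt m) y h a n :
  steered g y h (mkseq a n) <->
  (forall k, k < n ->
     first_after g (fun z => directed_toward z y) (rev (before h a k)) (a k)) /\
  same_vertex (rev (before h a n)) y.
Proof.
rewrite steeredP size_mkseq.
have -> : last h (mkseq a n) = before h a n.
  by rewrite (last_nth h) size_mkseq nth_before.
split=> - [h1 h2]; split=> // k hk; have := h1 k hk.
  by rewrite nth_before ?(ltnW hk) // nth_mkseq.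
by rewrite nth_before ?(ltnW hk) // nth_mkseq.
Qed.

Lemma steered_mkseq_dist (m : pmap) (g : elt m -> elt m) y h a n k : sound m ->
  fconnect g =2 @same_vertex m -> y \in dom m -> h \in dom m ->
  steered g y h (mkseq a n) -> k <= n -> dist (rev (before h a k)) y = n - k.
Proof.
move=> hm gE hy hh hs hk; rewrite -(nth_before _ _ hk).
by rewrite (steered_dist hm gE hy hh hs) size_mkseq.
Qed.

(** The counterclockwise search from [x] runs back along the arc from [z] to [x] and would find [z]
    at its end, so it has found [e] somewhere on this arc. *)
Lemma ccw_first_hit (m : pmap) (P : pred (elt m)) x e n z : sound m ->
  first_after (@ccw m) P x e -> iter n.+1 (@cw m) z = x -> P z ->
  exists2 j, j <= n & iter j (@cw m) z = e.
Proof.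
move=> hm [N [-> _ hN]] Ex Pz; rewrite -Ex in hN *.
have it i j w : iter i (@ccw m) (iter (i + j) (@cw m) w) = iter j (@cw m) w.
  by elim: i => // i ih; rewrite iterSr addSn [iter _.+1 (@cw m) w]iterS (cwK hm).
have [hlt|hle] := ltnP n N.
  by have := hN _ hlt; have := it n.+1 0 z; rewrite addn0 => -> /=; rewrite Pz.
exists (n - N); first exact: leq_subr.
by rewrite (_ : n.+1 = N.+1 + (n - N)) ?it //; lia.
Qed.

Lemma iter_inj (T : Type) (f : T -> T) n : injective f -> injective (iter n f).
Proof. by move=> fi; elim: n => //= n ih x y /fi /ih. Qed.

(** If the search from [x] started before [z], it would find [z] before [e]; hence [x] lies on the
    arc from [z] to [e]. *)
Lemma cw_first_hit (m : pmap) (P : pred (elt m)) x e n z : sound m ->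
  first_after (@cw m) P x e -> iter n.+1 (@cw m) z = e -> P z ->
  exists2 j, j <= n & iter j (@cw m) z = x.
Proof.
move=> hm [N [-> _ hN]] E Pz; have inj k := iter_inj (n := k) (cw_inj hm).
have [hlt|hle] := ltnP n N.
  have Ez : z = iter (N - n.+1).+1 (@cw m) x.
    by apply: (inj n.+1); rewrite E -iterD (_ : n.+1 + _ = N.+1) //; lia.
  have hlt' : N - n.+1 < N by lia.
  by have := hN _ hlt'; rewrite -Ez Pz.
exists (n - N); first exact: leq_subr.
by apply: (inj N.+1); rewrite -E -iterD (_ : N.+1 + _ = n.+1) //; lia.
Qed.

(** Taking the first arrival at [y] also forbids any return to [x], as a return would yield an
    earlier arrival. *)
Lemma sweep (T : finType) (f : T -> T) x y :
  fconnect f x y -> x != y ->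
  exists2 n, y = iter n.+1 f x &
    forall j, j < n -> iter j.+1 f x != x /\ iter j.+1 f x != y.
Proof.
move=> /fconnect_iter_ex h xy.
have hex : exists n, iter n f x == y by case: h => n ->; exists n.
case: (ex_minnP hex) => -[|n] /eqP hn hmin; first by rewrite /= in hn; rewrite hn eqxx in xy.
exists n => // j hj; split; apply/eqP => E; last first.
  by have := hmin j.+1; rewrite E eqxx => /(_ isT); lia.
have := hmin (n - j); rewrite -{1}E -iterD (_ : n - j + j.+1 = n.+1); last by lia.
by rewrite hn eqxx => /(_ isT); lia.
Qed.

(** On a finite type the inverse of a permutation is one of its powers. *)
Lemma gen_connect_sym (T : finType) (r n : T -> T) :
  involutive r -> injective n ->
  connect_sym [rel u w | (w == r u) || (w == n u)].
Proof.
move=> rK ni; set e := [rel u w | _].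
have sub : subrel (fconnect n) (connect e).
  by apply: connect_sub => x y /eqP <-; apply: connect1; rewrite /= eqxx orbT.
have e1 x y : e x y -> connect e y x.
  case/orP=> /eqP ->; first by apply: connect1; rewrite /= rK eqxx.
  by apply: sub; rewrite (fconnect_sym ni) fconnect1.
have half x y : connect e x y -> connect e y x.
  case/connectP=> s; elim: s x => [|z s ih] x /=; first by move=> _ ->.
  by case/andP=> h1 h2 /(ih _ h2) h3; apply: connect_trans h3 (e1 _ _ h1).
by move=> x y; apply/idP/idP; apply: half.
Qed.

Section Connectivity.
Variables (T : finType) (D1 D2 : {set T}) (r1 n1 r2 n2 : T -> T).
Variables (b1 b2 : T -> option nat) (l : nat) (p q : nat -> T) (c0 : T).
Hypothesis sm : slid_marked D1 D2 r1 n1 r2 n2 l p q c0.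
Let m1 := @PMap T D1 r1 n1 b1.
Let m2 := @PMap T D2 r2 n2 b2.
Let g1 := connect [rel u w | (w == r1 u) || (w == n1 u)].
Let g2 := connect [rel u w | (w == r2 u) || (w == n2 u)].

Let g1r u : g1 u (r1 u). Proof. by apply: connect1; rewrite /= eqxx. Qed.
Let g1n u : g1 u (n1 u). Proof. by apply: connect1; rewrite /= eqxx orbT. Qed.
Let g2r u : g2 u (r2 u). Proof. by apply: connect1; rewrite /= eqxx. Qed.
Let g2n u : g2 u (n2 u). Proof. by apply: connect1; rewrite /= eqxx orbT. Qed.
Let g1_sym u w : g1 u w = g1 w u.
Proof. by apply: gen_connect_sym; [apply: (sm_r1K sm)|apply: (sm_n1 sm)]. Qed.
Let g2_sym u w : g2 u w = g2 w u.
Proof. by apply: gen_connect_sym; [apply: (sm_r2K sm)|apply: (sm_n2 sm)]. Qed.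
Let g1t u v w : g1 u v -> g1 v w -> g1 u w. Proof. exact: connect_trans. Qed.
Let g2t u v w : g2 u v -> g2 v w -> g2 u w. Proof. exact: connect_trans. Qed.

Let g1v u w : @same_vertex m1 u w -> g1 u w.
Proof.
by apply: connect_sub => x y /eqP <-; apply: g1t (g1r x) _; apply: g1n.
Qed.
Let g2v u w : @same_vertex m2 u w -> g2 u w.
Proof.
by apply: connect_sub => x y /eqP <-; apply: g2t (g2r x) _; apply: g2n.
Qed.

(** In the slid map one climbs from [p k] to [p k.+1] through [q k.+1], up to [p l], whose reverse
    is [q 0]. The removed mark [c0] is represented by [q 0]. *)
Lemma trk_connected2 : vertices2 D2 r2 n2 b2 l p q ->
  forall z, trk l p q c0 z -> g2 (if z == c0 then q 0 else z) (q 0).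
Proof.
case=> v2 _.
have hp k : k <= l.+1 -> g2 (p k) (q 0).
  move En : (l.+1 - k) => n; elim: n k En => [|[|n] ih] k En hk.
  - by rewrite (_ : k = l.+1) -?(sm_n2c sm) ?g2n //; lia.
  - by rewrite (_ : k = l) -?(sm_r2pl sm) ?g2r //; lia.
  - apply: g2t (g2r _) _; rewrite (sm_r2p sm); last by lia.
    apply: g2t (_ : g2 _ (p k.+1)) _; last by apply: ih; lia.
    by rewrite g2_sym; apply/g2v/v2; lia.
move=> z /trkP [k hk ->|[|k] hk ->|->]; last by rewrite eqxx; apply: connect0.
- by rewrite (negPf (sm_pc0 sm hk)) hp.
- by rewrite (negPf (sm_qc0 sm hk)); apply: connect0.
- rewrite (negPf (sm_qc0 sm hk)); apply: g2t (hp k.+1 _); last by lia.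
  by rewrite g2_sym; apply/g2v/v2.
Qed.

Lemma trk_connected1 : vertices1 D1 r1 n1 b1 l p q ->
  forall z, trk l p q c0 z -> g1 z (q 0).
Proof.
case=> v1 _.
have hq k : k <= l -> g1 (q k) (q 0).
  elim: k => [|k ih] hk; first exact: connect0.
  apply: g1t (ih (ltnW hk)); rewrite g1_sym.
  apply: g1t (g1v (v1 _ (ltnW hk))) _.
  by rewrite -(sm_r1p sm hk) g1r.
move=> z /trkP [[|k] hk ->|k hk ->|->].
- by rewrite -(sm_r1p sm (leq0n l)) g1r.
- by apply: g1t (hq k hk); rewrite g1_sym; apply/g1v/v1.
- exact: hq.
- by rewrite -(sm_n1c0 sm) g1n.
Qed.

(** A chain of the original map is projected by [pi], which sends [c0] to [q 0]. Reversals on the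
    path are rerouted through [q 0], to which the whole path is connected, and the changed
    successors are replaced by at most two new steps. *)
Lemma slid_connected2 : vertices2 D2 r2 n2 b2 l p q ->
  (forall x y, x \in D1 -> y \in D1 -> g1 x y) ->
  forall x y, x \in D2 -> y \in D2 -> g2 x y.
Proof.
move=> v2 h1 x y; rewrite !(D2E sm) => /andP [hx0 hx] /andP [hy0 hy].
pose pi z := if z == c0 then q 0 else z.
have hK z : trk l p q c0 z -> g2 (pi z) (q 0) by apply: trk_connected2.
suff step u w : [rel u w | (w == r1 u) || (w == n1 u)] u w -> g2 (pi u) (pi w).
  have : g2 (pi x) (pi y).
    have /connectP [s] := h1 x y hx hy.
    elim: s x {hx hx0} => [|z s ih] x /=; first by move=> _ ->; apply: connect0.
    by case/andP=> /step h2 h3 /(ih _ h3); apply: g2t.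
  by rewrite /pi (negPf hx0) (negPf hy0).
case/orP=> /eqP ->.
  have [hu|hu] := boolP (trk l p q c0 u).
    apply: g2t (hK _ hu) _; rewrite g2_sym; apply: hK.
    by rewrite (trk_r1 sm).
  have [h2 _ _] := trk_out hu.
  have : ~~ trk l p q c0 (r1 u) by rewrite (trk_r1 sm).
  case/trk_out => h3 _ _.
  by rewrite /pi (negPf h2) (negPf h3) -(r2E sm hu) g2r.
have [->|h2] := eqVneq u c0.
  by rewrite (sm_n1c0 sm) /pi eqxx (negPf (sm_qc0 sm (leq0n _))); apply: connect0.
have [->|h3] := eqVneq u (q 0).
  by rewrite (sm_n1q sm) /pi eqxx (negPf (sm_qc0 sm (leq0n _))); apply: connect0.
have -> : pi (n1 u) = n1 u.
  rewrite /pi; case: eqP => // E; case/eqP: h3; apply: (sm_n1 sm).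
  by rewrite E (sm_n1q sm).
rewrite {1}/pi (negPf h2); have [->|h4] := eqVneq u (p l.+1).
  by rewrite -(sm_n2q sm); apply: g2t (g2n _); rewrite -(sm_n2c sm) g2n.
by rewrite -(sm_nE sm h2 h3 h4) g2n.
Qed.

Lemma trk_r2 z : trk l p q c0 z -> trk l p q c0 (r2 z).
Proof.
case/(trkP)=> [k hk ->|[|k] hk ->|->].
- have [hk'|[->|->]] : k < l \/ k = l \/ k = l.+1 by lia.
  + by rewrite (sm_r2p sm) // trk_q.
  + by rewrite (sm_r2pl sm) trk_q.
  + by rewrite (sm_r2c sm) trk_p.
- by rewrite (r2q0 sm) trk_p.
- by rewrite (r2q sm) // trk_p //; lia.
- by rewrite (sm_r2c0 sm) trk_c0.
Qed.

Lemma slid_connected1 : vertices1 D1 r1 n1 b1 l p q ->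
  (forall x y, x \in D2 -> y \in D2 -> g2 x y) ->
  forall x y, x \in D1 -> y \in D1 -> g1 x y.
Proof.
move=> v1 h2; have hK := trk_connected1 v1.
have hKK u w : trk l p q c0 u -> trk l p q c0 w -> g1 u w.
  by move=> hu hw; apply: g1t (hK _ hu) _; rewrite g1_sym; apply: hK.
have step u w : [rel u w | (w == r2 u) || (w == n2 u)] u w -> g1 u w.
  case/orP=> /eqP ->.
    have [hu|hu] := boolP (trk l p q c0 u); last by rewrite (r2E sm hu) g1r.
    by apply: hKK => //; apply: trk_r2.
  have [->|h3] := eqVneq u c0; first by rewrite (sm_n2c0 sm); apply: connect0.
  have [->|h4] := eqVneq u (q 0).
    by rewrite (sm_n2q sm); apply: g1t (g1n _); apply: hKK; rewrite ?trk_q ?trk_p.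
  have [->|h5] := eqVneq u (p l.+1).
    by rewrite (sm_n2c sm); apply: hKK; rewrite ?trk_q ?trk_p.
  by rewrite (sm_nE sm h3 h4 h5) g1n.
have main x y : x \in D2 -> y \in D2 -> g1 x y.
  move=> hx hy; have /connectP [s] := h2 x y hx hy.
  elim: s x {hx} => [|z s ih] x /=; first by move=> _ ->; apply: connect0.
  by case/andP=> /step h3 h4 /(ih _ h4); apply: g1t.
have hc0 : g1 c0 (q 0) by rewrite -(sm_n1c0 sm) g1n.
have hq0 : q 0 \in D2 by apply: (D2q sm).
move=> x y hx hy; have [->|hx0] := eqVneq x c0; have [->|hy0] := eqVneq y c0.
- exact: connect0.
- by apply: g1t hc0 _; apply: main; rewrite // (D2E sm) hy0.
- by rewrite g1_sym; apply: g1t hc0 _; apply: main; rewrite // (D2E sm) hx0.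
- by apply: main; rewrite (D2E sm) ?hx0 ?hy0.
Qed.

End Connectivity.

(** * Sliding a rightmost geodesic *)

Section SlideRight.
Variables (T : finType) (D1 D2 : {set T}) (r1 n1 r2 n2 : T -> T).
Variables (b1 b2 : T -> option nat) (l : nat) (p q : nat -> T) (c0 : T).
Hypothesis sm : slid_marked D1 D2 r1 n1 r2 n2 l p q c0.
Let m1 := @PMap T D1 r1 n1 b1.
Let m2 := @PMap T D2 r2 n2 b2.
Let s1 : T -> T := @cw m1.
Let s2 : T -> T := @cw m2.
Hypothesis hm1 : sound m1.
Hypothesis geo : @steered m1 (@ccw m1) (p l.+1) c0 (mkseq (fun k => p k.+1) l).
Let F (z : T) : nat := @dist m1 z (p l.+1).
Let trk := trk l p q c0.

Let hy : p l.+1 \in dom m1. Proof. exact: (sm_Dp sm). Qed.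
Let hc0 : c0 \in dom m1. Proof. exact: (sm_Dc0 sm). Qed.
Let Fs1 z : F (s1 z) = F z. Proof. exact: (dist_cw hm1). Qed.
Let s1i : injective s1 := s1_inj sm.

Let e1c0 : s1 c0 = q 0 := s1c0 sm.
Let e1p0 : s1 (p 0) = c0 := s1p0 sm.
Let e2c : s2 (p l.+1) = q 0 := s2c sm.
Let e2c0 : s2 c0 = c0 := s2c0 sm.
Let e2p k : k <= l -> s2 (p k) = s1 (p k.+1). Proof. exact: (s2p sm). Qed.
Let e2q k : k < l -> s2 (q k.+1) = s1 (q k). Proof. exact: (s2q sm). Qed.
Let e2E z : ~~ trk z -> s2 z = s1 z. Proof. exact: (s2E sm). Qed.
Let e2q0 : s2 (q 0) = s1 (q l) := s2q0 sm.

Let hk (k : nat) : T := before c0 (fun k => p k.+1) k.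

Lemma right_Fh k : k <= l -> F (r1 (hk k)) = l - k.
Proof. exact: (steered_mkseq_dist hm1 (ccw_same_vertex hm1) hy hc0 geo). Qed.

Let geo1 k : k < l ->
  first_after (@ccw m1) (fun z => @directed_toward m1 z (p l.+1)) (r1 (hk k)) (p k.+1).
Proof. by move: k; case/steered_mkseq: geo. Qed.
Let geo2 : @same_vertex m1 (r1 (hk l)) (p l.+1).
Proof. by case/steered_mkseq: geo. Qed.

Lemma right_Fc0 : F c0 = l.
Proof. by have := right_Fh (leq0n l); rewrite /hk /= (sm_r1c0 sm) subn0. Qed.
Lemma right_Fp0 : F (p 0) = l.
Proof. by rewrite -Fs1 e1p0 right_Fc0. Qed.
Lemma right_Fq k : k <= l -> F (q k) = l - k.
Proof.
case: k => [|k] hkl; first by rewrite -e1c0 Fs1 right_Fc0 subn0.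
by have := right_Fh hkl; rewrite /hk /= (sm_r1p sm) // => ->.
Qed.

Let hk_q k : k <= l -> @same_vertex m1 (r1 (hk k)) (q k).
Proof.
case: k => [|k] hkl; last by rewrite /hk /= (sm_r1p sm) //; apply: connect0.
rewrite /hk /= (sm_r1c0 sm) -e1c0; exact: fconnect1.
Qed.

Lemma right_qp k : k <= l -> @same_vertex m1 (q k) (p k.+1).
Proof.
move=> hkl; have h : @same_vertex m1 (r1 (hk k)) (p k.+1).
  have [hlt|->] : k < l \/ k = l by lia.
    exact: (first_after_vertex (ccw_same_vertex hm1) (geo1 hlt)).
  exact: geo2.
apply: (@same_vertex_trans m1) h; rewrite (same_vertex_sym hm1); exact: hk_q.
Qed.

Lemma right_Fp k : k <= l -> F (p k.+1) = l - k.
Proof.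
by move=> hkl; rewrite /F -(dist_l hm1 _ (right_qp hkl)) -/(F (q k)) right_Fq.
Qed.

Lemma right_vertices1 : vertices1 D1 r1 n1 b1 l p q.
Proof.
split=> [|i j hi hj /(dist_l hm1 (p l.+1))]; first exact: right_qp.
rewrite -/(F (q i)) -/(F (q j)) !right_Fq //; lia.
Qed.

(** The value of [F] at a vertex determines the index of the elements of the path found there. At
    the first vertex [p 0], [c0] and [q 0] are consecutive in the rotation, which keeps [p 0] and
    [c0] out of this sector. *)
Lemma right_sweepA k : k <= l ->
  exists2 n, p k.+1 = iter n s1 (s1 (q k)) &
    forall j, j < n -> ~~ trk (iter j s1 (s1 (q k))).
Proof.
move=> hkl; have [|n hn hj] := sweep (right_qp hkl).
  by rewrite eq_sym (sm_pq sm).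
exists n => [|j hlt]; first by rewrite -iterSr.
rewrite -iterSr; set w := iter _ _ _; have [h1 h2] := hj j hlt.
have hF : F w = l - k by rewrite -(right_Fq hkl); apply: (dist_l hm1);
  rewrite (same_vertex_sym hm1); apply: same_vertex_iter.
have nxt1 i : i < n -> s1 (iter i.+1 s1 (q k)) <> q k.
  move=> hi; rewrite -iterS => E; have [hi'|hi'] : i.+1 < n \/ i.+1 = n by lia.
    by have [+ _] := hj _ hi'; rewrite [iter _ _ _]E eqxx.
  move: hn; rewrite -hi' [iter _ _ _]E => E2.
  by have := sm_pq sm (hkl : k.+1 <= l.+1) hkl; rewrite E2 eqxx.
have nc0 i : k = 0 -> i < n -> iter i.+1 s1 (q k) <> c0.
  move=> k0 hi E; apply: (nxt1 i hi); rewrite E k0; exact: e1c0.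
apply/negP => /trkP [[|i] hi E|i hi E|E].
- have k0 : k = 0 by move: hF; rewrite E right_Fp0; lia.
  have E2 : s1 w = c0 by rewrite E; apply: e1p0.
  have [hj'|hj'] : j.+1 < n \/ j.+1 = n by lia.
    by apply: (nc0 j.+1 k0 hj').
  move: hn; rewrite -hj' iterS -/w [@cw m1 w]E2 => E3.
  by have := sm_pc0 sm (hkl : k.+1 <= l.+1); rewrite E3 eqxx.
- have ik : i = k by move: hF; rewrite E right_Fp //; lia.
  by move: h2; rewrite -/w E ik eqxx.
- have ik : i = k by move: hF; rewrite E right_Fq //; lia.
  by move: h1; rewrite -/w E ik eqxx.
- have k0 : k = 0 by move: hF; rewrite E right_Fc0; lia.
  exact: (nc0 j k0 hlt).
Qed.

(** The complementary sector, from [p k.+1] back to [q k]. For [k = 0] it stops at [p 0], the first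
    of the consecutive elements [p 0], [c0], [q 0]. *)
Lemma right_sweepB k : k <= l ->
  let t := if k is 0 then p 0 else q k in
  exists2 n, t = iter n s1 (s1 (p k.+1)) &
    forall j, j < n -> ~~ trk (iter j s1 (s1 (p k.+1))).
Proof.
move=> hkl t.
have tP : (k = 0 /\ t = p 0) \/ (0 < k /\ t = q k).
  by rewrite /t; case: (k); [left|right].
have ht : @same_vertex m1 (p k.+1) t.
  rewrite (same_vertex_sym hm1); apply: (@same_vertex_trans m1) (right_qp hkl).
  case: tP => -[k0 ->]; last exact: connect0.
  rewrite k0; apply: (@same_vertex_trans m1 _ c0).
    by rewrite -e1p0; apply: fconnect1.
  by rewrite -e1c0; apply: fconnect1.
have pt : p k.+1 != t.
  case: tP => -[k0 ->]; last by rewrite (sm_pq sm).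
  by apply/eqP => /(sm_p sm (hkl : k.+1 <= l.+1) (leq0n _)).
have [n hn hj] := sweep ht pt.
exists n => [|j hlt]; first by rewrite -iterSr.
rewrite -iterSr; set w := iter _ _ _; have [h1 h2] := hj j hlt.
have hF : F w = l - k by rewrite -(right_Fp hkl); apply: (dist_l hm1);
  rewrite (same_vertex_sym hm1); apply: same_vertex_iter.
have prev i : k = 0 -> i < n -> iter i.+1 s1 (p k.+1) <> c0.
  move=> k0 hi; rewrite iterS -e1p0 => /s1i.
  case: i hi => [|i] hi E; first by have := sm_p sm (hkl : k.+1 <= l.+1) (leq0n _) E.
  have [_ +] := hj i (ltnW hi); rewrite [iter _ _ _]E.
  by case: tP => -[h ->]; [rewrite eqxx|lia].
apply/negP => /trkP [[|i] hi E|i hi E|E].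
- have k0 : k = 0 by move: hF; rewrite E right_Fp0; lia.
  by move: h2; rewrite -/w E; case: tP => -[h ->]; [rewrite eqxx|lia].
- have ik : i = k by move: hF; rewrite E right_Fp //; lia.
  by move: h1; rewrite -/w E ik eqxx.
- have ik : i = k by move: hF; rewrite E right_Fq //; lia.
  case: tP => -[h ht']; last by move: h2; rewrite -/w E ik ht' eqxx.
  move: E; rewrite ik h /w iterS -e1c0 => /s1i.
  case: j hlt {h1 h2 hF w} => [|j] hlt E.
    by have := sm_pc0 sm (hkl : k.+1 <= l.+1); rewrite [p k.+1]E eqxx.
  by apply: (prev j h (ltnW hlt)).
- have k0 : k = 0 by move: hF; rewrite E right_Fc0; lia.
  exact: (prev j k0 hlt).
Qed.

(** The only place where the path is used as a rightmost one. If a descending [z] turned into an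
    element of [Z], the next half-edge of the path would have to lie on the arc just travelled,
    which avoids the path. At the last vertex [F] vanishes and nothing descends. *)
Lemma right_no_desc z n : F (r1 z) < F z ->
  (forall j, j <= n -> ~~ trk (iter j s1 z)) -> ~~ stp l p q c0 (iter n.+1 s1 z).
Proof.
move=> hd hfree; apply/negP => hs.
have hFz : F (iter n.+1 s1 z) = F z.
  by apply: (dist_l hm1); rewrite (same_vertex_sym hm1); apply: same_vertex_iter.
have hc w : trk w -> iter n.+1 s1 z <> s1 w.
  by move=> hw; rewrite iterS => /s1i E; have := hfree n (leqnn n); rewrite E hw.
have key k : k < l -> forall j, iter j.+1 s1 z = r1 (hk k) ->
    (forall i, i <= j -> i <= n \/ iter i s1 z <> p k.+1) -> False.
  move=> hkl j E hj.
  have [i hi Ei] := ccw_first_hit hm1 (geo1 hkl) E hd.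
  have [hin|] := hj i hi; last by apply.
  by have := hfree i hin; rewrite [iter _ _ _]Ei /trk trk_p // ltnW.
case/or3P: hs => [/eqP E|/eqP E|/existsP [k /eqP E]].
- have [l0|l0] : l = 0 \/ 0 < l by lia.
    by move: hFz; rewrite E right_Fp0; lia.
  (* The arc ends at [p 0], whereas the search for [p 1] starts from [c0], one step further; this
     accounts for [n.+1] and for the separate treatment of [p 0] itself. *)
  apply: (key 0 l0 n.+1); first by rewrite iterS E /hk /= (sm_r1c0 sm); apply: e1p0.
  move=> i hi; have [h|->] : i <= n \/ i = n.+1 by lia.
    by left.
  by right; rewrite E => /(sm_p sm (leq0n _) (ltnW (l0 : 1 < l.+1))).
- by apply: (hc (p 0)); [apply: trk_p|rewrite E e1p0].
- have hkl : k <= l := ltn_ord k.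
  case: k E hkl => [[|k] hk0]; rewrite -/(iter n.+1 s1 z) [nat_of_ord _]/= => E hkl.
    by apply: (hc c0); [apply: trk_c0|rewrite E e1c0].
  have [hlt|hlt] : k.+1 < l \/ k.+1 = l by lia.
    apply: (key _ hlt n); last by move=> i hi; left.
    by rewrite E /hk /= (sm_r1p sm).
  by move: hFz; rewrite E right_Fq // hlt; lia.
Qed.

Let AZ : forall z, arr l p z -> ~~ stp l p q c0 z := arr_stp sm.
Let F_r z : ~~ trk z -> F z <= (F (r1 z)).+1.
Proof.
move=> _; have [hz|hz] := boolP (z \in D1); first exact: (dist_rev hm1).
by rewrite (proj1 (sm_out sm hz)).
Qed.
Let rK z : ~~ trk z -> r1 (r1 z) = z. Proof. by move=> _; apply: (sm_r1K sm). Qed.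
Let Kr z : ~~ trk z -> ~~ trk (r1 z). Proof. by rewrite /trk (trk_r1 sm). Qed.

Let ep := eps (arr l p) (stp l p q c0) s1 r1 F.
Let sh := shifted (arr l p) (stp l p q c0) s1 r1 F l.
Let ep_iter z n : (forall j, j < n -> ~~ trk (iter j s1 z)) -> ep (iter n s1 z) = ep z.
Proof. exact: (eps_iter s1i right_no_desc). Qed.
Let ep_stp z : stp l p q c0 z -> ~~ ep z. Proof. exact: (eps_Z _ _ _ AZ). Qed.
Let ep_arr z : arr l p z -> ep z. Proof. exact: eps_A. Qed.

(** In the slid map [q 0] moves to the vertex of the distinguished corner, at distance [l.+1] from
    [p 0], whereas [sh] takes the value 0 there. *)
Let f (z : T) : nat := if z == q 0 then l.+1 else if z == c0 then 0 else sh z.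

Let f_p k : k <= l.+1 -> f (p k) = k.
Proof.
move=> hkl; rewrite /f (negPf (sm_pq sm _ _)) // (negPf (sm_pc0 sm _)) //.
rewrite /sh /shifted -/(ep _); case: k hkl => [|k] hkl.
  by rewrite (negPf (ep_stp stp_p0)) right_Fp0; lia.
by rewrite (ep_arr (arr_p (hkl : k <= l))) right_Fp //; lia.
Qed.

Let f_q k : 0 < k -> k <= l -> f (q k) = k.
Proof.
move=> h0 hkl; rewrite /f; case: eqP => [/(sm_q sm hkl (leq0n _))|_]; first by lia.
rewrite (negPf (sm_qc0 sm _)) // /sh /shifted -/(ep _).
by rewrite (negPf (ep_stp (stp_q hkl))) right_Fq //; lia.
Qed.
Let f_q0 : f (q 0) = l.+1. Proof. by rewrite /f eqxx. Qed.

Let f_out z : ~~ trk z -> f z = sh z.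
Proof. by case/trk_out=> h1 _ h3; rewrite /f (negPf h1) (negPf (h3 _ _)). Qed.

Let s1_special z : z != c0 -> z != p 0 -> f (s1 z) = sh (s1 z).
Proof.
move=> h1 h2; rewrite /f; case: eqP => [E|_].
  by case/eqP: h1; apply: s1i; rewrite E e1c0.
case: eqP => [E|//].
by case/eqP: h2; apply: s1i; rewrite E e1p0.
Qed.

Let f_s1p k : k <= l -> f (s1 (p k.+1)) = k.
Proof.
move=> hkl; rewrite s1_special; first last.
- by apply/eqP => /(sm_p sm (hkl : k.+1 <= l.+1) (leq0n _)).
- exact: (sm_pc0 sm).
have [n hn hj] := right_sweepB hkl.
have he : ~~ ep (s1 (p k.+1)).
  rewrite -(ep_iter hj) -hn; apply: ep_stp.
  by case: (k) hkl => [|k'] hk'; [apply: stp_p0|apply: stp_q].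
by rewrite /sh /shifted -/(ep _) (negPf he) Fs1 right_Fp //; lia.
Qed.

Let f_s1q k : k <= l -> f (s1 (q k)) = k.+1.
Proof.
move=> hkl; rewrite s1_special; first last.
- by rewrite eq_sym (sm_pq sm).
- exact: (sm_qc0 sm).
have [n hn hj] := right_sweepA hkl.
have he : ep (s1 (q k)) by rewrite -(ep_iter hj) -hn; apply: ep_arr; apply: arr_p.
by rewrite /sh /shifted -/(ep _) he Fs1 right_Fq //; lia.
Qed.

(** A new vertex inside the path glues a sector ending in [A], where [eps] holds, to a sector ending
    in [Z], where it fails and which is one step closer to the old target: the two differences
    cancel. *)
Let f_cw z : f (s2 z) = f z.
Proof.
have [|hz] := boolP (trk z).
  case/trkP=> [k hkl ->|[|k] hkl ->|->].
  - have [hkl'|->] : k <= l \/ k = l.+1 by lia.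
      by rewrite (e2p hkl') f_s1p // f_p.
    by rewrite e2c f_p // f_q0.
  - by rewrite e2q0 f_s1q // f_q0.
  - by rewrite (e2q hkl) f_s1q ?f_q // ltnW.
  - by rewrite e2c0.
rewrite (e2E hz) (f_out hz) s1_special.
- exact: (shifted_sg l s1i Fs1 right_no_desc hz).
- by case/trk_out: hz.
- by case/trk_out: hz => _ h _; apply: h.
Qed.

Let f_rev z : @is_dart m2 z -> f z <= (f (r2 z)).+1.
Proof.
case/andP=> hzD /=; have [|hz] := boolP (trk z); last first.
  have hz' : ~~ trk (r1 z) := Kr hz.
  rewrite (r2E sm hz) (f_out hz) (f_out hz') => _.
  exact: (shifted_ta s1 l F_r rK Kr hz).
case/trkP=> [k hkl ->|[|k] hkl ->|->].
- have [hkl'|[->|->]] : k < l \/ k = l \/ k = l.+1 by lia.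
  + by rewrite (sm_r2p sm hkl') f_q ?f_p //; lia.
  + by rewrite (sm_r2pl sm) f_q0 f_p //; lia.
  + by rewrite (sm_r2c sm) eqxx.
- by rewrite (r2q0 sm) f_q0 f_p //; lia.
- by rewrite (r2q sm hkl) f_q // f_p //; lia.
- by rewrite (sm_r2c0 sm) eqxx.
Qed.

Let iter_s2 z n : (forall j, j < n -> ~~ trk (iter j s1 z)) ->
  iter n s2 z = iter n s1 z.
Proof.
elim: n => // n ih h; rewrite !iterS ih; last by move=> j hj; apply: h; apply: ltnW.
by rewrite e2E ?h.
Qed.

Lemma right_vertices2 : vertices2 D2 r2 n2 b2 l p q.
Proof.
split=> [[|k] // _ hkl|i j hi hj].
  have [n hn hj] := right_sweepA (ltnW hkl).
  have E : p k.+1 = iter n.+1 s2 (q k.+1).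
    rewrite iterSr (e2q hkl).
    by rewrite iter_s2.
  rewrite /same_vertex (fconnect_sym (s2_inj sm)) E; exact: fconnect_iter.
move=> h; have := fconnect_invariant f_cw h; rewrite !f_p //.
Qed.

Lemma right_sound2 : sound m2.
Proof.
split; [exact: (sm_r2K sm)|exact: (sm_n2 sm)|exact: (out2 sm)|].
by apply: (slid_connected2 sm right_vertices2); apply: (sound_conn hm1).
Qed.
Let hm2 := right_sound2.

Let hp0 : p 0 \in dom m2. Proof. exact: (D2p sm). Qed.
Let fp0 : f (p 0) = 0. Proof. exact: f_p. Qed.

Let G (z : T) : nat := @dist m2 z (p 0).

Let G_ge z : z \in D2 -> f z <= G z.
Proof.
move=> hz; have [w hw hs] := dist_walk hm2 hz hp0.
have h := @walk_potential m2 f z w (p 0) f_cw f_rev hw.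
by move: h; rewrite hs fp0 addn0.
Qed.

(** The potential [f] bounds the distance from below; the slid path itself, followed through the
    [q k], bounds it from above. *)
Lemma right_dist_p k : k <= l.+1 -> @dist m2 (p k) (p 0) = k.
Proof.
move=> hkl; apply/eqP; rewrite eqn_leq -{3}(f_p hkl) G_ge ?(D2p sm) // andbT.
elim: k hkl => [|k ih] hkl; first by apply: (@dist_le m2 (p 0) [::] (p 0)); apply: connect0.
have [hkl'|E] : k < l \/ k = l by lia.
  rewrite (dist_l hm2 _ (right_vertices2.1 k.+1 _ _)) //.
  apply: leq_trans (dist_rev hm2 _ hp0) _; first exact: (D2q sm).
  by rewrite /= (r2q sm hkl') ltnS ih // ltnW.
have -> : @dist m2 (p k.+1) (p 0) = @dist m2 (q 0) (p 0).
  by rewrite -(dist_cw hm2) E; congr dist; apply: e2c.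
apply: leq_trans (dist_rev hm2 _ hp0) _; first exact: (D2q sm).
by rewrite /= (r2q0 sm) ltnS -E ih // ltnW.
Qed.

Lemma right_dist_q k : 0 < k -> k <= l -> @dist m2 (q k) (p 0) = k.
Proof.
move=> h0 hkl; rewrite -(dist_l hm2 _ (right_vertices2.1 k h0 hkl)) right_dist_p //.
exact: ltnW.
Qed.

Lemma right_dist_q0 : @dist m2 (q 0) (p 0) = l.+1.
Proof. by rewrite -e2c (dist_cw hm2) right_dist_p. Qed.

Lemma right_directed : @directed_toward m2 (q 0) (p 0).
Proof.
by rewrite /directed_toward right_dist_q0 /= (r2q0 sm) right_dist_p.
Qed.

(** The slid path reads [q 0], [q l], ..., [q 1]. Its first step is immediate, [q 0] being next to
    the corner. Afterwards the clockwise search from [p j] sweeps the sector that ends at [q j];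
    [eps] fails on it, so [trapped_dart] forbids any half-edge of this sector to start a
    geodesic. *)
Lemma right_leftmost :
  @steered m2 (@cw m2) (p 0) (p l.+1)
    (mkseq (fun k => if k is k'.+1 then q (l - k') else q 0) l.+1).
Proof.
apply/steered_mkseq; split=> [[|k] hkl|] /=.
- exists 0; split=> //; last exact: right_directed.
  by rewrite /= (sm_r2c sm); apply/esym/e2c.
- set j := l - k; have hj0 : 0 < j by rewrite /j; lia.
  have hjl : j <= l by rewrite /j; lia.
  have -> : r2 (if k is k'.+1 then q (l - k') else q 0) = p j.
    case: k @j hkl hj0 hjl => [|k] /= hkl hj0 hjl; first by rewrite subn0 (r2q0 sm).
    by rewrite (_ : l - k = (l - k.+1).+1) ?(r2q sm) //; lia.
  have [n hn hfree] := right_sweepB hjl.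
  rewrite (_ : (if j is 0 then p 0 else q j) = q j) in hn; last by case: (j) hj0.
  have it i : i <= n -> iter i.+1 s2 (p j) = iter i s1 (s1 (p j.+1)).
    move=> hi; rewrite iterSr (e2p hjl) iter_s2 // => i' hi'.
    by apply: hfree; apply: leq_trans hi' hi.
  exists n; split; first by rewrite [RHS]it.
    rewrite /directed_toward right_dist_q //=.
    by move: hj0 hjl; case: (j) => // j' _ hjl; rewrite (r2q sm) // right_dist_p //; lia.
  move=> i hi; rewrite [iter _ _ _]it ?(ltnW hi) //; set z := iter _ _ _.
  have hz : ~~ trk z := hfree i hi.
  have hez : ~~ ep z.
    rewrite /z ep_iter; last by move=> i' hi'; apply: hfree; apply: ltn_trans hi.
    by rewrite -(ep_iter hfree) -hn; apply/ep_stp/stp_q.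
  apply/negP => hd; have hdart := directed_dart hm2 hd.
  have hfz : f z = j.
    rewrite -(f_p (leqW hjl)); have -> : z = iter i.+1 s2 (p j) by rewrite it // ltnW.
    by apply: (fconnect_invariant f_cw); apply: fconnect_iter.
  have Gz : @dist m2 z (p 0) = j.
    rewrite -(right_dist_p (leqW hjl)); apply: (dist_l hm2).
    have -> : z = iter i.+1 s2 (p j) by rewrite it // ltnW.
    by rewrite (same_vertex_sym hm2); apply: same_vertex_iter.
  have [w hw hs] := dist_walk hm2 (etrans (rev_dom hm2 z) (dart_dom hdart)) hp0.
  move: hw; apply/negP.
  apply: (@trapped_dart m2 (arr l p) (stp l p q c0) s1 r1 F f l s1i F_r rK Kr
    right_no_desc f_cw f_rev e2E (r2E sm) f_out (p 0) fp0 _ w z hz hez hdart).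
    move=> x hx; apply/negP => /fconnect_iter_ex [i' Ei].
    by case/negP: (hx i'); rewrite -Ei; apply: trk_p.
  by rewrite hs hfz -Gz.
- have -> : r2 (if l is l'.+1 then q (l - l') else q 0) = p 0; last exact: connect0.
  case El: {1}l => [|l']; first by rewrite (r2q0 sm) El.
  by rewrite El subSnn (r2q sm) // El.
Qed.

End SlideRight.

(** * Sliding back a leftmost geodesic *)

(** Unlike in [sweep], the ends may coincide: around the pointed vertex the sector leaves from [p 0]
    and returns to it. *)
Lemma sweep_loop (T : finType) (f : T -> T) x y : injective f ->
  fconnect f x y ->
  exists2 n, y = iter n.+1 f x &
    forall j, j < n -> iter j.+1 f x != x /\ iter j.+1 f x != y.
Proof.
move=> fi; have [<- _|] := eqVneq x y; last by move=> h1 h2; apply: sweep.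
have hex : exists n, iter n.+1 f x == x.
  by exists (order f x).-1; rewrite prednK ?order_gt0 // iter_order.
case: (ex_minnP hex) => n /eqP hn hmin; exists n => // j hj.
suff h : iter j.+1 f x != x by split.
by apply/negP => /hmin; lia.
Qed.

Section SlideLeft.
Variables (T : finType) (D1 D2 : {set T}) (r1 n1 r2 n2 : T -> T).
Variables (b1 b2 : T -> option nat) (l : nat) (p q : nat -> T) (c0 : T).
Hypothesis sm : slid_marked D1 D2 r1 n1 r2 n2 l p q c0.
Let m1 := @PMap T D1 r1 n1 b1.
Let m2 := @PMap T D2 r2 n2 b2.
Let s1 : T -> T := @cw m1.
Let s2 : T -> T := @cw m2.
(** The slid path in its order of travel: [q 0], then [q l] down to [q 1]. *)
Let a (k : nat) : T := if k is k'.+1 then q (l - k') else q 0.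
Hypothesis hm2 : sound m2.
Hypothesis geo : @steered m2 (@cw m2) (p 0) (p l.+1) (mkseq a l.+1).
Let F (z : T) : nat := @dist m2 z (p 0).
Let trk := trk l p q c0.

Let hy : p 0 \in dom m2. Proof. exact: (D2p sm). Qed.
Let hc : p l.+1 \in dom m2. Proof. exact: (D2p sm). Qed.
Let Fs2 z : F (s2 z) = F z. Proof. exact: (dist_cw hm2). Qed.
Let s2i : injective s2 := s2_inj sm.
Let e1c0 : s1 c0 = q 0 := s1c0 sm.
Let e1p0 : s1 (p 0) = c0 := s1p0 sm.
Let e2c : s2 (p l.+1) = q 0 := s2c sm.
Let e2c0 : s2 c0 = c0 := s2c0 sm.
Let e2p k : k <= l -> s2 (p k) = s1 (p k.+1). Proof. exact: (s2p sm). Qed.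
Let e2q k : k < l -> s2 (q k.+1) = s1 (q k). Proof. exact: (s2q sm). Qed.
Let e2E z : ~~ trk z -> s2 z = s1 z. Proof. exact: (s2E sm). Qed.
Let e2q0 : s2 (q 0) = s1 (q l) := s2q0 sm.

Let hk (k : nat) : T := before (p l.+1) a k.

Let Fh k : k <= l.+1 -> F (r2 (hk k)) = l.+1 - k.
Proof. exact: (steered_mkseq_dist hm2 (@cw_same_vertex m2) hy hc geo). Qed.

Let hkE k : k <= l -> r2 (hk (l.+1 - k)) = p k.
Proof.
move=> hkl; rewrite subSn // /hk /= /a; case E: (l - k) => [|j].
  by rewrite (r2q0 sm); congr p; lia.
by rewrite (_ : l - j = k.+1) ?(r2q sm) //; lia.
Qed.

Let geo1 k : 0 < k -> k <= l ->
  first_after (@cw m2) (fun z => @directed_toward m2 z (p 0)) (p k) (q k).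
Proof.
move=> h0 hkl; rewrite -(hkE hkl); have -> : q k = a (l.+1 - k).
  by rewrite subSn // /a; congr q; lia.
case/steered_mkseq: geo => h _; apply: h; lia.
Qed.

Let Fp k : k <= l.+1 -> F (p k) = k.
Proof.
move=> hkl; have [hkl'|->] : k <= l \/ k = l.+1 by lia.
  by rewrite -(hkE hkl') Fh ?leq_subr //; lia.
by have := Fh (leq0n _); rewrite /hk /= (sm_r2c sm) subn0.
Qed.

Let pq k : 0 < k -> k <= l -> @same_vertex m2 (p k) (q k).
Proof. by move=> h0 hkl; apply: (first_after_vertex _ (geo1 h0 hkl)). Qed.

Let Fq k : 0 < k -> k <= l -> F (q k) = k.
Proof.
move=> h0 hkl; rewrite /F -(dist_l hm2 _ (pq h0 hkl)) -/(F (p k)) Fp //.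
exact: ltnW.
Qed.
Let Fq0 : F (q 0) = l.+1. Proof. by rewrite -e2c Fs2 Fp. Qed.

Lemma left_vertices2 : vertices2 D2 r2 n2 b2 l p q.
Proof.
split=> [|i j hi hj /(dist_l hm2 (p 0))]; first exact: pq.
by rewrite -/(F (p i)) -/(F (p j)) !Fp.
Qed.

(** Leftmostness puts [p k] on every arc from a descending element to [q k] when [k] is positive.
    The remaining cases are immediate: [p 0] is at the target, [c0] is fixed by the rotation, and
    [q 0] directly follows the distinguished corner. *)
Lemma left_no_desc z n : F (r2 z) < F z ->
  (forall j, j <= n -> ~~ trk (iter j s2 z)) -> ~~ stp l p q c0 (iter n.+1 s2 z).
Proof.
move=> hd hfree; apply/negP => hs.
have hFz : F (iter n.+1 s2 z) = F z.
  by apply: (dist_l hm2); rewrite (same_vertex_sym hm2); apply: same_vertex_iter.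
have hw w : trk w -> iter n.+1 s2 z <> s2 w.
  by move=> hw; rewrite iterS => /s2i E; have := hfree n (leqnn n); rewrite E hw.
case/or3P: hs => [/eqP E|/eqP E|/existsP [k /eqP E]].
- by move: hFz; rewrite E Fp //; lia.
- by apply: (hw c0); [apply: trk_c0|rewrite E e2c0].
- have hkl : k <= l := ltn_ord k.
  have [k0|k0] : k = 0 :> nat \/ 0 < k by lia.
    by apply: (hw (p l.+1)); [apply: trk_p|rewrite E e2c k0].
  have [j hj Ej] := cw_first_hit hm2 (geo1 k0 hkl) E hd.
  by have := hfree j hj; rewrite [iter _ _ _]Ej /trk trk_p // ltnW.
Qed.

Let orbF x w n : w = iter n s2 x -> F w = F x.
Proof.
move=> ->; apply: (dist_l hm2); rewrite (same_vertex_sym hm2); exact: same_vertex_iter.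
Qed.
Let orbD x w n : w = iter n s2 x -> x \in D2 -> w != c0.
Proof.
move=> E hx; have h : @same_vertex m2 x w by rewrite E; apply: same_vertex_iter.
by have := same_vertex_dom hm2 h; rewrite /= hx (D2E sm) => /esym/andP [].
Qed.

(** The same sector as in [right_sweepA], now read in the slid map, where it is preceded by
    [q k.+1], or by [q 0] when [k = l]; this predecessor is [u]. *)
Lemma left_sweepA k : k <= l ->
  exists2 n, p k.+1 = iter n s2 (s1 (q k)) &
    forall j, j < n -> ~~ trk (iter j s2 (s1 (q k))).
Proof.
move=> hkl; pose u := if k < l then q k.+1 else q 0.
have uP : (k < l /\ u = q k.+1) \/ (k = l /\ u = q 0).
  by rewrite /u; case: ltnP => h; [left|right; split=> //; lia].
have eu : s2 u = s1 (q k).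
  by case: uP => -[h ->]; [rewrite e2q|rewrite e2q0 h].
have hu : @same_vertex m2 u (p k.+1).
  case: uP => -[h ->]; rewrite (same_vertex_sym hm2); first exact: pq.
  by rewrite -e2c h; apply: fconnect1.
have hup : u != p k.+1.
  by case: uP => -[h ->]; rewrite eq_sym (sm_pq sm).
have huD : u \in D2 by case: uP => -[h ->]; apply: (D2q sm).
have hFu : F u = k.+1 by rewrite /F (dist_l hm2 _ hu) -/(F (p k.+1)) Fp.
have [n hn hj] := sweep hu hup; rewrite -eu.
exists n => [|j hlt]; first by rewrite -iterSr.
rewrite -iterSr; have [h1 h2] := hj j hlt; move Ew: (iter _ _ _) => w.
have hF : F w = k.+1 by rewrite -hFu; apply: (orbF (n := j.+1)).
have hw0 : w != c0 by apply: (orbD (n := j.+1) (x := u)).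
rewrite [iter _ _ _]Ew in h1 h2.
apply/negP => /trkP [i hi E|i hi E|E].
- by move: h2; rewrite E -(_ : i = k.+1) ?eqxx //; move: hF; rewrite E Fp.
- have [i0|i0] : i = 0 \/ 0 < i by lia.
    have kl : k = l by move: hF; rewrite E i0 Fq0; lia.
    by move: h1; rewrite E i0; case: uP => -[h ->]; [lia|rewrite eqxx].
  have ik : i = k.+1 by move: hF; rewrite E Fq.
  by move: h1; rewrite E; case: uP => -[h ->]; [rewrite ik eqxx|lia].
- by rewrite E eqxx in hw0.
Qed.

Lemma left_sweepB k : k <= l ->
  let t := if k is 0 then p 0 else q k in
  exists2 n, t = iter n s2 (s2 (p k)) &
    forall j, j < n -> ~~ trk (iter j s2 (s2 (p k))).
Proof.
move=> hkl t.
have tP : (k = 0 /\ t = p 0) \/ (0 < k /\ t = q k).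
  by rewrite /t; case: (k); [left|right].
have ht : @same_vertex m2 (p k) t.
  by case: tP => -[h ->]; [rewrite h; apply: connect0|apply: pq].
have [n hn hj] := sweep_loop s2i ht.
exists n => [|j hlt]; first by rewrite -iterSr.
rewrite -iterSr; have [h1 h2] := hj j hlt; move Ew: (iter _ _ _) => w.
have hF : F w = k by rewrite -(Fp (leqW hkl)); apply: (orbF (n := j.+1)).
have hw0 : w != c0.
  by apply: (orbD (n := j.+1) (x := p k)) => //; apply: (D2p sm); apply: leqW.
rewrite [iter _ _ _]Ew in h1 h2.
apply/negP => /trkP [i hi E|i hi E|E].
- by move: h1; rewrite E -(_ : i = k) ?eqxx //; move: hF; rewrite E Fp.
- have [i0|i0] : i = 0 \/ 0 < i by lia.
    by move: hF; rewrite E i0 Fq0; lia.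
  have ik : i = k by move: hF; rewrite E Fq.
  by move: h2; rewrite E; case: tP => -[h ->]; [lia|rewrite ik eqxx].
- by rewrite E eqxx in hw0.
Qed.

Let AZ : forall z, arr l p z -> ~~ stp l p q c0 z := arr_stp sm.
Let F_r z : ~~ trk z -> F z <= (F (r2 z)).+1.
Proof.
move=> _; have [hz|hz] := boolP (z \in D2); first exact: (dist_rev hm2).
by rewrite (proj1 (out2 sm hz)).
Qed.
Let rK z : ~~ trk z -> r2 (r2 z) = z. Proof. by move=> _; apply: (sm_r2K sm). Qed.
Let Kr z : ~~ trk z -> ~~ trk (r2 z).
Proof. by move=> hz; rewrite (r2E sm hz) /trk (trk_r1 sm). Qed.

Let ep := eps (arr l p) (stp l p q c0) s2 r2 F.
Let sh := shifted (arr l p) (stp l p q c0) s2 r2 F l.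
Let ep_iter z n : (forall j, j < n -> ~~ trk (iter j s2 z)) -> ep (iter n s2 z) = ep z.
Proof. exact: (eps_iter s2i left_no_desc). Qed.
Let ep_stp z : stp l p q c0 z -> ~~ ep z. Proof. exact: (eps_Z _ _ _ AZ). Qed.
Let ep_arr z : arr l p z -> ep z. Proof. exact: eps_A. Qed.

(** In the original map [q 0] and [c0] belong to the vertex where the path starts, at distance [l]
    from the distinguished corner, whereas [sh] vanishes at [q 0]. *)
Let f (z : T) : nat := if (z == q 0) || (z == c0) then l else sh z.

Let f_p k : k <= l -> f (p k.+1) = l - k.
Proof.
move=> hkl; rewrite /f (negPf (sm_pq sm _ _)) // (negPf (sm_pc0 sm _)) //.
by rewrite /sh /shifted -/(ep _) (ep_arr (arr_p hkl)) Fp //=; lia.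
Qed.

Let f_p0 : f (p 0) = l.
Proof.
rewrite /f (negPf (sm_pq sm _ _)) // (negPf (sm_pc0 sm _)) //.
by rewrite /sh /shifted -/(ep _) (negPf (ep_stp stp_p0)) Fp //=; lia.
Qed.

Let f_q k : k <= l -> f (q k) = l - k.
Proof.
move=> hkl; rewrite /f; case: eqP => [/(sm_q sm hkl (leq0n _)) ->|h].
  by rewrite subn0.
have h0 : 0 < k by case: (k) h.
rewrite (negPf (sm_qc0 sm _)) // /sh /shifted -/(ep _).
by rewrite (negPf (ep_stp (stp_q hkl))) Fq //=; lia.
Qed.

Let f_out z : ~~ trk z -> f z = sh z.
Proof. by case/trk_out=> h1 _ h3; rewrite /f (negPf h1) (negPf (h3 _ _)). Qed.

Let s2_special z : z != c0 -> z != p l.+1 -> f (s2 z) = sh (s2 z).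
Proof.
move=> h1 h2; rewrite /f; case: eqP => [E|_].
  by case/eqP: h2; apply: s2i; rewrite E e2c.
case: eqP => [E|//].
by case/eqP: h1; apply: s2i; rewrite E e2c0.
Qed.

Let f_s1p k : k <= l -> f (s1 (p k.+1)) = l - k.
Proof.
move=> hkl; rewrite -e2p // s2_special; first last.
- by apply/eqP => /(sm_p sm (leqW hkl) (leqnn _)); lia.
- by apply: (sm_pc0 sm); apply: leqW.
have [n hn hj] := left_sweepB hkl.
have he : ~~ ep (s2 (p k)).
  rewrite -(ep_iter hj) -hn; apply: ep_stp.
  by case: (k) hkl => [|k'] hk'; [apply: stp_p0|apply: stp_q].
by rewrite /sh /shifted -/(ep _) (negPf he) Fs2 Fp ?(leqW hkl) //=; lia.
Qed.

Let f_s1q k : k <= l -> f (s1 (q k)) = l - k.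
Proof.
move=> hkl; have [n hn hj] := left_sweepA hkl.
have he : ep (s1 (q k)) by rewrite -(ep_iter hj) -hn; apply: ep_arr; apply: arr_p.
have hF : F (s1 (q k)) = k.+1.
  by rewrite -(Fp (hkl : k.+1 <= l.+1)) hn; apply/esym/(orbF (n := n)).
have E : f (s1 (q k)) = sh (s1 (q k)).
  have [hlt|->] : k < l \/ k = l by lia.
    rewrite -e2q // s2_special ?(sm_qc0 sm) //.
    by rewrite eq_sym (sm_pq sm).
  by rewrite -e2q0 s2_special ?(sm_qc0 sm) // eq_sym (sm_pq sm).
by rewrite E /sh /shifted -/(ep _) he hF /=; lia.
Qed.

Let f_cw z : f (s1 z) = f z.
Proof.
have [|hz] := boolP (trk z).
  case/trkP=> [[|k] hkl ->|k hkl ->|->].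
  - by rewrite e1p0 f_p0 /f eqxx orbT.
  - by rewrite f_s1p // f_p.
  - by rewrite f_s1q // f_q.
  - by rewrite e1c0 f_q // subn0 /f eqxx orbT.
rewrite -(e2E hz) (f_out hz) s2_special.
- exact: (shifted_sg l s2i Fs2 left_no_desc hz).
- by case/trk_out: hz.
- by case/trk_out: hz => _ h _; apply: h.
Qed.

Let f_rev z : @is_dart m1 z -> f z <= (f (r1 z)).+1.
Proof.
case/andP=> hzD /=; have [|hz] := boolP (trk z); last first.
  have hz' : ~~ trk (r2 z) := Kr hz.
  rewrite -(r2E sm hz) (f_out hz) (f_out hz') => _.
  exact: (shifted_ta s2 l F_r rK Kr hz).
case/trkP=> [[|k] hkl ->|[|k] hkl ->|->].
- by rewrite (sm_r1p sm) // f_q // f_p0; lia.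
- have [hkl'|->] : k < l \/ k = l by lia.
  + by rewrite (sm_r1p sm hkl') f_q ?f_p //; lia.
  + by rewrite (sm_r1c sm) eqxx.
- by rewrite (r1q sm) // f_q // f_p0; lia.
- by rewrite (r1q sm) // f_q // f_p //; lia.
- by rewrite (sm_r1c0 sm) eqxx.
Qed.

Let iter_s1 z n : (forall j, j < n -> ~~ trk (iter j s2 z)) ->
  iter n s1 z = iter n s2 z.
Proof.
elim: n => // n ih h; rewrite !iterS ih; last by move=> j hj; apply: h; apply: ltnW.
by rewrite e2E // h.
Qed.

Lemma left_vertices1 : vertices1 D1 r1 n1 b1 l p q.
Proof.
split=> [k hkl|i j hi hj h].
  have [n hn hfree] := left_sweepA hkl.
  have -> : p k.+1 = iter n.+1 s1 (q k) by rewrite iterSr iter_s1.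
  exact: fconnect_iter.
have := fconnect_invariant f_cw h; rewrite !f_q //; lia.
Qed.

Lemma left_sound1 : sound m1.
Proof.
split; [exact: (sm_r1K sm)|exact: (sm_n1 sm)|exact: (sm_out sm)|].
by apply: (slid_connected1 sm left_vertices1); apply: (sound_conn hm2).
Qed.
Let hm1 := left_sound1.

Let hc1 : p l.+1 \in dom m1. Proof. exact: (sm_Dp sm). Qed.
Let fc : f (p l.+1) = 0. Proof. by rewrite f_p // subnn. Qed.
Let G (z : T) : nat := @dist m1 z (p l.+1).

Let G_ge z : z \in D1 -> f z <= G z.
Proof.
move=> hz; have [w hw hs] := dist_walk hm1 hz hc1.
have h := @walk_potential m1 f z w (p l.+1) f_cw f_rev hw.
by move: h; rewrite hs fc addn0.
Qed.

Let Gs1 z : G (s1 z) = G z. Proof. exact: (dist_cw hm1). Qed.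

Let Gq k : k <= l -> G (q k) = l - k.
Proof.
move=> hkl; apply/eqP; rewrite eqn_leq -{2}(f_q hkl) G_ge ?(sm_Dq sm) // andbT.
move Ej: (l - k) => j; elim: j k hkl Ej => [|j ih] k hkl Ej.
  rewrite (_ : k = l); last by lia.
  rewrite leqn0 /G (dist_eq0 hm1) //; first exact: (left_vertices1.1 l (leqnn l)).
  exact: (sm_Dq sm).
have hkl' : k < l by lia.
rewrite /G (dist_l hm1 _ (left_vertices1.1 k hkl)).
apply: leq_trans (dist_rev hm1 _ hc1) _; first exact: (sm_Dp sm).
by rewrite /= (sm_r1p sm hkl') ltnS; apply: ih; lia.
Qed.

Let Gp k : k <= l -> G (p k.+1) = l - k.
Proof. by move=> hkl; rewrite /G -(dist_l hm1 _ (left_vertices1.1 k hkl)) -/(G _) Gq. Qed.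

Let Gp0 : G (p 0) = l.
Proof. by rewrite -Gs1 e1p0 -Gs1 e1c0 Gq // subn0. Qed.

Let trap k z i : k < l -> z = iter i s2 (s2 (p k)) ->
  (forall j, j <= i -> ~~ trk (iter j s2 (s2 (p k)))) -> ~~ ep z ->
  ~~ @directed_toward m1 z (p l.+1).
Proof.
move=> hkl Ez hfree hez; have hz : ~~ trk z by rewrite Ez hfree.
apply/negP => hd; have hdart := directed_dart hm1 hd.
have Ez1 : z = iter i.+1 s1 (p k.+1).
  rewrite iterSr -e2p ?(ltnW hkl) // iter_s1 // => j hj.
  by apply: hfree; apply: ltnW.
have hfz : f z = l - k.
  rewrite -(f_p (ltnW hkl)) Ez1; apply: (fconnect_invariant f_cw); exact: fconnect_iter.
have Gz : @dist m1 z (p l.+1) = l - k.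
  rewrite -(Gp (ltnW hkl)) Ez1; apply: (dist_l hm1).
  by rewrite (same_vertex_sym hm1); apply: same_vertex_iter.
have [w hw hs] := dist_walk hm1 (etrans (rev_dom hm1 z) (dart_dom hdart)) hc1.
move: hw; apply/negP.
have e1E z' : ~~ trk z' -> s1 z' = s2 z' by move=> h; rewrite e2E.
have r1E z' : ~~ trk z' -> r1 z' = r2 z' by move=> h; rewrite (r2E sm).
apply: (@trapped_dart m1 (arr l p) (stp l p q c0) s2 r2 F f l s2i F_r rK Kr
  left_no_desc f_cw f_rev e1E r1E f_out (p l.+1) fc _ w z hz hez hdart).
  move=> x hx; apply/negP => /fconnect_iter_ex [i' Ei].
  by case/negP: (hx i'); rewrite -Ei; apply: trk_p.
by rewrite hs hfz -Gz.
Qed.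

Lemma left_rightmost :
  @steered m1 (@ccw m1) (p l.+1) c0 (mkseq (fun k => p k.+1) l).
Proof.
apply/steered_mkseq; split=> [k hkl|] /=; last first.
  case El: l => [|l'] /=.
    rewrite (sm_r1c0 sm) -El; apply: (@same_vertex_trans m1 _ (q 0)).
      by rewrite -e1c0; apply: fconnect1.
    by have := left_vertices1.1 l (leqnn l); rewrite {1}El.
  rewrite (sm_r1p sm) ?El //; rewrite -El; exact: left_vertices1.1 l (leqnn l).
have [n hn hfree] := left_sweepB (ltnW hkl).
have hdir : @directed_toward m1 (p k.+1) (p l.+1).
  have E1 : @dist m1 (q k.+1) (p l.+1) = l - k.+1 := Gq hkl.
  have E2 : @dist m1 (p k.+1) (p l.+1) = l - k := Gp (ltnW hkl).
  rewrite /directed_toward -[rev (p k.+1 : elt m1)]/(r1 (p k.+1)) (sm_r1p sm hkl) E1 E2.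
  by lia.
set t := (X in X = _) in hn.
have it i : i <= n -> iter i.+1 s1 (p k.+1) = iter i s2 (s2 (p k)).
  move=> hi; rewrite iterSr -e2p ?(ltnW hkl) // iter_s1 // => i' hi'.
  by apply: hfree; apply: leq_trans hi' hi.
(* The sector is known through clockwise iterates from [p k.+1], but the search for the rightmost
   step runs counterclockwise from its other end [t]. *)
have back i j : i + j = n.+1 -> iter i (@ccw m1) t = iter j s1 (p k.+1).
  move=> hij; rewrite hn -it // -hij; elim: (i) => // i' ih.
  by rewrite iterSr addSn iterS (cwK hm1).
have htrap i : i < n -> ~~ @directed_toward m1 (iter i.+1 (@ccw m1) t) (p l.+1).
  move=> hi; rewrite (back _ (n - i.+1).+1); last by lia.
  rewrite it; last by lia.
  apply: (trap hkl (erefl _)) => [j hj|]; first by apply: hfree; lia.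
  rewrite ep_iter; last by move=> j hj; apply: hfree; lia.
  rewrite -(ep_iter hfree) -hn; apply: ep_stp.
  by rewrite /t; case: (k) hkl => [|k'] hk'; [apply: stp_p0|apply: stp_q; apply: ltnW].
(* At the start there is one more candidate to discard: the search from [c0] first meets [p 0],
   which is a loop in this map and does not come closer to the target. *)
case: k hkl @t hn hfree hdir it back htrap => [|k] hkl t hn hfree hdir it back htrap.
  have ec : ccw (c0 : elt m1) = t by rewrite -e1p0; apply: (cwK hm1).
  exists n.+1; rewrite [before _ _ _]/= (sm_r1c0 sm); split=> //.
    by rewrite iterSr ec (back n.+1 0 (addn0 _)).
  case=> [|i] hi; last by rewrite iterSr ec; apply: htrap.
  rewrite /= ec /directed_toward -[rev (t : elt m1)]/(r1 (p 0)) (sm_r1p sm) //.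
  have E1 : @dist m1 (q 0) (p l.+1) = l - 0 := Gq (leq0n l).
  have E2 : @dist m1 t (p l.+1) = l := Gp0.
  by rewrite E1 E2 subn0 ltnn.
exists n; rewrite [before _ _ _]/= (sm_r1p sm) ?(ltnW hkl) //; split=> //.
by rewrite (back n.+1 0 (addn0 _)).
Qed.

End SlideLeft.

(** * Inserting a corner *)

Section Insertion.
Variables (T : finType) (f : T -> T) (s : T) (g : option T -> option T).
Hypotheses (fi : injective f)
  (gS : forall x, g (Some x) = if x == s then None else Some (f x))
  (gN : g None = Some (f s)).

Lemma insert_inj : injective g.
Proof.
move=> [x|] [y|] //; rewrite ?gS ?gN.
- case: eqP => [->|_]; case: eqP => [->|_] // [] /fi -> //.
- by case: eqP => // h [] /fi.
- by case: eqP => // h [] /fi E; case: h.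
Qed.

(** Collapsing the inserted element onto its predecessor [s] turns each step of [g] into at most one
    step of [f]. *)
Lemma insert_connect x y : fconnect g (Some x) (Some y) = fconnect f x y.
Proof.
pose pi (z : option T) := odflt s z.
have step z : fconnect f (pi z) (pi (g z)).
  case: z => [z|]; rewrite ?gS ?gN /=; last exact: fconnect1.
  by case: eqP => [->|_] /=; [apply: connect0|apply: fconnect1].
apply/idP/idP => [/fconnect_iter_ex [n E]|/fconnect_iter_ex [n ->]].
  rewrite -[y]/(pi (Some y)) E -[x in fconnect _ x]/(pi (Some x)).
  by elim: n {E} => [|n ih]; [apply: connect0|apply: connect_trans ih (step _)].
elim: n => [|n ih]; first exact: connect0.
apply: connect_trans ih _; rewrite iterS; set z := iter _ _ _.
have := fconnect1 g (Some z); rewrite gS; case: eqP => // -> h.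
by apply: connect_trans h _; rewrite -gN; apply: fconnect1.
Qed.

(** The inserted element is never alone in its cycle, so [Some] induces a bijection between the
    cycles. *)
Lemma insert_fcard (D : {set T}) (D' : {set option T}) :
  (forall x, (f x \in D) = (x \in D)) -> s \in D ->
  (forall z, (z \in D') = if z is Some x then x \in D else true) ->
  fcard g (mem D') = fcard f (mem D).
Proof.
move=> hD hs hD'.
have h1 : connect_sym (frel g) := fconnect_sym insert_inj.
have h2 : connect_sym (frel f) := fconnect_sym fi.
have h3 : closed (frel g) (mem D').
  move=> [x|] y /eqP <-; rewrite ?gS ?gN !hD' ?hD ?hs //.
  by case: eqP => [->|_]; rewrite ?hs ?hD.
rewrite (adjunction_n_comp Some h1 h2 h3).
  by apply: eq_n_comp_r => x; rewrite !inE hD'.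
split=> [[x|] hx|x y _]; last by rewrite insert_connect.
- by exists x; apply: connect0.
- by exists (f s); apply: connect1; rewrite /= gN.
Qed.

End Insertion.

Section AddCorner.
Variables (m : pmap) (hm : sound m) (s : elt m) (hs : s \in dom m) (o : option nat).
Let M := add_corner s o.

Lemma add_corner_nxtS (x : elt m) : @nxt M (Some x) = if x == s then None else Some (nxt x).
Proof. by []. Qed.
(** In the rotation the corner comes right after [rev s], so the results on insertions apply to [cw]
    as well as to [nxt]. *)
Lemma add_corner_cwS (x : elt m) :
  @cw M (Some x) = if x == rev s then None else Some (cw x).
Proof. by rewrite /cw /= (inv_eq (revK hm)). Qed.
Lemma add_corner_cwN : @cw M None = Some (cw (rev s)).
Proof. by rewrite /cw /= (revK hm). Qed.

Lemma add_corner_dom (z : elt M) :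
  (z \in dom M) = if z is Some x then x \in dom m else true.
Proof. by rewrite inE; case: z. Qed.

Lemma add_corner_sound : sound M.
Proof.
split.
- by case=> [x|] //=; rewrite (revK hm).
- exact: (insert_inj (nxt_inj hm) add_corner_nxtS).
- move=> [x|]; rewrite add_corner_dom // => hx; have [/= -> E] := sound_out hm hx.
  by rewrite E; case: eqP => // E2; rewrite E2 hs in hx.
- pose pi (z : elt M) : elt m := odflt s z.
  set e := [rel u w | _].
  have e_sym : connect_sym e.
    apply: gen_connect_sym; last exact: (insert_inj (nxt_inj hm) add_corner_nxtS).
    by case=> [x|] //=; rewrite (revK hm).
  have hpi z : connect e z (Some (pi z)).
    case: z => [x|] /=; first exact: connect0.
    by rewrite e_sym; apply: connect1; apply/orP; right; rewrite /= eqxx.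
  have hS x y : connect [rel u w | (w == rev u) || (w == nxt u)] x y ->
      connect e (Some x) (Some y).
    case/connectP=> q; elim: q x => [|z q ih] x /=; first by move=> _ ->; apply: connect0.
    case/andP=> h1 h2 /(ih _ h2); apply: connect_trans; case/orP: h1 => /eqP ->.
      by apply: connect1; rewrite /= eqxx.
    have [->|ne] := eqVneq x s; last first.
      by apply: connect1; rewrite /= (negPf ne) eqxx orbT.
    by apply: (connect_trans (y := None)); apply: connect1; apply/orP; right;
      rewrite /= eqxx.
  move=> x y hx hy; apply: connect_trans (hpi x) _.
  rewrite e_sym; apply: connect_trans (hpi y) _; rewrite e_sym; apply: hS.
  have hd z : z \in dom M -> pi z \in dom m by rewrite add_corner_dom; case: z.
  by apply: (sound_conn hm); apply: hd.
Qed.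

Lemma add_corner_vertex x y : @same_vertex M (Some x) (Some y) = same_vertex x y.
Proof.
exact: (insert_connect add_corner_cwS add_corner_cwN).
Qed.

Lemma add_corner_vertexN (z : elt M) : @same_vertex M z (Some (odflt (nxt s) z)).
Proof.
case: z => [x|] /=; first exact: connect0.
by have := fconnect1 (@cw M) None; rewrite add_corner_cwN /cw (revK hm).
Qed.

Lemma add_corner_fcard_nxt : fcard (@nxt M) (mem (dom M)) = fcard (@nxt m) (mem (dom m)).
Proof.
apply: (insert_fcard (nxt_inj hm) add_corner_nxtS) => //; first exact: (nxt_dom hm).
exact: add_corner_dom.
Qed.

Lemma add_corner_fcard_cw : fcard (@cw M) (mem (dom M)) = fcard (@cw m) (mem (dom m)).
Proof.
apply: (insert_fcard (cw_inj hm) add_corner_cwS) => //; first exact: add_corner_cwN.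
- exact: (cw_dom hm).
- by rewrite (rev_dom hm).
- exact: add_corner_dom.
Qed.

Lemma add_corner_dart (z : elt M) : is_dart z = if z is Some x then is_dart x else false.
Proof. by rewrite /is_dart add_corner_dom; case: z. Qed.

Lemma add_corner_vertex_odflt (z w : elt M) :
  @same_vertex M z w = same_vertex (odflt (nxt s) z) (odflt (nxt s) w).
Proof.
have hM := add_corner_sound.
by rewrite (same_vertex_l hM _ (add_corner_vertexN z))
   (same_vertex_r hM _ (add_corner_vertexN w)) add_corner_vertex.
Qed.

Lemma add_corner_walk (z : elt M) q (w : elt M) : walk z q w ->
  exists2 q', q = map Some q' & walk (odflt (nxt s) z) q' (odflt (nxt s) w).
Proof.
elim: q z => [|e q ih] z /=; first by rewrite add_corner_vertex_odflt; exists [::].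
case/and3P=> h1 h2 /ih [q' -> h3]; case: e h1 h2 h3 => [e|]; rewrite add_corner_dart //.
by move=> h1; rewrite add_corner_vertex_odflt => h2 h3; exists (e :: q') => //=; rewrite h1 h2.
Qed.

Lemma add_corner_walkS (x : elt m) q y : walk x q y -> @walk M (Some x) (map Some q) (Some y).
Proof.
elim: q x => [|e q ih] x /=; first by rewrite add_corner_vertex.
by case/and3P=> h1 h2 /ih ->; rewrite add_corner_dart h1 add_corner_vertex h2.
Qed.

Lemma add_corner_dist (z w : elt M) : z \in dom M -> w \in dom M ->
  @dist M z w = dist (odflt (nxt s) z) (odflt (nxt s) w).
Proof.
have hM := add_corner_sound; move=> hz hw.
have hd (u : elt M) : u \in dom M -> odflt (nxt s) u \in dom m.
  by rewrite add_corner_dom; case: u => //= _; rewrite (nxt_dom hm).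
apply/eqP; rewrite eqn_leq; apply/andP; split; last first.
  have [q hq <-] := dist_walk hM hz hw; have [q' -> h] := add_corner_walk hq.
  by rewrite size_map; apply: dist_le.
have [q hq <-] := dist_walk hm (hd z hz) (hd w hw).
rewrite (dist_l hM _ (add_corner_vertexN z)) (dist_r hM _ (add_corner_vertexN w)).
rewrite -(size_map Some q); apply: dist_le; exact: add_corner_walkS.
Qed.

Lemma add_corner_directed (x y : elt m) : x \in dom m -> y \in dom m ->
  @directed_toward M (Some x) (Some y) = directed_toward x y.
Proof.
move=> hx hy; rewrite /directed_toward !add_corner_dist ?add_corner_dom //=.
by rewrite (rev_dom hm).
Qed.

End AddCorner.

(** The arguments on geodesics take place in maps where the distinguished corner is marked; this
    brings their conclusion on connectedness back to the map itself. *)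
Lemma sound_remove_corner (m : pmap) (s : elt m) (o : option nat) :
  involutive (@rev m) -> injective (@nxt m) ->
  (forall x : elt m, x \notin dom m -> rev x = x /\ nxt x = x) ->
  s \in dom m -> sound (add_corner s o) -> sound m.
Proof.
move=> h1 h2 h3 hs hM; split=> // x y hx hy.
have hd z : z \in dom m -> Some z \in dom (add_corner s o) by rewrite inE.
pose pi (z : option (elt m)) := odflt s z.
suff key (u w : elt (add_corner s o)) : connect [rel u w | (w == rev u) || (w == nxt u)] u w ->
    connect [rel u w | (w == rev u) || (w == nxt u)] (pi u) (pi w).
  exact: (key (Some x) (Some y) (sound_conn hM (hd x hx) (hd y hy))).
case/connectP=> q; elim: q u => [|z q ih] u /=; first by move=> _ ->; apply: connect0.
case/andP=> h4 h5 /(ih _ h5); apply: connect_trans.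
case/orP: h4 => /eqP ->; case: u => [u|] /=.
- by apply: connect1; rewrite /= eqxx.
- exact: connect0.
- case: eqP => [->|_] /=; first exact: connect0.
  by apply: connect1; rewrite /= eqxx orbT.
- by apply: connect1; rewrite /= eqxx orbT.
Qed.

(* As [slid_marked], before the distinguished corner, which follows [s], is
   marked. *)
Record slid (T : finType) (D1 D2 : {set T}) (r1 n1 r2 n2 : T -> T)
    (l : nat) (p q : nat -> T) (s c0 : T) : Prop := Slid {
  sl_r1K : involutive r1;
  sl_r2K : involutive r2;
  sl_n1 : injective n1;
  sl_n2 : injective n2;
  sl_r1p : forall k, k <= l -> r1 (p k) = q k;
  sl_r1c0 : r1 c0 = c0;
  sl_r2p : forall k, k < l -> r2 (p k) = q k.+1;
  sl_r2pl : r2 (p l) = q 0;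
  sl_r2c0 : r2 c0 = c0;
  sl_rE : forall z, z != c0 -> (forall k, k <= l -> z != p k) ->
    (forall k, k <= l -> z != q k) -> r2 z = r1 z;
  sl_n1q : n1 (q 0) = c0;
  sl_n1c0 : n1 c0 = q 0;
  sl_n2s : n2 s = q 0;
  sl_n2q : n2 (q 0) = n1 s;
  sl_n2c0 : n2 c0 = c0;
  sl_nE : forall z, z != c0 -> z != q 0 -> z != s -> n2 z = n1 z;
  sl_p : forall i j, i <= l -> j <= l -> p i = p j -> i = j;
  sl_q : forall i j, i <= l -> j <= l -> q i = q j -> i = j;
  sl_pq : forall i j, i <= l -> j <= l -> p i != q j;
  sl_pc0 : forall i, i <= l -> p i != c0;
  sl_qc0 : forall i, i <= l -> q i != c0;
  sl_sc0 : s != c0;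
  sl_sq : s != q 0;
  sl_Dp : forall i, i <= l -> p i \in D1;
  sl_Dq : forall i, i <= l -> q i \in D1;
  sl_Ds : s \in D1;
  sl_Dc0 : c0 \in D1;
  sl_D2 : D2 = D1 :\ c0;
  sl_out : forall z, z \notin D1 -> r1 z = z /\ n1 z = z }.

(** Past [l] the value is [None], which is the inserted corner: it becomes the last element [p l.+1]
    required by [slid_marked]. *)
Definition markp (T : Type) (l : nat) (p : nat -> T) (k : nat) : option T :=
  if k <= l then Some (p k) else None.

Section Slid.
Variables (T : finType) (D1 D2 : {set T}) (r1 n1 r2 n2 : T -> T).
Variables (b : T -> option nat) (l : nat) (p q : nat -> T) (s c0 : T).
Hypothesis sl : slid D1 D2 r1 n1 r2 n2 l p q s c0.
Let m1 := @PMap T D1 r1 n1 b.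
Let m2 := @PMap T D2 r2 n2 b.
Let M1 := @add_corner m1 s None.
Let M2 := @add_corner m2 s None.

Lemma slid_mark : slid_marked (dom M1) (dom M2) (@rev M1) (@nxt M1) (@rev M2) (@nxt M2)
  l (markp l p) (fun k => Some (q k)) (Some c0).
Proof.
have mp k : k <= l -> markp l p k = Some (p k) by rewrite /markp => ->.
have mc : markp l p l.+1 = None by rewrite /markp ltnn.
have ks k : k <= l.+1 -> k <= l \/ k = l.+1 by lia.
split.
- by case=> [x|] //=; rewrite (sl_r1K sl).
- by case=> [x|] //=; rewrite (sl_r2K sl).
- by apply: (insert_inj (f := n1) (s := s)) => //; apply: (sl_n1 sl).
- by apply: (insert_inj (f := n2) (s := s)) => //; apply: (sl_n2 sl).
- by move=> k hk; rewrite mp //= (sl_r1p sl).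
- by rewrite mc.
- by rewrite /= (sl_r1c0 sl).
- by move=> k hk; rewrite mp 1?ltnW //= (sl_r2p sl).
- by rewrite mp //= (sl_r2pl sl).
- by rewrite mc.
- by rewrite /= (sl_r2c0 sl).
- case=> [z|] //= h1 h2 h3; congr Some; apply: (sl_rE sl) => [|k hk|k hk].
  + by apply: contraNneq h1 => ->.
  + by apply: contraNneq (h2 k (leqW hk)) => ->; rewrite mp.
  + by apply: contraNneq (h3 k hk) => ->.
- by rewrite /= eq_sym (negPf (sl_sq sl)) (sl_n1q sl).
- by rewrite /= eq_sym (negPf (sl_sc0 sl)) (sl_n1c0 sl).
- by rewrite mc /= (sl_n2s sl).
- by rewrite mc /= eq_sym (negPf (sl_sq sl)) (sl_n2q sl).
- by rewrite /= eq_sym (negPf (sl_sc0 sl)) (sl_n2c0 sl).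
- rewrite mc; case=> [z|] //= h1 h2 _; case: eqP => // h3; congr Some; apply: (sl_nE sl).
  + by apply: contraNneq h1 => ->.
  + by apply: contraNneq h2 => ->.
  + exact/eqP.
- move=> i j /ks [hi|->] /ks [hj|->]; rewrite ?mc ?mp // => -[]; exact: (sl_p sl).
- by move=> i j hi hj [] /(sl_q sl hi hj).
- move=> i j /ks [hi|->] hj; rewrite ?mc ?mp //.
  by apply/eqP => -[] /eqP; rewrite (negPf (sl_pq sl hi hj)).
- move=> i /ks [hi|->]; rewrite ?mc ?mp //.
  by apply/eqP => -[] /eqP; rewrite (negPf (sl_pc0 sl hi)).
- by move=> i hi; apply/eqP => -[] /eqP; rewrite (negPf (sl_qc0 sl hi)).
- by move=> i /ks [hi|->]; rewrite ?mc ?mp // inE //=; apply: (sl_Dp sl).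
- by move=> i hi; rewrite inE /=; apply: (sl_Dq sl).
- by rewrite inE /=; apply: (sl_Dc0 sl).
- by apply/setP => -[z|]; rewrite !inE //= (sl_D2 sl) !inE.
- case=> [z|]; rewrite inE //= => hz; have [-> ->] := sl_out sl hz.
  by case: eqP hz => // ->; rewrite (sl_Ds sl).
Qed.

End Slid.

(** * Types of slid maps *)

Section SlidTransfer.
Variables (T : finType) (D1 D2 : {set T}) (r1 n1 r2 n2 : T -> T).
Variables (b : T -> option nat) (l : nat) (p q : nat -> T) (s c0 : T).
Hypothesis sl : slid D1 D2 r1 n1 r2 n2 l p q s c0.
Let m1 := @PMap T D1 r1 n1 b.
Let m2 := @PMap T D2 r2 n2 b.
Let M1 := @add_corner m1 s None.
Let M2 := @add_corner m2 s None.

(** [None] is the distinguished corner: the target of this path, and the start of the one in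
    [left_geo]. *)
Definition right_geo : Prop :=
  @steered M1 (@ccw M1) None (Some c0) (mkseq (fun k => markp l p k.+1) l).
Definition left_geo : Prop :=
  @steered M2 (@cw M2) (Some (p 0)) None
    (mkseq (fun k => Some (if k is k'.+1 then q (l - k') else q 0)) l.+1).

Let sm : slid_marked (dom M1) (dom M2) (@rev M1) (@nxt M1) (@rev M2) (@nxt M2)
  l (markp l p) (fun k => Some (q k)) (Some c0) := slid_mark b sl.

Let mc : markp l p l.+1 = None. Proof. by rewrite /markp ltnn. Qed.
Let m0 : markp l p 0 = Some (p 0). Proof. by []. Qed.

Let r1q k : k <= l -> r1 (q k) = p k.
Proof. by move=> hk; rewrite -(sl_r1p sl hk) (sl_r1K sl). Qed.
Let r2q k : k < l -> r2 (q k.+1) = p k.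
Proof. by move=> hk; rewrite -(sl_r2p sl hk) (sl_r2K sl). Qed.
Let r2q0 : r2 (q 0) = p l.
Proof. by rewrite -(sl_r2pl sl) (sl_r2K sl). Qed.

Lemma slid_rev_fix x : x != c0 -> (r2 x == x) = (r1 x == x).
Proof.
move=> hx.
have [/existsP [k /eqP E]|] := boolP [exists k : 'I_l.+1, x == p k].
  have hk : k <= l := ltn_ord k.
  rewrite E (sl_r1p sl hk) eq_sym [RHS]eq_sym (negPf (sl_pq sl hk hk)).
  have [hk'|->] : k < l \/ k = l :> nat by lia.
    by rewrite (sl_r2p sl hk') (negPf (sl_pq sl hk hk')).
  by rewrite (sl_r2pl sl) (negPf (sl_pq sl _ _)).
rewrite negb_exists => /forallP hp.
have [/existsP [k /eqP E]|] := boolP [exists k : 'I_l.+1, x == q k].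
  have hk : k <= l := ltn_ord k.
  rewrite E (r1q hk) (negPf (sl_pq sl hk hk)).
  case: k E hk => [[|k] hk0] /= E hk; first by rewrite r2q0 (negPf (sl_pq sl _ _)).
  by rewrite (r2q hk) (negPf (sl_pq sl _ _)) // ltnW.
rewrite negb_exists => /forallP hq.
rewrite (sl_rE sl hx) // => k hk; first exact: (hp (Ordinal (hk : k < l.+1))).
exact: (hq (Ordinal (hk : k < l.+1))).
Qed.

Lemma slid_dart x : @is_dart m2 x = @is_dart m1 x.
Proof.
rewrite /is_dart /= (sl_D2 sl) !inE; have [->|hx] := eqVneq x c0.
  by rewrite (sl_r1c0 sl) eqxx andbF.
by rewrite slid_rev_fix.
Qed.

Let n1q_iter n : iter n n1 (q 0) = q 0 \/ iter n n1 (q 0) = c0.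
Proof.
elim: n => [|n [ih|ih]]; first by left.
  by right; rewrite iterS ih (sl_n1q sl).
by left; rewrite iterS ih (sl_n1c0 sl).
Qed.

Lemma slid_face_q0 x : fconnect n1 (q 0) x = (x == q 0) || (x == c0).
Proof.
apply/idP/orP => [/fconnect_iter_ex [n ->]|[]/eqP ->].
- by case: (n1q_iter n) => ->; rewrite eqxx; [left|right].
- exact: connect0.
- by rewrite -(sl_n1q sl); apply: fconnect1.
Qed.

Lemma slid_euler : vertices1 (dom M1) (@rev M1) (@nxt M1) (@lab M1) l (markp l p)
    (fun k => Some (q k)) ->
  vertices2 (dom M2) (@rev M2) (@nxt M2) (@lab M2) l (markp l p)
    (fun k => Some (q k)) ->
  fcard (@cw M2) (mem (dom M2)) = (fcard (@cw M1) (mem (dom M1))).+1 /\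
  fcard (@nxt M1) (mem (dom M1)) = (fcard (@nxt M2) (mem (dom M2))).+1.
Proof.
move=> v1 v2; split; first exact: (slid_vertex_count sm v1 v2).
apply: (slid_face_count sm); rewrite mc.
(* The corner follows [s], so it can share the contour of [q 0] only if [s] does; but that contour
   consists of [q 0] and [c0]. *)
apply/negP => h.
have h' : fconnect (@nxt M1) (Some (n1 s)) (Some (q 0)).
  apply: connect_trans h; rewrite (fconnect_sym (sm_n1 sm)).
  by apply: connect1; rewrite /=.
have gS x : @nxt M1 (Some x) = if x == s then None else Some (n1 x) by [].
have := h'; rewrite (insert_connect gS) //.
rewrite (fconnect_sym (sl_n1 sl)) slid_face_q0 => /orP [/eqP E|/eqP E].
  have /(sl_n1 sl) E' : n1 s = n1 c0 by rewrite E (sl_n1c0 sl).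
  by have := sl_sc0 sl; rewrite E' eqxx.
have /(sl_n1 sl) E' : n1 s = n1 (q 0) by rewrite E (sl_n1q sl).
by have := sl_sq sl; rewrite E' eqxx.
Qed.

Lemma slid_tame1 : [/\ involutive (@rev m1), injective (@nxt m1) &
  forall x : elt m1, x \notin dom m1 -> rev x = x /\ nxt x = x].
Proof. split; [exact: (sl_r1K sl)|exact: (sl_n1 sl)|exact: (sl_out sl)]. Qed.

Lemma slid_tame2 : [/\ involutive (@rev m2), injective (@nxt m2) &
  forall x : elt m2, x \notin dom m2 -> rev x = x /\ nxt x = x].
Proof.
split; [exact: (sl_r2K sl)|exact: (sl_n2 sl)|] => x.
rewrite /= (sl_D2 sl) !inE negb_and negbK => hx.
have [->|hx0] := eqVneq x c0; first by rewrite (sl_r2c0 sl) (sl_n2c0 sl).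
rewrite (negPf hx0) /= in hx; have [h1 h2] := sl_out sl hx.
split; first by apply/eqP; rewrite (slid_rev_fix hx0) h1.
rewrite (sl_nE sl) //; apply: contraNneq hx => ->; first exact: (sl_Dq sl).
exact: (sl_Ds sl).
Qed.

(** Marking a corner changes neither the number of vertices nor that of faces, so the counts
    obtained for the marked maps yield Euler's relation for the unmarked ones, which have the same
    half-edges. *)
Lemma slid_right : plane_map m1 -> right_geo ->
  [/\ plane_map m2, @directed_toward m2 (q 0) (p 0) & left_geo].
Proof.
move=> h1; have so1 := plane_sound h1; case: h1 => h1 h2 h3 h4 h5 h6 geo.
have soM1 : sound M1 by apply: add_corner_sound => //; apply: (sl_Ds sl).
have geo' : @steered M1 (@ccw M1) (markp l p l.+1) (Some c0)
    (mkseq (fun k => markp l p k.+1) l) by rewrite mc.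
have [e1 e2] := slid_euler (right_vertices1 sm soM1 geo') (right_vertices2 (@lab M2) sm soM1 geo').
have soM2 : sound M2 := right_sound2 (@lab M2) sm soM1 geo'.
have [t1 t2 t3] := slid_tame2.
have s2 : s \in D2 by rewrite (sl_D2 sl) !inE (sl_sc0 sl) (sl_Ds sl).
have so2 : sound m2 := sound_remove_corner t1 t2 t3 s2 soM2.
split.
- split=> //.
  + move=> x; rewrite /= (sl_D2 sl) !inE => /andP [hx hx'].
    by rewrite (slid_rev_fix hx); apply: h4.
  + exact: (sound_conn so2).
  + have -> : [set x : elt m2 | is_dart x] = [set x : elt m1 | is_dart x].
      by apply/setP => x; rewrite !inE slid_dart.
    rewrite -h6 -(add_corner_fcard_nxt so1 (sl_Ds sl) None).
    rewrite -(add_corner_fcard_cw so1 (sl_Ds sl) None).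
    rewrite -(add_corner_fcard_nxt so2 s2 None) -(add_corner_fcard_cw so2 s2 None).
    by rewrite e1 e2 addSnnS.
- have := right_directed (@lab M2) sm soM1 geo'; rewrite m0.
  by rewrite (add_corner_directed so2 s2) // /= (sl_D2 sl) !inE
    ?(sl_qc0 sl) ?(sl_pc0 sl) ?(sl_Dp sl) ?(sl_Dq sl).
- have := right_leftmost (@lab M2) sm soM1 geo'; rewrite m0 mc /left_geo.
  by congr steered; apply: eq_mkseq => -[].
Qed.

(** The restored corner [c0] is fixed by the reversal, so [plane_map] requires it to bear a label:
    this is the role of [b c0]. *)
Lemma slid_left : plane_map m2 -> b c0 -> left_geo ->
  plane_map m1 /\ right_geo.
Proof.
move=> h1 hb; have so2 := plane_sound h1; case: h1 => h1 h2 h3 h4 h5 h6 geo.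
have s2 : s \in D2 by rewrite (sl_D2 sl) !inE (sl_sc0 sl) (sl_Ds sl).
have soM2 : sound M2 by apply: add_corner_sound.
have geo' : @steered M2 (@cw M2) (markp l p 0) (markp l p l.+1)
    (mkseq (fun k => if k is k'.+1 then Some (q (l - k')) else Some (q 0)) l.+1).
  rewrite mc; move: geo; rewrite /left_geo; congr steered.
  by apply: eq_mkseq => -[].
have [e1 e2] := slid_euler (left_vertices1 (@lab M1) sm soM2 geo') (left_vertices2 sm soM2 geo').
have soM1 : sound M1 := left_sound1 (@lab M1) sm soM2 geo'.
have [t1 t2 t3] := slid_tame1.
have so1 : sound m1 := sound_remove_corner t1 t2 t3 (sl_Ds sl) soM1.
split.
- split=> //.
  + move=> x hx; have [->|hx0] := eqVneq x c0.
      by rewrite /= (sl_r1c0 sl) eqxx hb.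
    by rewrite /= -(slid_rev_fix hx0); apply: h4; rewrite /= (sl_D2 sl) !inE hx0.
  + exact: (sound_conn so1).
  + have -> : [set x : elt m1 | is_dart x] = [set x : elt m2 | is_dart x].
      by apply/setP => x; rewrite !inE slid_dart.
    rewrite -h6 -(add_corner_fcard_nxt so1 (sl_Ds sl) None).
    rewrite -(add_corner_fcard_cw so1 (sl_Ds sl) None).
    rewrite -(add_corner_fcard_nxt so2 s2 None) -(add_corner_fcard_cw so2 s2 None).
    by rewrite e1 e2 addSnnS.
- have := left_rightmost (@lab M1) sm soM2 geo'; by rewrite mc.
Qed.

(* In the slid map, [q 0] follows [s] in the contour of f_1. *)
Let pi x := if x == q 0 then s else x.

Lemma slid_same_face x y : x != c0 -> y != c0 ->
  @same_face m2 x y = fconnect n1 (pi x) (pi y).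
Proof.
move=> hx hy; have n1c0 z : (n1 z == c0) = (z == q 0).
  by rewrite -{1}(sl_n1q sl) (inj_eq (sl_n1 sl)).
have n1q0 z : (n1 z == q 0) = (z == c0).
  by rewrite -{1}(sl_n1c0 sl) (inj_eq (sl_n1 sl)).
have pi0 z : z != c0 -> (pi z != c0) && (pi z != q 0).
  rewrite /pi; case: (eqVneq z (q 0)) => [_ _|hq hz].
    by rewrite (sl_sc0 sl) (sl_sq sl).
  by rewrite hz.
have step z : z != c0 -> n2 z != c0 /\ fconnect n1 (pi z) (pi (n2 z)).
  move=> hz; have [->|hq] := eqVneq z (q 0).
    rewrite (sl_n2q sl) n1c0 (sl_sq sl) /pi eqxx n1q0 (negPf (sl_sc0 sl)).
    by split=> //; apply: fconnect1.
  have [->|hs] := eqVneq z s.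
    rewrite (sl_n2s sl) (sl_qc0 sl) // /pi eqxx (negPf (sl_sq sl)).
    by split=> //; apply: connect0.
  rewrite (sl_nE sl hz hq hs) n1c0 /pi n1q0 (negPf hq) (negPf hz).
  by split=> //; apply: fconnect1.
have back z : z != c0 -> z != q 0 -> fconnect n2 z (n1 z).
  move=> hz hq; have [->|hs] := eqVneq z s; last first.
    by rewrite -(sl_nE sl hz hq hs); apply: fconnect1.
  apply: (connect_trans (y := q 0)); apply: connect1; rewrite /= ?(sl_n2s sl) //.
  by rewrite (sl_n2q sl).
have topi z : fconnect n2 (pi z) z.
  rewrite /pi; case: eqP => [->|_]; last exact: connect0.
  by apply: connect1; rewrite /= (sl_n2s sl).
have sym2 := fconnect_sym (sl_n2 sl).
apply/idP/idP => [/fconnect_iter_ex [n ->]|].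
  suff [] : iter n n2 x != c0 /\ fconnect n1 (pi x) (pi (iter n n2 x)) by [].
  elim: n => [|n [ih1 ih2]]; first by split=> //; apply: connect0.
  have [h1 h2] := step _ ih1; split=> //; exact: connect_trans ih2 h2.
case/fconnect_iter_ex=> n E.
apply: connect_trans (topi y); rewrite E {E hy}.
rewrite /same_face sym2; apply: connect_trans (topi x); rewrite sym2.
have /andP := pi0 x hx; move: (pi x) => {hx}x hx.
suff [_ _] : [/\ iter n n1 x != c0, iter n n1 x != q 0 & fconnect n2 x (iter n n1 x)].
  by [].
elim: n => [|n [ih1 ih2 ih3]]; first by case: hx; split=> //; apply: connect0.
split; rewrite iterS ?n1c0 ?n1q0 //; exact: connect_trans ih3 (back _ ih1 ih2).
Qed.

Variable r : nat.
Hypotheses (bc0 : b c0 = Some r) (hr : forall y, y \in D1 -> b y = Some r -> y = c0)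
  (bq0 : b (q 0) = None).

Lemma slid_mark_iff i y : i != r -> @is_mark m2 i y = @is_mark m1 i y.
Proof.
move=> hi; rewrite /is_mark /= (sl_D2 sl) !inE.
have [->|//] := eqVneq y c0; rewrite bc0 (sl_Dc0 sl) /=.
by apply/esym/negP => /eqP [] E; rewrite E eqxx in hi.
Qed.

Lemma slid_markr y : @is_mark m2 r y = false.
Proof.
apply/negP => /andP [] /=; rewrite (sl_D2 sl) !inE => /andP [h1 h2] /eqP /hr h3.
by rewrite h3 ?eqxx in h1.
Qed.

Lemma slid_in_face i x : x != c0 -> i != r ->
  @in_face m2 i x = @in_face m1 i (pi x).
Proof.
move=> hx hi; rewrite /in_face.
have -> : (x \in dom m2) = (pi x \in dom m1).
  rewrite /= (sl_D2 sl) !inE hx /= /pi; case: eqP => // ->.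
  by rewrite (sl_Dq sl) // (sl_Ds sl).
congr (_ && _); apply: eq_existsb => y; rewrite slid_mark_iff //.
case hm: (@is_mark m1 i y) => //=; have [hy /eqP hb] := andP (idP hm).
have y0 : y != c0.
  apply: contraNneq hi => E; move: hb; rewrite E /= bc0 => -[->]; exact: eqxx.
have yq : y != q 0 by apply: contraTneq isT => E; move: hb; rewrite E /= bq0.
by rewrite slid_same_face // {2}/pi (negPf yq).
Qed.

Lemma slid_in_facer x : @in_face m1 r x = (x == q 0) || (x == c0).
Proof.
rewrite -slid_face_q0; apply/andP/idP => [[hx /existsP [y /andP [/andP [hy /eqP /hr]]]]|h].
  move=> /(_ hy) -> h; apply: connect_trans (fconnect1 _ _) _.
  by rewrite (sl_n1q sl) (fconnect_sym (sl_n1 sl)).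
have hxD : x \in D1.
  by move: h; rewrite slid_face_q0 => /orP [] /eqP ->; [apply: (sl_Dq sl)|apply: (sl_Dc0 sl)].
split=> //; apply/existsP; exists c0.
rewrite /is_mark /= (sl_Dc0 sl) bc0 eqxx /= /same_face (fconnect_sym (sl_n1 sl)).
by rewrite -(sl_n1q sl) -(same_fconnect1 (sl_n1 sl)).
Qed.

Lemma slid_in_facer2 x : @in_face m2 r x = false.
Proof. by apply/negP => /andP [_ /existsP [y]]; rewrite slid_markr. Qed.

Variable a : seq nat.
Hypotheses (hr0 : 0 < r) (ha : size a = r).

Let size1 : size (rcons a 1) = r.+1. Proof. by rewrite size_rcons ha. Qed.
Let size2 : size (incr_nth a 0) = r. Proof. by rewrite size_incr_nth ha hr0. Qed.
Let nth1 i : i < r -> nth 0 (rcons a 1) i = nth 0 a i.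
Proof. by move=> hi; rewrite nth_rcons ha hi. Qed.
Let nth1r : nth 0 (rcons a 1) r = 1.
Proof. by rewrite nth_rcons ha ltnn eqxx. Qed.
Let lt_neq i : i < r -> i != r. Proof. by lia. Qed.

Lemma slid_in_face_q0 i x : (x == q 0) || (x == c0) -> @in_face m1 i x = (i == r).
Proof.
move=> hx; have [->|hi] := eqVneq i r; first by rewrite slid_in_facer hx.
apply/negP => /andP [_ /existsP [y /andP [/andP [hy /eqP hb] h]]].
have h' : fconnect n1 (q 0) x by rewrite slid_face_q0.
have := connect_trans h' h; rewrite slid_face_q0 => /orP [] /eqP E.
  by move: hb; rewrite E /= bq0.
by move: hb; rewrite E /= bc0 => -[E2]; rewrite E2 eqxx in hi.
Qed.

(** [q 0] is the only half-edge that changes faces: it leaves the face of degree 1 and joins that of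
    [s]. *)
Lemma slid_face_card i : i != r ->
  #|[set x : elt m2 | is_dart x && in_face i x]| =
  @in_face m1 i s + #|[set x : elt m1 | is_dart x && in_face i x]|.
Proof.
move=> hi; have q0d : @is_dart m1 (q 0).
  by rewrite /is_dart /= (sl_Dq sl) // r1q // (sl_pq sl).
have q0f : @in_face m1 i (q 0) = false.
  by rewrite slid_in_face_q0 ?eqxx // (negPf hi).
have hset x : x != q 0 -> @is_dart m2 x && @in_face m2 i x =
    @is_dart m1 x && @in_face m1 i x.
  move=> hx; rewrite slid_dart; have [->|hx0] := eqVneq x c0.
    by rewrite /is_dart /= (sl_r1c0 sl) eqxx andbF.
  by rewrite (slid_in_face hx0 hi) /pi (negPf hx).
have q0c : q 0 != c0 by apply: (sl_qc0 sl).
case hs: (@in_face m1 i s).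
  rewrite -[RHS](_ : #|q 0 |: [set x : elt m1 | is_dart x && in_face i x]| = _).
    apply: eq_card => x; rewrite !inE; case: (eqVneq x (q 0)) => [->|/hset //].
    by rewrite slid_dart q0d (slid_in_face q0c hi) /pi eqxx hs.
  by rewrite cardsU1 inE q0f andbF.
apply: eq_card => x; rewrite !inE; case: (eqVneq x (q 0)) => [->|/hset //].
by rewrite (slid_in_face q0c hi) q0f /pi eqxx hs !andbF.
Qed.

Lemma slid_type_right : map_of_type (rcons a 1) m1 -> @in_face m1 0 s ->
  plane_map m2 -> map_of_type (incr_nth a 0) m2 /\ @in_face m2 0 (q 0).
Proof.
case=> _ t2 t3 t4 t5 hs pm; rewrite size1 in t2 t3 t5.
have q0c : q 0 != c0 by apply: (sl_qc0 sl).
split; last by rewrite (slid_in_face q0c (lt_neq hr0)) /pi eqxx.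
have hpi x : x \in D2 -> x != c0 /\ pi x \in D1.
  rewrite (sl_D2 sl) !inE => /andP [hx hx']; split=> //.
  by rewrite /pi; case: eqP => // _; apply: (sl_Ds sl).
have pir x : x != c0 -> @in_face m1 r (pi x) = false.
  move=> hx; rewrite slid_in_facer /pi; case: (eqVneq x (q 0)) => [_|hq].
    by rewrite (negPf (sl_sq sl)) (negPf (sl_sc0 sl)).
  by rewrite (negPf hq) (negPf hx).
split; rewrite ?size2 //.
- move=> x i; have [->|hi] := eqVneq i r; first by rewrite slid_markr.
  rewrite slid_mark_iff // => /t2; lia.
- move=> i hi; have [x [h1 h2]] := t3 i (ltnW hi); exists x.
  split; first by rewrite slid_mark_iff ?lt_neq.
  by move=> x'; rewrite slid_mark_iff ?lt_neq //; apply: h2.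
- move=> x /hpi [hx hx']; have [i [h1 h2]] := t4 _ hx'.
  have hi : i != r by apply: contraTneq h1 => ->; rewrite pir.
  exists i; split; first by rewrite slid_in_face.
  move=> j; have [->|hj] := eqVneq j r; first by rewrite slid_in_facer2.
  by rewrite slid_in_face //; apply: h2.
- move=> i hi; rewrite (slid_face_card (lt_neq hi)) (t5 i (ltnW hi)) nth1 //.
  rewrite nth_incr_nth; congr (nat_of_bool _ + _).
  have [j [_ h2]] := t4 s (sl_Ds sl); apply/idP/eqP => [h|<- //].
  by rewrite -(h2 _ h) -(h2 _ hs).
Qed.

Lemma slid_type_left : map_of_type (incr_nth a 0) m2 -> @in_face m2 0 (q 0) ->
  plane_map m1 -> map_of_type (rcons a 1) m1 /\ @in_face m1 0 s.
Proof.
case=> _ t2 t3 t4 t5 hq pm; rewrite size2 in t2 t3 t5.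
have q0c : q 0 != c0 by apply: (sl_qc0 sl).
have hs i : i != r -> @in_face m1 i s = @in_face m2 i (q 0).
  by move=> hi; rewrite (slid_in_face q0c hi) /pi eqxx.
split; last by rewrite hs // lt_neq.
split; rewrite ?size1 //.
- move=> x i; have [-> //|hi] := eqVneq i r.
  rewrite -slid_mark_iff // => /t2; lia.
- move=> i hi; have [->|hi'] := eqVneq i r.
    exists c0; split; first by rewrite /is_mark /= (sl_Dc0 sl) bc0 eqxx.
    by move=> x /andP [hx /eqP /(hr hx)].
  have hi2 : i < r by lia.
  have [x [h1 h2]] := t3 i hi2; exists x; split; first by rewrite -slid_mark_iff.
  by move=> x'; rewrite -slid_mark_iff //; apply: h2.
- move=> x hx; have [hx0|] := boolP ((x == q 0) || (x == c0)).
    exists r; split; first by rewrite slid_in_face_q0.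
    by move=> j; rewrite slid_in_face_q0 // => /eqP.
  rewrite negb_or => /andP [hxq hx0].
  have hx2 : x \in D2 by rewrite (sl_D2 sl) !inE hx0.
  have [i [h1 h2]] := t4 _ hx2.
  have hpi j : j != r -> @in_face m2 j x = @in_face m1 j x.
    by move=> hj; rewrite (slid_in_face hx0 hj) /pi (negPf hxq).
  have hi : i != r by apply: contraTneq h1 => ->; rewrite slid_in_facer2.
  exists i; split; first by rewrite -hpi.
  move=> j; have [->|hj] := eqVneq j r.
    by rewrite slid_in_facer (negPf hxq) (negPf hx0).
  by rewrite -hpi //; apply: h2.
- move=> i hi; have [->|hi'] := eqVneq i r.
    rewrite nth1r; apply/eqP/cards1P; exists (q 0); apply/setP => x; rewrite !inE.
    rewrite slid_in_facer; have [->|hxq] := eqVneq x (q 0).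
      by rewrite /is_dart /= (sl_Dq sl) // r1q // (sl_pq sl).
    by case: eqP => [->|_]; rewrite ?andbF // /is_dart /= (sl_r1c0 sl) eqxx andbF.
  have hi2 : i < r by lia.
  have := t5 i hi2; rewrite slid_face_card // nth_incr_nth nth1 // hs //.
  have hq0 : q 0 \in D2 by rewrite (sl_D2 sl) !inE q0c (sl_Dq sl).
  have [j [_ h2]] := t4 (q 0) hq0.
  suff -> : @in_face m2 i (q 0) = (0 == i) by move/addnI.
  by apply/idP/eqP => [h|<- //]; rewrite -(h2 _ h) -(h2 _ hq).
Qed.

End SlidTransfer.

(** * Isomorphisms *)

(** An isomorphism constrains nothing outside [dom], so this has to be known of its target before
    the properties of the source can be transported. *)
Definition inert (m : pmap) : Prop :=
  forall x : elt m, x \notin dom m -> rev x = x /\ nxt x = x.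

Section Iso.
Variables (m m' : pmap) (f : elt m -> elt m').
Hypotheses (hm : sound m) (hf : map_iso f) (ho : inert m').

Lemma iso_inj : {in dom m &, injective f}. Proof. by case: hf. Qed.
Lemma iso_dom x : x \in dom m -> f x \in dom m'.
Proof. by case: hf => _ <- _ _ _ h; apply: imset_f. Qed.
Lemma iso_ex y : y \in dom m' -> exists2 x, x \in dom m & y = f x.
Proof. by case: hf => _ <- _ _ _ /imsetP [x h ->]; exists x. Qed.
Lemma iso_rev x : x \in dom m -> f (rev x) = rev (f x).
Proof. by case: hf => _ _ h _ _; apply: h. Qed.
Lemma iso_nxt x : x \in dom m -> f (nxt x) = nxt (f x).
Proof. by case: hf => _ _ _ h _; apply: h. Qed.
Lemma iso_lab x : x \in dom m -> lab (f x) = lab x.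
Proof. by case: hf => _ _ _ _ h; apply: h. Qed.
Lemma iso_cw x : x \in dom m -> f (cw x) = cw (f x).
Proof. by move=> h; rewrite /cw iso_nxt ?rev_dom // iso_rev. Qed.

Lemma iso_sound : sound m'.
Proof.
have nd x : x \in dom m -> nxt (f x) \in dom m'.
  by move=> h; rewrite -iso_nxt // iso_dom // nxt_dom.
split=> //.
- move=> y; have [/iso_ex [x hx ->]|/ho [h _]] := boolP (y \in dom m'); last by rewrite !h.
  by rewrite -!iso_rev ?rev_dom // (revK hm).
- move=> y z; have [/iso_ex [x hx ->]|hy] := boolP (y \in dom m').
    have [/iso_ex [w hw ->]|hz] := boolP (z \in dom m').
      rewrite -!iso_nxt // => /iso_inj; rewrite !nxt_dom // => /(_ hx hw).
      by move/(nxt_inj hm) ->.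
    by move=> E; have := nd x hx; rewrite E (proj2 (ho hz)) (negPf hz).
  have [/iso_ex [w hw ->]|hz] := boolP (z \in dom m').
    by move=> E; have := nd w hw; rewrite -E (proj2 (ho hy)) (negPf hy).
  by rewrite (proj2 (ho hy)) (proj2 (ho hz)).
- move=> _ _ /iso_ex [x hx ->] /iso_ex [y hy ->].
  have /connectP [s] := sound_conn hm hx hy.
  elim: s x hx => [|z s ih] x hx /=; first by move=> _ ->; apply: connect0.
  case/andP=> h1 h2 h3; have hz : z \in dom m.
    by case/orP: h1 => /eqP ->; rewrite ?rev_dom ?nxt_dom.
  apply: connect_trans (ih z hz h2 h3); apply: connect1.
  by case/orP: h1 => /eqP ->; rewrite /= ?iso_rev ?iso_nxt // eqxx ?orbT.
Qed.
Let hm' := iso_sound.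

Section Orbits.
Variables (g : elt m -> elt m) (g' : elt m' -> elt m').
Hypotheses (gd : forall x, x \in dom m -> g x \in dom m)
  (gf : forall x, x \in dom m -> f (g x) = g' (f x)).

Lemma iso_iter_dom n x : x \in dom m -> iter n g x \in dom m.
Proof. by move=> hx; elim: n => //= n; apply: gd. Qed.

Lemma iso_iter n x : x \in dom m -> f (iter n g x) = iter n g' (f x).
Proof. by move=> hx; elim: n => //= n <-; apply: gf; apply: iso_iter_dom. Qed.

Lemma iso_connect x y : x \in dom m -> y \in dom m ->
  fconnect g' (f x) (f y) = fconnect g x y.
Proof.
move=> hx hy; apply/idP/idP => /fconnect_iter_ex [n E].
  move: E; rewrite -iso_iter // => /iso_inj -> //; first exact: fconnect_iter.
  exact: iso_iter_dom.
by rewrite E iso_iter // fconnect_iter.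
Qed.

Lemma iso_fcard : injective g -> injective g' ->
  (forall x, (g' x \in dom m') = (x \in dom m')) ->
  (forall x, (g x \in dom m) = (x \in dom m)) ->
  fcard g' (mem (dom m')) = fcard g (mem (dom m)).
Proof.
move=> gi gi' gd' gd2; pose R := enum (predI (froots g) (mem (dom m))).
have hR x : x \in R -> froots g x /\ x \in dom m.
  by rewrite mem_enum => /andP [].
have Rinj : {in R &, injective f}.
  by move=> x y /hR [_ hx] /hR [_ hy]; apply: iso_inj.
(* [fcard_reps] is applied with [K] everything and an empty set on the other side: it then counts
   the cycles of [g'] by the images of the roots of [g]. *)
have K0 : fcard (@id (elt m')) pred0 = 0 by apply: eq_card0 => x; rewrite !inE andbF.
have := @fcard_reps (elt m') g' id (mem (dom m')) pred0 predT (map f R) [::].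
rewrite K0 size_map addn0 /= add0n => -> //.
- by rewrite /R -cardE.
- by rewrite map_inj_in_uniq // enum_uniq.
- exact: all_predT.
- by apply/allP => _ /mapP [x /hR [_ hx] ->]; apply: iso_dom.
- move=> _ _ /mapP [x hxR ->] /mapP [y hyR ->].
  have [hx hxd] := hR x hxR; have [hy hyd] := hR y hyR.
  rewrite iso_connect // -(root_connect (fconnect_sym gi)) => /eqP.
  by rewrite (eqP hx) (eqP hy) => ->.
- move=> z hz _; have [x hx ->] := iso_ex hz; exists (f (froot g x)).
    apply: map_f; rewrite mem_enum inE roots_root; last exact: fconnect_sym.
    have := connect_root (frel g) x => /fconnect_iter_ex [n ->].
    by rewrite inE iso_iter_dom.
  rewrite iso_connect ?connect_root //.
  by have := connect_root (frel g) x => /fconnect_iter_ex [n ->]; apply: iso_iter_dom.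
Qed.

End Orbits.

Lemma iso_vertex x y : x \in dom m -> y \in dom m ->
  same_vertex (f x) (f y) = same_vertex x y.
Proof.
by apply: iso_connect => z hz; rewrite ?cw_dom // iso_cw.
Qed.

Lemma iso_face x y : x \in dom m -> y \in dom m ->
  same_face (f x) (f y) = same_face x y.
Proof.
by apply: iso_connect => z hz; rewrite ?nxt_dom // iso_nxt.
Qed.

Lemma iso_dart x : x \in dom m -> is_dart (f x) = is_dart x.
Proof.
move=> hx; rewrite /is_dart hx iso_dom // -iso_rev //.
by rewrite (inj_in_eq iso_inj) ?rev_dom.
Qed.

Lemma iso_mark i x : x \in dom m -> is_mark i (f x) = is_mark i x.
Proof. by move=> hx; rewrite /is_mark hx iso_dom // iso_lab. Qed.

Lemma iso_in_face i x : x \in dom m -> in_face i (f x) = in_face i x.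
Proof.
move=> hx; rewrite /in_face hx iso_dom //=; apply/existsP/existsP => -[y].
  case/andP=> hy; have [z hz E] := iso_ex (proj1 (andP hy)); rewrite E in hy *.
  by rewrite iso_face // => h; exists z; rewrite -iso_mark // hy.
case/andP=> hy; have hyd := proj1 (andP hy).
by move=> h; exists (f y); rewrite iso_mark // hy iso_face.
Qed.

Lemma iso_card (P : pred (elt m)) (P' : pred (elt m')) :
  (forall x, x \in dom m -> P' (f x) = P x) ->
  (forall x, P x -> x \in dom m) -> (forall x, P' x -> x \in dom m') ->
  #|[set x | P' x]| = #|[set x | P x]|.
Proof.
move=> h1 h2 h3; have <- : f @: [set x | P x] = [set x | P' x].
  apply/setP => y; rewrite inE; apply/imsetP/idP => [[x]|hy].
    by rewrite inE => hx ->; rewrite h1 // h2.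
  have [x hx E] := iso_ex (h3 _ hy); exists x => //.
  by rewrite inE -h1 // -E.
apply: card_in_imset => x y; rewrite !inE => /h2 hx /h2 hy; exact: iso_inj.
Qed.

Lemma iso_plane : plane_map m -> plane_map m'.
Proof.
case=> _ _ _ h4 h5 h6; split.
- exact: (revK hm').
- exact: (nxt_inj hm').
- exact: ho.
- move=> y /iso_ex [x hx ->]; rewrite iso_lab // -h4 // -iso_rev //.
  by rewrite (inj_in_eq iso_inj) ?rev_dom.
- exact: (sound_conn hm').
- rewrite (iso_fcard (g := @cw m)); first last.
  + exact: (cw_dom hm).
  + exact: (cw_dom hm').
  + exact: (cw_inj hm').
  + exact: (cw_inj hm).
  + exact: iso_cw.
  + by move=> x; rewrite cw_dom.
  rewrite (iso_fcard (g := @nxt m)); first last.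
  + exact: (nxt_dom hm).
  + exact: (nxt_dom hm').
  + exact: (nxt_inj hm').
  + exact: (nxt_inj hm).
  + exact: iso_nxt.
  + by move=> x; rewrite nxt_dom.
  rewrite h6; congr (_./2 + _); apply/esym/iso_card => x; last 2 first.
  + by case/andP.
  + by case/andP.
  + exact: iso_dart.
Qed.

Lemma iso_type a : map_of_type a m -> map_of_type a m'.
Proof.
case=> /iso_plane h1 h2 h3 h4 h5; split=> //.
- by move=> y i hy; have [x hx E] := iso_ex (proj1 (andP hy)); apply: (h2 x);
    rewrite -iso_mark // -E.
- move=> i /h3 [x [hx hu]]; have hxd := proj1 (andP hx).
  exists (f x); split; first by rewrite iso_mark.
  move=> y hy; have [z hz E] := iso_ex (proj1 (andP hy)).
  by rewrite E (hu z) // -iso_mark // -E.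
- move=> y /iso_ex [x hx ->]; have [i [h6 h7]] := h4 x hx.
  exists i; split; first by rewrite iso_in_face.
  by move=> j; rewrite iso_in_face //; apply: h7.
- move=> i /h5 <-; apply: iso_card => x.
  + by move=> hx; rewrite iso_dart // iso_in_face.
  + by case/andP => /andP [].
  + by case/andP => /andP [].
Qed.

Lemma iso_walk x p y : x \in dom m -> y \in dom m ->
  walk x p y -> walk (f x) (map f p) (f y).
Proof.
move=> + hy; elim: p x => [|e p ih] x hx /=; first by rewrite iso_vertex.
case/and3P=> h1 h2 h3; have he := dart_dom h1.
by rewrite iso_dart // h1 iso_vertex // h2 -iso_rev // ih // rev_dom.
Qed.

Lemma iso_walk_ex x p y : x \in dom m -> y \in dom m -> walk (f x) p (f y) ->
  exists2 p', p = map f p' & walk x p' y.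
Proof.
move=> + hy; elim: p x => [|e p ih] x hx /=; first by rewrite iso_vertex // => h; exists [::].
case/and3P=> h1; have [z hz E] := iso_ex (dart_dom h1); rewrite E in h1 *.
rewrite iso_vertex // -iso_rev // => h2 /ih [|p' -> h3]; first by rewrite rev_dom.
by exists (z :: p') => //=; rewrite -iso_dart // h1 h2.
Qed.

Lemma iso_dist x y : x \in dom m -> y \in dom m -> dist (f x) (f y) = dist x y.
Proof.
move=> hx hy; apply/eqP; rewrite eqn_leq; apply/andP; split.
  have [p hp <-] := dist_walk hm hx hy; rewrite -(size_map f p).
  by apply: dist_le; apply: iso_walk.
have [p hp <-] := dist_walk hm' (iso_dom hx) (iso_dom hy).
have [p' -> hp'] := iso_walk_ex hx hy hp.
by rewrite size_map; apply: dist_le.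
Qed.

Lemma iso_directed x y : x \in dom m -> y \in dom m ->
  directed_toward (f x) (f y) = directed_toward x y.
Proof.
by move=> hx hy; rewrite /directed_toward -iso_rev // !iso_dist ?rev_dom.
Qed.

Lemma iso_ccw x : x \in dom m -> f (ccw x) = ccw (f x).
Proof.
move=> hx; apply: (cw_inj hm'); rewrite (ccwK hm') -iso_cw ?(ccwK hm) //.
by rewrite -(cw_dom hm) (ccwK hm).
Qed.

Lemma iso_steered (g : elt m -> elt m) (g' : elt m' -> elt m') y h p :
  (forall x, x \in dom m -> g x \in dom m) ->
  (forall x, x \in dom m -> f (g x) = g' (f x)) ->
  y \in dom m -> h \in dom m ->
  steered g y h p -> steered g' (f y) (f h) (map f p).
Proof.
move=> gd gf hy; elim: p h => [|e p ih] h hh /=.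
  by rewrite -iso_rev // iso_vertex // rev_dom.
have hr : rev h \in dom m by rewrite rev_dom.
case=> -[n [E h1 h2]] h3.
have it := iso_iter gd gf; split; last first.
  by apply: ih => //; rewrite E; apply: iso_iter_dom.
exists n; rewrite -iso_rev // -it // -E; split=> //.
  by rewrite iso_directed // E; apply: iso_iter_dom.
by move=> i hi; rewrite -it // iso_directed ?h2 //; apply: iso_iter_dom.
Qed.

Lemma iso_inv (x0 : elt m) : exists f' : elt m' -> elt m,
  [/\ map_iso f', {in dom m, cancel f f'} & {in dom m', cancel f' f}].
Proof.
pose f' y := odflt x0 [pick x in dom m | f x == y].
have fK : {in dom m, cancel f f'}.
  move=> x hx; rewrite /f'; case: pickP => [z /andP [hz /eqP E]|/(_ x)] /=.
    exact: iso_inj.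
  by rewrite hx eqxx.
have f'K : {in dom m', cancel f' f} by move=> y /iso_ex [x hx ->]; rewrite fK.
have f'd y : y \in dom m' -> f' y \in dom m by move=> /iso_ex [x hx ->]; rewrite fK.
exists f'; split=> //; split.
- by move=> y z hy hz E; rewrite -(f'K y) // E f'K.
- apply/setP => x; apply/imsetP/idP => [[y hy ->]|hx]; first exact: f'd.
  by exists (f x); rewrite ?fK // iso_dom.
- by move=> y /iso_ex [x hx ->]; rewrite -iso_rev // !fK ?rev_dom.
- by move=> y /iso_ex [x hx ->]; rewrite -iso_nxt // !fK ?nxt_dom.
- by move=> y /iso_ex [x hx ->]; rewrite fK // iso_lab.
Qed.

Lemma iso_add_corner s o : s \in dom m ->
  @map_iso (add_corner s o) (add_corner (f s) o) (omap f).
Proof.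
move=> hs; split.
- move=> [x|] [y|] //; rewrite !inE => hx hy [] /iso_inj -> //.
- apply/setP => -[y|]; rewrite [RHS]inE /=; last by apply/imsetP; exists None; rewrite ?inE.
  apply/imsetP/idP => [[[x|]]|]; rewrite ?inE //=.
    by move=> hx [->]; apply: iso_dom.
  by case/iso_ex=> x hx ->; exists (Some x); rewrite ?inE.
- by case=> [x|]; rewrite inE //= => hx; rewrite iso_rev.
- case=> [x|]; rewrite inE //= => hx; last by rewrite iso_nxt.
  by rewrite (inj_in_eq iso_inj) //; case: eqP => //= _; rewrite iso_nxt.
- by case=> [x|]; rewrite inE //= => hx; rewrite iso_lab.
Qed.

End Iso.

(** * Isomorphism as an equivalence, and invariance of the two sets of decorated maps *)

Lemma map_iso_id m : @map_iso m m id.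
Proof. by split=> //; rewrite imset_id. Qed.

Lemma map_iso_comp (m m' m'' : pmap) (f : elt m -> elt m') (g : elt m' -> elt m'') :
  sound m -> map_iso f -> map_iso g -> map_iso (g \o f).
Proof.
move=> hm hf hg; have fd := iso_dom hf; split.
- by move=> x y hx hy /= /(iso_inj hg) /(iso_inj hf) -> //; apply: fd.
- have E1 : f @: dom m = dom m' by case: hf.
  by rewrite imset_comp E1; case: hg.
- by move=> x hx /=; rewrite (iso_rev hf) // (iso_rev hg) // fd.
- by move=> x hx /=; rewrite (iso_nxt hf) // (iso_nxt hg) // fd.
- by move=> x hx /=; rewrite (iso_lab hg) ?fd // (iso_lab hf).
Qed.

Lemma cornered_iso_sym X Y : sound (cmap X) -> ccor X \in dom (cmap X) ->
  cornered_iso X Y -> cornered_iso Y X.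
Proof.
move=> hX hc [f hf E]; have [f' [h1 h2 h3]] := iso_inv hX hf (ccor X).
by exists f' => //; rewrite -E h2.
Qed.

Lemma cornered_iso_trans X Y Z : sound (cmap X) ->
  cornered_iso X Y -> cornered_iso Y Z -> cornered_iso X Z.
Proof.
move=> hX [f hf Ef] [g hg Eg]; exists (g \o f); first exact: map_iso_comp.
by rewrite /= Ef Eg.
Qed.

Lemma pointed_iso_sym X Y : sound (vmap X) -> inert (vmap Y) ->
  vver X \in dom (vmap X) -> vhe X \in dom (vmap X) -> vver Y \in dom (vmap Y) ->
  pointed_iso X Y -> pointed_iso Y X.
Proof.
move=> hX hY hv hh hv' [f hf [E1 E2]]; have [f' [h1 h2 h3]] := iso_inv hX hf (vver X).
exists f' => //; split; last by rewrite -E2 h2.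
have hY' := iso_sound hX hf hY.
have f'd := iso_dom h1.
rewrite (same_vertex_sym hX) -(iso_vertex hX hf) ?f'd // h3 //.
Qed.

Lemma pointed_iso_trans X Y Z : sound (vmap X) -> inert (vmap Y) -> inert (vmap Z) ->
  vver X \in dom (vmap X) -> vver Y \in dom (vmap Y) ->
  pointed_iso X Y -> pointed_iso Y Z -> pointed_iso X Z.
Proof.
move=> hX hY hZ hv hv' [f hf [Ef1 Ef2]] [g hg [Eg1 Eg2]].
have sY := iso_sound hX hf hY; have sZ := iso_sound sY hg hZ.
exists (g \o f); first exact: map_iso_comp.
split; last by rewrite /= Ef2 Eg2.
apply: same_vertex_trans Eg1; rewrite /= (iso_vertex sY hg) //.
exact: (iso_dom hf).
Qed.

Lemma calM_iso a X Y : inert (cmap Y) -> cornered_iso X Y -> calM a X -> calM a Y.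
Proof.
move=> hY [f hf E] [h1 h2]; have hX : sound (cmap X) by case: h1 => /plane_sound.
split; first exact: (iso_type hX hf hY).
by rewrite -E (iso_in_face hX hf) //; case/andP: h2.
Qed.

Lemma calMt_iso a X Y : inert (vmap Y) -> vver Y \in dom (vmap Y) ->
  pointed_iso X Y -> calMt a X -> calMt a Y.
Proof.
move=> hY hv [f hf [E1 E2]] [h1 h2 h3 h4 h5].
have hX : sound (vmap X) by case: h1 => /plane_sound.
have sY := iso_sound hX hf hY; have hh := dart_dom h3.
split=> //; first exact: (iso_type hX hf hY).
- by rewrite -E2 (iso_dart hX hf).
- by rewrite -E2 (iso_in_face hX hf).
- have : directed_toward (f (vhe X)) (f (vver X)) by rewrite (iso_directed hX hf).
  by rewrite -E2 /directed_toward !(dist_r sY _ E1).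
Qed.

(** * Slid maps determine each other *)

(** Both descriptions of the path are recorded: the rightmost one lets the original map determine
    the slid one, and the leftmost one gives the converse. *)
Record slid_pair (r : nat) (T : finType) (D1 D2 : {set T}) (r1 n1 r2 n2 : T -> T)
    (b : T -> option nat) (l : nat) (p q : nat -> T) (s c0 : T) : Prop := SlidPair {
  sp_slid : slid D1 D2 r1 n1 r2 n2 l p q s c0;
  sp_sound1 : sound (@PMap T D1 r1 n1 b);
  sp_sound2 : sound (@PMap T D2 r2 n2 b);
  sp_mark : b c0 = Some r;
  sp_markU : forall y, y \in D1 -> b y = Some r -> y = c0;
  sp_right : right_geo D1 r1 n1 b l p s c0;
  sp_left : left_geo D2 r2 n2 b l p q s }.

Lemma mkseq_eq (A : Type) (f g : nat -> A) n n' :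
  mkseq f n = mkseq g n' -> n = n' /\ forall k, k < n -> f k = g k.
Proof.
move=> E; have En : n = n' by rewrite -(size_mkseq f n) E size_mkseq.
split=> // k hk; rewrite -(nth_mkseq (f k) f hk) E nth_mkseq //.
by rewrite -En.
Qed.

(** A pointed isomorphism respects the distinguished vertex but not the element that denotes it. *)
Lemma steered_target (m : pmap) (g : elt m -> elt m) y y' h p : sound m ->
  same_vertex y y' -> steered g y h p -> steered g y' h p.
Proof.
move=> hm hy; elim: p h => [|e p ih] h /=; first by move/same_vertex_trans; apply.
case=> h1 /ih h2; split=> //; apply: first_after_eq h1 => n.
by rewrite /directed_toward !(dist_r hm _ hy).
Qed.

Section Uniqueness.
Variables (r : nat) (T : finType) (D1 D2 : {set T}) (r1 n1 r2 n2 : T -> T).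
Variables (b : T -> option nat) (l : nat) (p q : nat -> T) (s c0 : T).
Variables (T' : finType) (D1' D2' : {set T'}) (r1' n1' r2' n2' : T' -> T').
Variables (b' : T' -> option nat) (l' : nat) (p' q' : nat -> T') (s' c0' : T').
Hypothesis sp : slid_pair r D1 D2 r1 n1 r2 n2 b l p q s c0.
Hypothesis sp' : slid_pair r D1' D2' r1' n1' r2' n2' b' l' p' q' s' c0'.
Let m1 := @PMap T D1 r1 n1 b.
Let m2 := @PMap T D2 r2 n2 b.
Let m1' := @PMap T' D1' r1' n1' b'.
Let m2' := @PMap T' D2' r2' n2' b'.
Let sl := sp_slid sp.
Let sl' := sp_slid sp'.

Let r1q (k : nat) : k <= l -> r1 (q k) = p k.
Proof. by move=> hk; rewrite -(sl_r1p sl hk) (sl_r1K sl). Qed.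
Let r1q' (k : nat) : k <= l' -> r1' (q' k) = p' k.
Proof. by move=> hk; rewrite -(sl_r1p sl' hk) (sl_r1K sl'). Qed.
Let r2q (k : nat) : k < l -> r2 (q k.+1) = p k.
Proof. by move=> hk; rewrite -(sl_r2p sl hk) (sl_r2K sl). Qed.
Let r2q0 : r2 (q 0) = p l.
Proof. by rewrite -(sl_r2pl sl) (sl_r2K sl). Qed.
Let r2q' (k : nat) : k < l' -> r2' (q' k.+1) = p' k.
Proof. by move=> hk; rewrite -(sl_r2p sl' hk) (sl_r2K sl'). Qed.
Let r2q0' : r2' (q' 0) = p' l'.
Proof. by rewrite -(sl_r2pl sl') (sl_r2K sl'). Qed.

Let D2E z : (z \in D2) = (z != c0) && (z \in D1).
Proof. by rewrite (sl_D2 sl) !inE. Qed.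
Let D2E' z : (z \in D2') = (z != c0') && (z \in D1').
Proof. by rewrite (sl_D2 sl') !inE. Qed.

Variant place z : Prop :=
  | PlaceP k of k <= l & z = p k
  | PlaceQ k of k <= l & z = q k
  | PlaceO of (forall k, k <= l -> z != p k) & (forall k, k <= l -> z != q k).

Lemma placeP z : place z.
Proof.
have [/existsP [k /eqP E]|] := boolP [exists k : 'I_l.+1, z == p k].
  exact: (PlaceP (ltn_ord k) E).
rewrite negb_exists => /forallP hp.
have [/existsP [k /eqP E]|] := boolP [exists k : 'I_l.+1, z == q k].
  exact: (PlaceQ (ltn_ord k) E).
rewrite negb_exists => /forallP hq; apply: PlaceO => k hk.
  exact: (hp (Ordinal (hk : k < l.+1))).
exact: (hq (Ordinal (hk : k < l.+1))).
Qed.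

(** All the data of the surgery are intrinsic: [c0] is the only element labelled [r], [q 0] is its
    successor, and the path is the unique rightmost geodesic. So [f] respects them and is itself an
    isomorphism of the slid maps. *)
Lemma slid_unique_right (f : T -> T') : @map_iso m1 m1' f -> f s = s' ->
  pointed_iso (@Pointed m2 (p 0) (q 0)) (@Pointed m2' (p' 0) (q' 0)).
Proof.
move=> hf fs; have so1 := sp_sound1 sp; have so1' := sp_sound1 sp'.
have fd := iso_dom hf; have fi := iso_inj hf.
have ho' : inert m1' := sound_out so1'.
have hc0 := sl_Dc0 sl.
have fc0 : f c0 = c0'.
  apply: (sp_markU sp'); first exact: fd.
  by have := iso_lab hf hc0; rewrite /= (sp_mark sp).
have fq0 : f (q 0) = q' 0.
  by rewrite -(sl_n1c0 sl) -(sl_n1c0 sl') -fc0; apply: (iso_nxt hf hc0).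
have hM := add_corner_sound so1 (sl_Ds sl) None.
have hM' := add_corner_sound so1' (sl_Ds sl') None.
have hF := iso_add_corner hf None (sl_Ds sl); rewrite -/m1 in hF.
have [ll fp] : l = l' /\ forall k, k < l -> f (p k.+1) = p' k.+1.
  have hN : None \in dom (@add_corner m1 s None) by rewrite inE.
  have hc : Some c0 \in dom (@add_corner m1 s None) by rewrite inE.
  have hN' : None \in dom (@add_corner m1' s' None) by rewrite inE.
  have hc' : Some c0' \in dom (@add_corner m1' s' None) by rewrite inE /= (sl_Dc0 sl').
  rewrite fs in hF.
  have ccwd x : x \in dom (@add_corner m1 s None) -> ccw x \in dom (@add_corner m1 s None).
    by rewrite -(cw_dom hM (ccw x)) (ccwK hM).
  have g1 := iso_steered hM hF (sound_out hM') (g := @ccw _) (g' := @ccw _)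
    ccwd (iso_ccw hM hF (sound_out hM')) hN hc (sp_right sp).
  rewrite [omap f (Some c0)]/= fc0 in g1.
  have := steered_uniq hM' (ccw_same_vertex hM') hN' hc' g1 (sp_right sp').
  rewrite -map_comp => E; have [E1 E2] := mkseq_eq E.
  split=> // k hk; have := E2 k hk; rewrite /markp /= -E1 hk /=.
  by case.
have fp0 : f (p 0) = p' 0.
  rewrite -r1q // -r1q' // -fq0; apply: (iso_rev hf (sl_Dq sl (leq0n l))).
have fpk k : k <= l -> f (p k) = p' k by case: k.
have fqk k : k <= l -> f (q k) = q' k.
  move=> hk; rewrite -(sl_r1p sl) // -(sl_r1p sl') -?ll // -fpk //.
  by apply: (iso_rev hf (sl_Dp sl hk)).
have fnp z k : z \in D1 -> k <= l -> z != p k -> f z != p' k.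
  by move=> hz hk; rewrite -fpk //; apply: contraNneq => /fi -> //; apply: (sl_Dp sl).
have fnq z k : z \in D1 -> k <= l -> z != q k -> f z != q' k.
  by move=> hz hk; rewrite -fqk //; apply: contraNneq => /fi -> //; apply: (sl_Dq sl).
have fnc z : z \in D1 -> z != c0 -> f z != c0'.
  by move=> hz; rewrite -fc0; apply: contraNneq => /fi ->.
exists f; last by split; rewrite /= ?fp0 //; apply: connect0.
split.
- by move=> x y /=; rewrite !D2E => /andP [_ hx] /andP [_ hy]; apply: fi.
- have hfi : f @: D1 = D1' by case: hf.
  rewrite /= (sl_D2 sl) (sl_D2 sl') -hfi -fc0; apply/setP => y; rewrite !inE.
  apply/imsetP/andP => [[x]|[hy /imsetP [x hx E]]].
    by rewrite !inE => /andP [hx hx'] ->; rewrite fc0 fnc // imset_f.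
  by exists x => //; rewrite !inE hx andbT; apply: contraNneq hy => xc; rewrite E xc.
- move=> z /=; rewrite D2E => /andP [hz0 hz].
  have [k hk ->|[|k] hk ->|hp hq] := placeP z.
  + rewrite fpk //; have [hk'|->] : k < l \/ k = l by lia.
      by rewrite (sl_r2p sl hk') (sl_r2p sl') -?ll // fqk.
    by rewrite (sl_r2pl sl) ll (sl_r2pl sl').
  + by rewrite r2q0 fqk // r2q0' fpk // ll.
  + by rewrite (r2q hk) fqk // r2q' -?ll // fpk // ltnW.
  + rewrite (sl_rE sl) // (sl_rE sl') //.
    * exact: (iso_rev hf hz).
    * exact: fnc.
    * by move=> k; rewrite -ll => hk; apply: fnp; rewrite ?hp.
    * by move=> k; rewrite -ll => hk; apply: fnq; rewrite ?hq.
- move=> z /=; rewrite D2E => /andP [hz0 hz].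
  have [->|hzq] := eqVneq z (q 0).
    rewrite (sl_n2q sl) fq0 (sl_n2q sl') -fs; exact: (iso_nxt hf (sl_Ds sl)).
  have [->|hzs] := eqVneq z s; first by rewrite (sl_n2s sl) fs (sl_n2s sl').
  rewrite (sl_nE sl) // (sl_nE sl') ?fnc // -?fs ?fnq //.
    exact: (iso_nxt hf hz).
  by apply: contraNneq hzs => /fi -> //; apply: (sl_Ds sl).
- move=> z /=; rewrite D2E => /andP [hz0 hz]; exact: (iso_lab hf hz).
Qed.

(** Here [s] is recovered as the predecessor of [q 0], and the path as the unique leftmost geodesic.
    The isomorphism then extends to the original maps by sending [c0] to [c0']. *)
Lemma slid_unique_left : pointed_iso (@Pointed m2 (p 0) (q 0)) (@Pointed m2' (p' 0) (q' 0)) ->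
  cornered_iso (@Cornered m1 s) (@Cornered m1' s').
Proof.
case=> g hg [/= gp0 gq0]; have so2 := sp_sound2 sp; have so2' := sp_sound2 sp'.
have gd := iso_dom hg; have gi := iso_inj hg.
have ho' : inert m2' := sound_out so2'.
have hs2 : s \in D2 by rewrite D2E (sl_sc0 sl) (sl_Ds sl).
have hs2' : s' \in D2' by rewrite D2E' (sl_sc0 sl') (sl_Ds sl').
have gs : g s = s'.
  apply: (sl_n2 sl'); rewrite (sl_n2s sl') -gq0 -(sl_n2s sl).
  by apply/esym; apply: (iso_nxt hg hs2).
have hM := add_corner_sound so2 hs2 None.
have hM' := add_corner_sound so2' hs2' None.
have hF := iso_add_corner hg None hs2; rewrite -/m2 gs in hF.
have Dp k : k <= l -> p k \in D2.
  by move=> hk; rewrite D2E (sl_pc0 sl) // (sl_Dp sl).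
have Dq k : k <= l -> q k \in D2.
  by move=> hk; rewrite D2E (sl_qc0 sl) // (sl_Dq sl).
have Dp' k : k <= l' -> p' k \in D2'.
  by move=> hk; rewrite D2E' (sl_pc0 sl') // (sl_Dp sl').
have [ll gq] : l = l' /\ forall k, k <= l -> g (q k) = q' k.
  have hN : None \in dom (@add_corner m2 s None) by rewrite inE.
  have hc : Some (p 0) \in dom (@add_corner m2 s None) by rewrite inE /= Dp.
  have hN' : None \in dom (@add_corner m2' s' None) by rewrite inE.
  have hc' : Some (p' 0) \in dom (@add_corner m2' s' None) by rewrite inE /= Dp'.
  have cwd x : x \in dom (@add_corner m2 s None) -> cw x \in dom (@add_corner m2 s None).
    by rewrite (cw_dom hM).
  have g1 := iso_steered hM hF (sound_out hM') (g := @cw _) (g' := @cw _)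
    cwd (iso_cw hM hF) hc hN (sp_left sp).
  have hv : @same_vertex (@add_corner m2' s' None) (Some (g (p 0))) (Some (p' 0)).
    by rewrite (add_corner_vertex so2').
  have g2 := steered_target hM' hv g1.
  have := steered_uniq hM' (@cw_same_vertex _) hc' hN' g2 (sp_left sp').
  rewrite -map_comp => E; have [[E1] E2] := mkseq_eq E.
  split=> // k hk; have [k0|k0] : k = 0 \/ 0 < k by lia.
    by rewrite k0; have := E2 0 isT; case.
  have hlt : (l - k).+1 < l.+1 by lia.
  by have := E2 _ hlt; rewrite /= -E1 subKn // => -[].
have gp k : k <= l -> g (p k) = p' k.
  move=> hk; have [hk'|->] : k < l \/ k = l by lia.
    have hk2 : k < l' by rewrite -ll.
    by rewrite -(r2q hk') -(r2q' hk2) -(gq _ hk'); apply: (iso_rev hg (Dq k.+1 hk')).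
  by rewrite -r2q0 ll -r2q0' -gq0; apply: (iso_rev hg (Dq 0 _)).
have gnp z k : z \in D2 -> k <= l -> z != p k -> g z != p' k.
  move=> hz hk; apply: contraNneq; rewrite -(gp k hk) => E.
  by apply/eqP; apply: gi E => //; apply: Dp.
have gnq z k : z \in D2 -> k <= l -> z != q k -> g z != q' k.
  move=> hz hk; apply: contraNneq; rewrite -(gq k hk) => E.
  by apply/eqP; apply: gi E => //; apply: Dq.
have gnc z : z \in D2 -> g z != c0'.
  by move=> /gd; rewrite /= D2E' => /andP [].
have D1c z : z \in D1 -> z != c0 -> z \in D2 by rewrite D2E => -> ->.
have sc : s != c0 := sl_sc0 sl.
pose f z := if z == c0 then c0' else g z.
have fN z : z != c0 -> f z = g z by rewrite /f => /negPf ->.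
have fc : f c0 = c0' by rewrite /f eqxx.
exists f; last by rewrite /= fN.
split.
- move=> x y /= hx hy; rewrite /f; case: (eqVneq x c0) => [->|hx0]; case: (eqVneq y c0) => [->|hy0] //.
  + by move=> E; have := gnc y (D1c y hy hy0); rewrite -E eqxx.
  + by move=> E; have := gnc x (D1c x hx hx0); rewrite E eqxx.
  + by apply: gi; apply: D1c.
- have hgi : g @: D2 = D2' by case: hg.
  apply/setP => y /=; apply/imsetP/idP => [[x hx ->]|hy].
    rewrite /f; case: eqVneq => [_|hx0]; first exact: (sl_Dc0 sl').
    by have := gd x (D1c x hx hx0); rewrite /= D2E' => /andP [].
  have [->|hy0] := eqVneq y c0'; first by exists c0; rewrite ?fc // (sl_Dc0 sl).
  have : y \in D2' by rewrite D2E' hy0.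
  rewrite -hgi => /imsetP [x hx ->]; exists x; first by move: hx; rewrite D2E => /andP [].
  by rewrite fN //; move: hx; rewrite D2E => /andP [].
- move=> z /= hz; have [->|hz0] := eqVneq z c0.
    by rewrite (sl_r1c0 sl) fc (sl_r1c0 sl').
  have [k hk ->|k hk ->|hp hq] := placeP z.
  + rewrite (sl_r1p sl hk) !fN ?(sl_pc0 sl) ?(sl_qc0 sl) // gp // gq //.
    by rewrite (sl_r1p sl') // -ll.
  + rewrite r1q // !fN ?(sl_pc0 sl) ?(sl_qc0 sl) // gp // gq //.
    by rewrite r1q' // -ll.
  + have hz2 := D1c z hz hz0.
    have r1z : r1 z != c0.
      apply: contraNneq hz0 => E; rewrite -(sl_r1K sl z) E; exact/eqP/(sl_r1c0 sl).
    rewrite !fN // -(sl_rE sl hz0 hp hq) -(sl_rE sl' (gnc z hz2)).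
    * exact: (iso_rev hg hz2).
    * by move=> k; rewrite -ll => hk; apply: gnp; rewrite ?hp.
    * by move=> k; rewrite -ll => hk; apply: gnq; rewrite ?hq.
- move=> z /= hz; have [->|hz0] := eqVneq z c0.
    by rewrite (sl_n1c0 sl) fc (sl_n1c0 sl') fN ?(sl_qc0 sl) // gq.
  have [->|hzq] := eqVneq z (q 0).
    by rewrite (sl_n1q sl) fc fN ?(sl_qc0 sl) // gq // (sl_n1q sl').
  have n1z w : w != q 0 -> n1 w != c0.
    by apply: contraNneq => E; apply/eqP; apply: (sl_n1 sl); rewrite E (sl_n1q sl).
  rewrite !fN ?n1z //; have [->|hzs] := eqVneq z s.
    rewrite gs -(sl_n2q sl) -(sl_n2q sl') -gq0; exact: (iso_nxt hg (Dq 0 _)).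
  have hz2 := D1c z hz hz0.
  rewrite -(sl_nE sl hz0 hzq hzs) -(sl_nE sl' (gnc z hz2)) ?gnq //.
    exact: (iso_nxt hg hz2).
  by rewrite -gs; apply: contraNneq hzs => /gi -> //.
- move=> z /= hz; have [->|hz0] := eqVneq z c0.
    by rewrite fc (sp_mark sp) (sp_mark sp').
  by rewrite fN //; apply: (iso_lab hg (D1c z hz hz0)).
Qed.

End Uniqueness.

(** * Slitting and sewing along a rightmost geodesic *)

Lemma first_after_now (T : Type) (g : T -> T) (P : pred T) x :
  P (g x) -> first_after g P x (g x).
Proof. by move=> h; exists 0. Qed.

Lemma first_after_next (T : Type) (g : T -> T) (P : pred T) x y :
  ~~ P (g x) -> first_after g P (g x) y -> first_after g P x y.
Proof.
move=> h [n [-> h1 h2]]; exists n.+1; split=> //; rewrite -?iterSr //.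
by case=> [|i] hi //; rewrite iterSr; apply: h2.
Qed.

(** Successors in a carved map are computed by following the raw successor until a kept element is
    found; [first_after_next] skips a discarded element and [first_after_now] concludes. *)
Lemma carve_nxt (T : finType) (D : {set T}) (rv g : T -> T) lb x y :
  x \in D -> first_after g (mem D) x y -> @nxt (carve D rv g lb) x = y.
Proof.
move=> hx [n [Ey hy hn]]; rewrite /= hx head_filter_nth; set o := orbit g (g x).
have nthE i : i < size o -> nth x o i = iter i.+1 g x.
  move=> hi; rewrite (set_nth_default (g x)) //.
  by move: hi; rewrite size_orbit /o /orbit => hi; rewrite nth_traject // -iterSr.
have hh : has (mem D) o.
  apply/hasP; exists y => //; rewrite -fconnect_orbit Ey iterSr.
  exact: fconnect_iter.
have hk : find (mem D) o < size o by rewrite -has_find.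
have := nth_find x hh; rewrite nthE //.
have [/hn/negP //|hlt _|-> _] := ltngtP (find (mem D) o) n; last by rewrite Ey.
have := before_find x hlt; rewrite nthE -?Ey ?hy //.
exact: ltn_trans hlt hk.
Qed.

Lemma carve_rev (T : finType) (D : {set T}) (rv g : T -> T) lb x :
  x \in D -> @rev (carve D rv g lb) x = rv x.
Proof. by move=> /= ->. Qed.

Lemma carve_inert (T : finType) (D : {set T}) (rv g : T -> T) lb : inert (carve D rv g lb).
Proof. by move=> x /= /negPf ->. Qed.

Lemma thread_out (T : eqType) (z0 z1 : T) s g z :
  z != z0 -> z \notin s -> thread z0 s z1 g z = g z.
Proof. by move=> h1 h2; rewrite /thread inE (negPf h1) (negPf h2). Qed.

Lemma thread_mkseq (T : eqType) (z1 : T) (u : nat -> T) n g k :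
  {in gtn n.+1 &, injective u} -> k <= n ->
  thread (u 0) (mkseq (fun i => u i.+1) n) z1 g (u k) =
  if k < n then u k.+1 else z1.
Proof.
move=> ui hk; have E : u 0 :: mkseq (fun i => u i.+1) n = mkseq u n.+1.
  by rewrite /mkseq /= (iotaDl 1 0) -map_comp.
rewrite /thread E; have hu : uniq (mkseq u n.+1).
  by apply/mkseq_uniqP => i j hi hj; apply: ui.
rewrite map_f ?mem_iota //.
have -> : index (u k) (mkseq u n.+1) = k.
  by rewrite -{1}(nth_mkseq z1 u (hk : k < n.+1)) index_uniq // size_mkseq.
case: ltnP => h; first by rewrite nth_mkseq.
by rewrite nth_default // size_mkseq.
Qed.

Lemma leq_case k l : k <= l -> k < l \/ k = l.
Proof. by lia. Qed.

Section PhiRight.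
Variables (r : nat) (m : pmap) (s c0 : elt m) (r2 n2 : elt m -> elt m).
Variables (l : nat) (p q : nat -> elt m).
Let X := @Cornered m s.
Hypothesis sl : slid (dom m) (dom m :\ c0) (@rev m) (@nxt m) r2 n2 l p q s c0.
Hypotheses (hc0 : right_c0 r X = Some c0)
  (hpath : right_path r X = mkseq (fun k => Some (p k.+1)) l)
  (hlab : lab (q 0) = None).
Let M1 := right_m1 X.
Let Sl := right_slit r X.
Let T : finType := elt M1.

Let r1q (k : nat) : k <= l -> rev (q k) = p k.
Proof. by move=> hk; rewrite -(sl_r1p sl hk) (sl_r1K sl). Qed.

Lemma mem_right_path x :
  (x \in right_path r X) = [exists k : 'I_l, x == Some (p k.+1)].
Proof.
rewrite hpath; apply/mapP/existsP => [[k]|[k /eqP ->]].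
  by rewrite mem_iota => hk ->; exists (Ordinal (hk : k < l)).
by exists (val k) => //; rewrite mem_iota ltn_ord.
Qed.

Let dbl (x : T) : bool := (x \in right_path r X) || (rev x \in right_path r X).

Lemma right_dbl_p k : 0 < k -> k <= l -> dbl (Some (p k)).
Proof.
case: k => // k _ hk; apply/orP; left; rewrite mem_right_path.
by apply/existsP; exists (Ordinal hk).
Qed.
Lemma right_dbl_q k : 0 < k -> k <= l -> dbl (Some (q k)).
Proof.
case: k => // k _ hk; apply/orP; right; rewrite mem_right_path.
by apply/existsP; exists (Ordinal hk); rewrite /= r1q.
Qed.
Lemma right_dbl_out x : (forall k, 0 < k -> k <= l -> x != p k) ->
  (forall k, 0 < k -> k <= l -> x != q k) -> ~~ dbl (Some x).
Proof.
move=> h1 h2; rewrite /dbl !mem_right_path; apply/negP => /orP [] /existsP [k /eqP []].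
  by move=> E; have := h1 k.+1 isT (ltn_ord k); rewrite E eqxx.
move=> E; have := h2 k.+1 isT (ltn_ord k).
by rewrite -(sl_r1p sl (ltn_ord k)) -E (sl_r1K sl) eqxx.
Qed.
Lemma right_dbl_p0 : ~~ dbl (Some (p 0)).
Proof.
apply: right_dbl_out => k h0 hk; last exact: (sl_pq sl).
by apply/eqP => /(sl_p sl (leq0n _) hk) E; rewrite -E in h0.
Qed.
Lemma right_dbl_q0 : ~~ dbl (Some (q 0)).
Proof.
apply: right_dbl_out => k h0 hk; first by rewrite eq_sym (sl_pq sl).
by apply/eqP => /(sl_q sl (leq0n _) hk) E; rewrite -E in h0.
Qed.

Let iL (x : elt m) : elt Sl := inl (Some x).
(** The two sides of the slit: [Bq k] is the reverse of the left copy of [p k], and [Bp k] is its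
    right copy. The loop, numbered 0, is not on the path and is not doubled, hence the common value
    at 0. *)
Let Bq k : elt Sl := if k is 0 then iL (q 0) else inr (Some (q k)).
Let Bp k : elt Sl := if k is 0 then iL (q 0) else inr (Some (p k)).

Let iL_dom x : (iL x \in dom Sl) = (x \in dom m) && (x != c0).
Proof. by rewrite inE /iL hc0 [Some x \in _]inE /= andbT. Qed.
Let inr_dom (x : T) : (inr x \in dom Sl) = dbl x.
Proof. by rewrite inE. Qed.
Let Bq_dom k : k <= l -> Bq k \in dom Sl.
Proof.
case: k => [|k] hk; first by rewrite iL_dom (sl_Dq sl) // (sl_qc0 sl).
by rewrite inr_dom right_dbl_q.
Qed.
Let Bp_dom k : k <= l -> Bp k \in dom Sl.
Proof.
case: k => [|k] hk; first by rewrite iL_dom (sl_Dq sl) // (sl_qc0 sl).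
by rewrite inr_dom right_dbl_p.
Qed.

Let revS_p k : k <= l -> rev (iL (p k)) = Bq k.
Proof.
move=> hk; have hd : iL (p k) \in dom Sl by rewrite iL_dom (sl_Dp sl) // (sl_pc0 sl).
rewrite [LHS](carve_rev _ _ _ hd) /=; case: k hk hd => [|k] hk hd.
  by rewrite -/(dbl _) (negPf right_dbl_p0) (sl_r1p sl).
by rewrite -/(dbl _) right_dbl_p // (sl_r1p sl).
Qed.
Let revS_Bq k : k <= l -> rev (Bq k) = iL (p k).
Proof.
move=> hk; have hd := Bq_dom hk; rewrite [LHS](carve_rev _ _ _ hd).
case: k hk {hd} => [|k] hk /=; last by rewrite r1q.
by rewrite -/(dbl _) (negPf right_dbl_q0) r1q.
Qed.
Let revS_q k : 0 < k -> k <= l -> rev (iL (q k)) = Bp k.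
Proof.
move=> h0 hk; have hd : iL (q k) \in dom Sl by rewrite iL_dom (sl_Dq sl) // (sl_qc0 sl).
rewrite [LHS](carve_rev _ _ _ hd) /= -/(dbl _) right_dbl_q // r1q //.
by case: (k) h0.
Qed.
Let revS_Bp k : 0 < k -> k <= l -> rev (Bp k) = iL (q k).
Proof.
move=> h0 hk; have hd := Bp_dom hk; rewrite [LHS](carve_rev _ _ _ hd).
by case: k h0 hk {hd} => // k _ hk /=; rewrite (sl_r1p sl).
Qed.
Let revS_out x : x \in dom m -> x != c0 -> (forall k, k <= l -> x != p k) ->
  (forall k, k <= l -> x != q k) -> rev (iL x) = iL (rev x).
Proof.
move=> h1 h2 h3 h4; have hd : iL x \in dom Sl by rewrite iL_dom h1.
rewrite [LHS](carve_rev _ _ _ hd) /= -/(dbl _) (negPf (right_dbl_out _ _)) // => k _.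
  exact: h3.
exact: h4.
Qed.

Let right_loopE : right_loop r X = iL (q 0).
Proof. by rewrite /right_loop hc0 /= eq_sym (negPf (sl_sc0 sl)) (sl_n1c0 sl). Qed.
Let right_r0E : right_r0 r X = iL (p 0).
Proof. by rewrite /right_r0 right_loopE -[iL (q 0)]/(Bq 0) revS_Bq. Qed.

(** The two threads drawn by the slit, one from the corner [c0] and the other from the corner
    [None]; the latter follows the path backwards, hence the index [l - k'] in [uL]. *)
Let uR (k : nat) : (T + T)%type := if k is k'.+1 then inr (Some (p k'.+1)) else inl (Some c0).
Let uL (k : nat) : (T + T)%type :=
  if k is k'.+1 then inr (Some (q (l - k'))) else inl None.

Let uR_inj : {in gtn l.+1 &, injective uR}.
Proof.
move=> [|i] [|j] //= hi hj []; rewrite !unfold_in /= in hi hj => E.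
by apply: (sl_p sl) E; lia.
Qed.
Let uL_inj : {in gtn l.+1 &, injective uL}.
Proof.
move=> [|i] [|j] //= hi hj []; rewrite !unfold_in /= in hi hj => E.
have : l - i = l - j by apply: (sl_q sl) E; lia.
lia.
Qed.

Let g0 (z : (T + T)%type) : (T + T)%type := if z is inl x then inl (nxt x) else z.
Let gl := thread (uL 0) (mkseq (fun i => uL i.+1) l) (inl (Some (q 0))) g0.
Let g := thread (uR 0) (mkseq (fun i => uR i.+1) l) (inl (Some (nxt s))) gl.

Let gS : T + T -> T + T :=
  thread (inl (right_c0 r X)) [seq inr x | x <- right_path r X] (inl (nxt (right_c X)))
    (thread (inl (right_c X)) [seq inr (rev x) | x <- seq.rev (right_path r X)]
       (inl (nxt (right_c0 r X))) g0).

Let gSE : gS = g.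
Proof.
rewrite /gS /g /gl hc0 hpath; congr (thread _ _ _ (thread _ _ _ _)).
- by rewrite /mkseq -map_comp.
- apply: (@eq_from_nth _ (inl None)); rewrite size_map size_rev !size_mkseq // => i hi.
  rewrite (nth_map None) ?size_rev ?size_mkseq // nth_rev ?size_mkseq // !nth_mkseq //.
    have E : (l - i.+1).+1 = l - i by lia.
    rewrite [rev _]/= E (sl_r1p sl) //; exact: leq_subr.
  by lia.
- by rewrite /= eq_sym (negPf (sl_sc0 sl)) (sl_n1c0 sl).
Qed.

Let g_uR k : k <= l -> g (uR k) = if k < l then uR k.+1 else inl (Some (nxt s)).
Proof. exact: thread_mkseq uR_inj. Qed.

Let g_uL k : k <= l -> g (uL k) = if k < l then uL k.+1 else inl (Some (q 0)).
Proof.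
move=> hk; rewrite /g thread_out; first exact: (thread_mkseq _ _ uL_inj).
  by case: (k).
apply/mapP => -[i]; rewrite mem_iota => hi; case: k hk => //= k hk [] E.
by have := sl_pq sl (_ : i.+1 <= l) (leq_subr k l); rewrite E eqxx => /(_ hi).
Qed.

Let g_iL x : x != c0 -> g (iL x) = if x == s then inl None else iL (nxt x).
Proof.
move=> hx; have h1 : iL x \notin mkseq (fun i => uR i.+1) l by apply/mapP => -[i].
have h2 : iL x \notin mkseq (fun i => uL i.+1) l by apply/mapP => -[i].
have h3 : iL x != uR 0 by apply/eqP => -[] E; rewrite E eqxx in hx.
rewrite /g (thread_out _ _ h3 h1) /gl thread_out //=; by case: eqP.
Qed.

Let nxtS z y : z \in dom Sl -> first_after g (mem (dom Sl)) z y -> nxt z = y.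
Proof. by rewrite -gSE; apply: carve_nxt. Qed.

Let n1_c0 x : x != q 0 -> nxt x != c0.
Proof. by apply: contraNneq => E; apply/eqP/(sl_n1 sl); rewrite E (sl_n1q sl). Qed.
Let s_c0 : nxt s != c0. Proof. exact: n1_c0 (sl_sq sl). Qed.

Let nxtS_iL x : x \in dom m -> x != c0 -> x != s -> x != q 0 -> nxt (iL x) = iL (nxt x).
Proof.
move=> h1 h2 h3 h4; apply: nxtS; first by rewrite iL_dom h1.
have E : g (iL x) = iL (nxt x) by rewrite g_iL // (negPf h3).
rewrite -E; apply: first_after_now; rewrite E /= iL_dom n1_c0 // andbT.
by apply: contraTT h1 => h1; have [_ /(sl_n1 sl) <-] := sl_out sl h1.
Qed.

Let nS_dom : iL (nxt s) \in dom Sl.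
Proof.
rewrite iL_dom s_c0 andbT; apply: contraTT (sl_Ds sl) => h1.
by have [_ /(sl_n1 sl) <-] := sl_out sl h1.
Qed.

Let c_out : (inl None : elt Sl) \notin dom Sl.
Proof. by rewrite inE /right_c eqxx !andbF. Qed.
Let c0_out : (inl (Some c0) : elt Sl) \notin dom Sl.
Proof. by rewrite inE hc0 eqxx !andbF. Qed.

Let uL_Bq k : k < l -> uL (l - k) = Bq k.+1.
Proof.
by move=> hk; rewrite (_ : l - k = (l - k.+1).+1) /=; last lia; rewrite subKn.
Qed.
Let g_uLB k : k <= l -> g (uL (l - k)) = Bq k.
Proof.
move=> hk; rewrite g_uL ?leq_subr //; case: k hk => [|k] hk; first by rewrite subn0 ltnn.
have -> : l - k.+1 < l by lia.
by rewrite -uL_Bq //; congr uL; lia.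
Qed.

(** From here on the contour of the slit is computed: [s], [Bq l], ..., [Bq 0], [Bp 1], ..., [Bp l],
    [nxt s]. Opening the path has merged the face of degree 1 with [f_1]. *)
Let nxtS_s : nxt (iL s) = Bq l.
Proof.
apply: nxtS; first by rewrite iL_dom (sl_Ds sl) (sl_sc0 sl).
have E : g (iL s) = inl None by rewrite g_iL ?(sl_sc0 sl) // eqxx.
apply: first_after_next; rewrite E //; have := g_uLB (leqnn l); rewrite subnn /= => <-.
by apply: first_after_now; have := g_uLB (leqnn l); rewrite subnn /= => ->; apply: Bq_dom.
Qed.

Let nxtS_Bq k : k < l -> nxt (Bq k.+1) = Bq k.
Proof.
move=> hk; apply: nxtS; first exact: Bq_dom.
rewrite -(g_uLB (ltnW hk)) -uL_Bq //; apply: first_after_now.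
by rewrite g_uLB ?(ltnW hk) //; apply: Bq_dom; apply: ltnW.
Qed.

Let nxtS_Bp k : k <= l -> nxt (Bp k) = if k < l then Bp k.+1 else iL (nxt s).
Proof.
move=> hk; apply: nxtS; first exact: Bp_dom.
have E : g (uR k) = if k < l then Bp k.+1 else iL (nxt s) by rewrite g_uR.
have hd : (if k < l then Bp k.+1 else iL (nxt s)) \in dom Sl.
  by case: ltnP => h //; apply: Bp_dom.
case: k hk E hd => [|k] hk E hd; rewrite -E; last first.
  by apply: first_after_now; rewrite [g _]E.
have E2 : g (iL (q 0)) = uR 0.
  by rewrite g_iL ?(sl_qc0 sl) // eq_sym (negPf (sl_sq sl)) (sl_n1q sl).
apply: first_after_next; rewrite [g (Bp 0)]E2 //.
by apply: first_after_now; rewrite E.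
Qed.

Lemma mkseq_cons (A : Type) (u : nat -> A) n :
  u 0 :: mkseq (fun i => u i.+1) n = mkseq u n.+1.
Proof. by rewrite /mkseq /= (iotaDl 1 0) -map_comp. Qed.

Lemma mkseq_rcons (A : Type) (u : nat -> A) n : mkseq u n.+1 = rcons (mkseq u n) (u n).
Proof. by rewrite /mkseq -addn1 iotaD map_cat cats1. Qed.

Let right_rE : right_r r X = mkseq (fun k => iL (p k.+1)) l.
Proof. by rewrite /right_r hpath /mkseq -map_comp. Qed.
Let right_lE : right_l r X = mkseq (fun k => Bp k.+1) l.
Proof. by rewrite /right_l hpath /mkseq -map_comp. Qed.

Let belastE : belast (right_r0 r X) (right_r r X) = mkseq (fun k => iL (p k)) l /\
  last (right_r0 r X) (right_r r X) = iL (p l).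
Proof.
rewrite right_rE right_r0E.
have := lastI (iL (p 0)) (mkseq (fun k => iL (p k.+1)) l).
rewrite (mkseq_cons (fun k => iL (p k))) mkseq_rcons.
by case/rcons_inj => <- <-.
Qed.

Let sideL : map (@rev Sl) (belast (right_r0 r X) (right_r r X)) = mkseq Bq l.
Proof.
rewrite belastE.1 /mkseq -map_comp; apply/eq_in_map => k.
by rewrite mem_iota => hk /=; apply: revS_p; lia.
Qed.

Let Bq_inj i j : i <= l -> j <= l -> Bq i = Bq j -> i = j.
Proof. by case: i j => [|i] [|j] // hi hj [] /(sl_q sl hi hj). Qed.
Let Bp_inj i j : i <= l -> j <= l -> Bp i = Bp j -> i = j.
Proof. by case: i j => [|i] [|j] // hi hj [] /(sl_p sl hi hj). Qed.
Let Bpq i j : i < l -> j <= l -> Bp i.+1 != Bq j.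
Proof.
move=> hi; case: j => [|j] hj //; apply/eqP => -[] E.
by have := sl_pq sl hi hj; rewrite E eqxx.
Qed.

Let sewn z := (z \in mkseq Bq l) || (z \in mkseq (fun k => Bp k.+1) l).
Let mate z := if z \in mkseq Bq l then
    nth z (mkseq (fun k => Bp k.+1) l) (index z (mkseq Bq l))
  else if z \in mkseq (fun k => Bp k.+1) l then
    nth z (mkseq Bq l) (index z (mkseq (fun k => Bp k.+1) l)) else z.

Let Sw := right_sewn r X.

Let uniqBq : uniq (mkseq Bq l).
Proof.
by apply/mkseq_uniqP => i j; rewrite !unfold_in /= => hi hj; apply: Bq_inj; apply: ltnW.
Qed.
Let uniqBp : uniq (mkseq (fun k => Bp k.+1) l).
Proof.
apply/mkseq_uniqP => i j; rewrite !unfold_in /= => hi hj E.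
by have := @Bp_inj i.+1 j.+1 hi hj E; case.
Qed.

Let in_Bq k : k < l -> Bq k \in mkseq Bq l.
Proof. by move=> hk; apply: map_f; rewrite mem_iota. Qed.
Let in_Bp k : k < l -> Bp k.+1 \in mkseq (fun k => Bp k.+1) l.
Proof. by move=> hk; apply: (map_f (fun k => Bp k.+1)); rewrite mem_iota. Qed.
Let notin_Bq k : k < l -> Bp k.+1 \notin mkseq Bq l.
Proof.
move=> hk; apply/mapP => -[i]; rewrite mem_iota => hi /eqP.
by rewrite (negPf (Bpq hk _)) //; lia.
Qed.

Let mate_Bq k : k < l -> mate (Bq k) = Bp k.+1.
Proof.
move=> hk; rewrite /mate in_Bq //.
have -> : index (Bq k) (mkseq Bq l) = k.
  by rewrite -{1}(nth_mkseq (Bq 0) Bq hk) index_uniq // size_mkseq.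
by rewrite nth_mkseq.
Qed.
Let mate_Bp k : k < l -> mate (Bp k.+1) = Bq k.
Proof.
move=> hk; rewrite /mate (negPf (notin_Bq hk)) in_Bp //.
have -> : index (Bp k.+1) (mkseq (fun k => Bp k.+1) l) = k.
  by rewrite -{1}(nth_mkseq (Bq 0) (fun k => Bp k.+1) hk) index_uniq // size_mkseq.
by rewrite nth_mkseq.
Qed.
Let mate_out z : ~~ sewn z -> mate z = z.
Proof. by rewrite /sewn negb_or /mate => /andP [/negPf -> /negPf ->]. Qed.
Let sewn_Bq k : k < l -> sewn (Bq k).
Proof. by move=> hk; rewrite /sewn in_Bq. Qed.
Let sewn_Bp k : k < l -> sewn (Bp k.+1).
Proof. by move=> hk; rewrite /sewn in_Bp // orbT. Qed.
Let sewn_Bql : ~~ sewn (Bq l).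
Proof.
apply/norP; split; apply/mapP => -[k]; rewrite mem_iota => hk.
  by move/Bq_inj => E; have := E (leqnn l) _; lia.
by move/eqP; rewrite eq_sym (negPf (Bpq _ _)).
Qed.
Let sewn_iL x : x != q 0 -> ~~ sewn (iL x).
Proof.
move=> hx; apply/norP; split; apply/mapP => -[k]; rewrite mem_iota //.
by case: k => //= hk [] E; rewrite E eqxx in hx.
Qed.

Let domW z : (z \in dom Sw) = (z \in dom Sl) && ~~ sewn z.
Proof. by rewrite [LHS]inE right_lE sideL. Qed.

Let revW z : z \in dom Sw ->
  @rev Sw z = if sewn (@rev Sl z) then @rev Sl (mate (@rev Sl z)) else @rev Sl z.
Proof.
move=> hz; rewrite [LHS](carve_rev _ _ _ hz).
by rewrite right_lE sideL.
Qed.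

Let gW z := nxt (mate z).
Let nxtW z y : z \in dom Sw -> first_after gW (mem (dom Sw)) z y -> @nxt Sw z = y.
Proof.
move=> hz h; apply: carve_nxt => //.
case: h => n [-> h1 h2].
(* The origins of the two sewn paths already coincide, so the transposition is trivial. *)
have it i : iter i (fun z0 => tperm (nxt (right_loop r X)) (nxt (right_loop r X))
   (nxt (mate z0))) z = iter i gW z.
  by elim: i => //= i ->; rewrite tperm1 perm1.
rewrite right_lE sideL; exists n; split=> [||i hi].
- exact: (esym (it n.+1)).
- by rewrite /= inE -/(sewn _) -domW.
- apply: contra (h2 i hi); rewrite -(it i.+1) /= inE => h; rewrite domW; exact: h.
Qed.

(** Sewing consumes [Bq k] for [k < l], including the loop when [l > 0], and all the right copies.
    The surviving border element [Bq l], reverse of the last left copy, takes the place of [q 0]. *)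
Definition right_embed (x : elt m) : elt Sw := if x == q 0 then Bq l else iL x.

Let em_q0 : right_embed (q 0) = Bq l. Proof. by rewrite /right_embed eqxx. Qed.
Let em_out x : x != q 0 -> right_embed x = iL x.
Proof. by rewrite /right_embed => /negPf ->. Qed.

Let em_dom x : x \in dom m -> x != c0 -> right_embed x \in dom Sw.
Proof.
move=> h1 h2; rewrite domW /right_embed; case: eqVneq => [_|h3].
  by rewrite sewn_Bql Bq_dom.
by rewrite iL_dom h1 h2 sewn_iL.
Qed.

Let em_ex z : z \in dom Sw -> exists2 x, x \in dom m :\ c0 & z = right_embed x.
Proof.
have hq0 : q 0 \in dom m :\ c0 by rewrite !inE (sl_qc0 sl) // (sl_Dq sl).
rewrite domW; case: z => [[x|]|y] /andP [].
- rewrite iL_dom => /andP [h1 h2]; have [->|h3] := eqVneq x (q 0).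
    have [l0|l0] := posnP l.
      by exists (q 0) => //; rewrite em_q0 l0.
    by rewrite -[inl _]/(Bq 0) sewn_Bq.
  by exists x; rewrite ?em_out // !inE h1 h2.
- by rewrite (negPf c_out).
- rewrite inr_dom /dbl !mem_right_path => /orP [] /existsP [k /eqP].
    by move=> ->; rewrite -[inr _]/(Bp k.+1) sewn_Bp.
  case: y => //= y [E]; have {E} -> : y = q k.+1.
    by rewrite -(sl_r1p sl (ltn_ord k)) -E (sl_r1K sl).
  rewrite -[inr _]/(Bq k.+1) => hs; exists (q 0) => //; rewrite em_q0.
  have [h|->//] := leq_case (ltn_ord k).
  by rewrite sewn_Bq in hs.
Qed.

Lemma Phi_right_inert : inert (vmap (Phi_right r X)).
Proof. exact: carve_inert. Qed.

Lemma Phi_right_slide :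
  pointed_iso (@Pointed (@PMap (elt m) (dom m :\ c0) r2 n2 (@lab m)) (p 0) (q 0))
    (Phi_right r X).
Proof.
have hD x : (x \in dom m :\ c0) = (x != c0) && (x \in dom m) by rewrite !inE.
have pq0 k : k <= l -> p k != q 0 by move=> hk; apply: (sl_pq sl).
have qq0 k : k < l -> q k.+1 != q 0.
  by move=> hk; apply/eqP => /(sl_q sl hk (leq0n _)).
have em_p k : k <= l -> right_embed (p k) = iL (p k) by move=> hk; rewrite em_out ?pq0.
have em_q k : k < l -> right_embed (q k.+1) = iL (q k.+1).
  by move=> hk; rewrite em_out ?qq0.
have dp k : k <= l -> right_embed (p k) \in dom Sw.
  by move=> hk; rewrite em_dom ?(sl_Dp sl) ?(sl_pc0 sl).
have dq k : k <= l -> right_embed (q k) \in dom Sw.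
  by move=> hk; rewrite em_dom ?(sl_Dq sl) ?(sl_qc0 sl).
have rpl : @rev Sw (right_embed (p l)) = right_embed (q 0).
  by rewrite (revW (dp l (leqnn l))) em_p // revS_p // (negPf sewn_Bql) em_q0.
suff iso : @map_iso (@PMap (elt m) (dom m :\ c0) r2 n2 (@lab m)) Sw right_embed.
  exists right_embed => //; split.
    by rewrite /= right_r0E em_p //; apply: connect0.
  by rewrite -rpl em_p // -belastE.2.
split.
- move=> x y _ _; rewrite /right_embed; case: eqVneq => [->|hx]; case: eqVneq => [->|hy] //.
  + by case: (l) => [[] //|k //].
  + by case: (l) => [[] //|k //].
  + by case.
- apply/setP => z; apply/imsetP/idP => [[x]|/em_ex //].
  by rewrite hD => /andP [h1 h2] ->; apply: em_dom.
- move=> x; rewrite hD => /andP [h1 h2].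
  change (right_embed (r2 x) = @rev Sw (right_embed x)).
  have [k hk ->|[|k] hk ->|hp' hq'] := placeP l p q x.
  - have [hk'|->] := leq_case hk; last by rewrite (sl_r2pl sl) rpl.
    rewrite (sl_r2p sl hk') em_q // (revW (dp k hk)) em_p // revS_p // sewn_Bq //.
    by rewrite mate_Bq // revS_Bp.
  - rewrite -(sl_r2pl sl) (sl_r2K sl) (sl_r2pl sl) (revW (dq 0 isT)) em_q0 revS_Bq //.
    by rewrite (negPf (sewn_iL (pq0 _ _))) // em_p.
  - rewrite -(sl_r2p sl hk) (sl_r2K sl) (sl_r2p sl hk) (revW (dq k.+1 hk)) em_q //.
    rewrite (revS_q (isT : 0 < k.+1) hk) (sewn_Bp hk) (mate_Bp hk).
    by rewrite (revS_Bq (ltnW hk)) (em_p _ (ltnW hk)).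
  have hrq : @rev m x != q 0.
    apply: contraNneq (hp' 0 (leq0n l)) => E.
    by rewrite -(r1q (leq0n l)) -E; apply/eqP/esym/(sl_r1K sl).
  rewrite (sl_rE sl h1 hp' hq') (revW (em_dom h2 h1)) em_out // em_out ?hq' //.
  by rewrite revS_out // (negPf (sewn_iL hrq)).
- move=> x; rewrite hD => /andP [h1 h2].
  change (right_embed (n2 x) = @nxt Sw (right_embed x)).
  have nsq : nxt s != q 0.
    apply: contraNneq (sl_sc0 sl) => E; apply/eqP/(sl_n1 sl).
    by rewrite E (sl_n1c0 sl).
  have nSw : iL (nxt s) \in dom Sw by rewrite domW nS_dom sewn_iL.
  have [->|hxq] := eqVneq x (q 0).
    rewrite (sl_n2q sl) em_out // em_q0; apply/esym/nxtW; first by rewrite -em_q0 dq.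
    case El: (l) => [|k].
      have E : gW (Bq 0) = iL (nxt s).
        by rewrite /gW mate_out -?El // ?sewn_Bql // El -[Bq 0]/(Bp 0) nxtS_Bp // El.
      by rewrite -E; apply: first_after_now; rewrite E.
    (* [Bq l] is followed by [Bq (l - 1)], which disappears in the sewing; the contour carries on
       after its mate [Bp l], that is, at [nxt s]. *)
    have hk : k < l by rewrite El.
    have E1 : gW (Bq k.+1) = Bq k.
      by rewrite /gW mate_out -?El ?sewn_Bql // El nxtS_Bq.
    have E2 : gW (Bq k) = iL (nxt s) by rewrite /gW mate_Bq // nxtS_Bp // El ltnn.
    apply: first_after_next; rewrite E1; first by rewrite /= domW sewn_Bq // andbF.
    by rewrite -E2; apply: first_after_now; rewrite E2.
  have [->|hxs] := eqVneq x s.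
    rewrite (sl_n2s sl) em_q0 em_out ?(sl_sq sl) //; apply/esym/nxtW.
      by rewrite -em_out ?(sl_sq sl) // em_dom ?(sl_Ds sl) ?(sl_sc0 sl).
    have E : gW (iL s) = Bq l by rewrite /gW mate_out ?nxtS_s // sewn_iL // (sl_sq sl).
    by rewrite -E; apply: first_after_now; rewrite E -em_q0; apply: dq.
  have hnq : @nxt m x != q 0.
    by apply: contraNneq h1 => E; apply/eqP/(sl_n1 sl); rewrite E (sl_n1c0 sl).
  rewrite (sl_nE sl) // !em_out //; apply/esym/nxtW; first by rewrite -em_out // em_dom.
  have E : gW (iL x) = iL (@nxt m x) by rewrite /gW mate_out ?sewn_iL // nxtS_iL.
  rewrite -E; apply: first_after_now; rewrite E -em_out //; apply: em_dom.
    by apply: contraTT h2 => h; have [_ /(sl_n1 sl) <-] := sl_out sl h.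
  exact: n1_c0.
- move=> x; rewrite hD /= => /andP [h1 h2].
  rewrite /right_embed; case: eqVneq => [->|//].
  by rewrite hlab; case: (l) => [|k] //=; rewrite hlab.
Qed.

End PhiRight.

(** * Slitting and sewing along a leftmost geodesic *)

Section PhiLeft.
Variables (r : nat) (m : pmap) (v h s : elt m) (r1 n1 : option (elt m) -> option (elt m)).
Variables (l : nat) (p q : nat -> elt m).
Let Y := @Pointed m v h.
(** The mark of the face to be created has no counterpart in [m]; it is the additional element
    [None]. *)
Let U : finType := option (elt m).
Let D1 : {set U} := [set z : U | if z is Some x then x \in dom m else true].
Let D2 : {set U} := [set z : U | if z is Some x then x \in dom m else false].
Let mc : U -> option nat := fun z => if z is Some x then lab x else Some r.
Hypothesis sl : slid D1 D2 r1 n1 (omap (@rev m)) (omap (@nxt m)) l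
  (fun k => Some (p k)) (fun k => Some (q k)) (Some s) None.
Hypotheses (hs : finv (@nxt m) h = s) (hq0 : q 0 = h) (hlab : lab h = None).
Hypothesis hpath : left_path Y =
  mkseq (fun k => Some (if k is k'.+1 then q (l - k') else q 0)) l.+1.
Let M := left_m1 Y.
Let T : finType := elt M.
Let Sl := left_slit Y.

Let sI (A : Type) (x y : A) : Some x = Some y -> x = y. Proof. by case. Qed.
Let revK : involutive (@rev m).
Proof. by move=> x; apply: (sI (sl_r2K sl (Some x))). Qed.
Let nxt_inj : injective (@nxt m).
Proof. by move=> x y E; apply: sI; apply: (sl_n2 sl); rewrite /= E. Qed.
Let rev_p k : k < l -> rev (p k) = q k.+1.
Proof. by move=> hk; apply: (sI (sl_r2p sl hk)). Qed.
Let rev_pl : rev (p l) = q 0. Proof. exact: (sI (sl_r2pl sl)). Qed.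
Let rev_q k : k < l -> rev (q k.+1) = p k.
Proof. by move=> hk; rewrite -rev_p // revK. Qed.
Let rev_q0 : rev (q 0) = p l. Proof. by rewrite -rev_pl revK. Qed.
Let nxt_s : nxt s = q 0. Proof. exact: (sI (sl_n2s sl)). Qed.
Let p_inj i j : i <= l -> j <= l -> p i = p j -> i = j.
Proof. by move=> hi hj E; apply: (sl_p sl hi hj); rewrite E. Qed.
Let q_inj i j : i <= l -> j <= l -> q i = q j -> i = j.
Proof. by move=> hi hj E; apply: (sl_q sl hi hj); rewrite E. Qed.
Let pq i j : i <= l -> j <= l -> p i != q j.
Proof. by move=> hi hj; apply: contraNneq (sl_pq sl hi hj) => ->. Qed.
Let sq : s != q 0. Proof. by apply: contraNneq (sl_sq sl) => ->. Qed.
Let Dp k : k <= l -> p k \in dom m.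
Proof. by move=> hk; have := sl_Dp sl hk; rewrite inE. Qed.
Let Dq k : k <= l -> q k \in dom m.
Proof. by move=> hk; have := sl_Dq sl hk; rewrite inE. Qed.
Let Ds : s \in dom m. Proof. by have := sl_Ds sl; rewrite inE. Qed.
Let out x : x \notin dom m -> nxt x = x.
Proof.
move=> hx; have hx1 : Some x \notin D1 by rewrite inE.
have [_ E] := sl_out sl hx1; apply: sI; rewrite -[RHS]E -(sl_nE sl) //.
- by apply/eqP => -[E']; rewrite E' Dq in hx.
- by apply/eqP => -[E']; rewrite E' Ds in hx.
Qed.
Let nxt_dom x : x \in dom m -> nxt x \in dom m.
Proof. by apply: contraTT => hx; rewrite -(nxt_inj (out hx)). Qed.
Let nxt_h x : x != s -> nxt x != q 0.
Proof. by apply: contra_neq; rewrite -nxt_s => /nxt_inj. Qed.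

Let w (k : nat) : elt m := if k is k'.+1 then q (l - k') else q 0.

Lemma mem_left_path x : (x \in left_path Y) = [exists k : 'I_l.+1, x == Some (q k)].
Proof.
rewrite hpath; apply/mapP/existsP => [[k]|[k /eqP ->]].
  rewrite mem_iota => hk ->; case: k hk => [|k] hk; first by exists ord0.
  have hk' : l - k < l.+1 by rewrite ltnS leq_subr.
  by exists (Ordinal hk').
case: k => [[|k] hk]; first by exists 0.
exists (l - k.+1).+1; first by rewrite mem_iota /= subnSK // add0n ltnS leq_subr.
by rewrite subKn.
Qed.

Let dbl (x : T) : bool := (x \in left_path Y) || (rev x \in left_path Y).

Let dbl_q k : k <= l -> dbl (Some (q k)).
Proof.
move=> hk; apply/orP; left; rewrite mem_left_path.
by apply/existsP; exists (Ordinal (hk : k < l.+1)).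
Qed.
Let dbl_p k : k <= l -> dbl (Some (p k)).
Proof.
move=> hk; apply/orP; right; rewrite mem_left_path; apply/existsP.
have [hk'|->] := leq_case hk.
  by exists (Ordinal (hk' : k.+1 < l.+1)); rewrite /= rev_p.
by exists ord0; rewrite /= rev_pl.
Qed.
Let dbl_out x : (forall k, k <= l -> x != p k) -> (forall k, k <= l -> x != q k) ->
  ~~ dbl (Some x).
Proof.
move=> h1 h2; rewrite /dbl !mem_left_path; apply/negP => /orP [] /existsP [k /eqP []].
  by move=> E; have := h2 k (ltn_ord k); rewrite E eqxx.
move=> E; have Ex : x = rev (q k) by rewrite -E revK.
case: k {E} Ex => [[|k] hk] Ex.
  by have := h1 l (leqnn l); rewrite Ex rev_q0 eqxx.
by have := h1 k (ltnW hk); rewrite Ex rev_q // eqxx.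
Qed.
Let dblP x : dbl (Some x) -> (exists2 k, k <= l & x = p k) \/ (exists2 k, k <= l & x = q k).
Proof.
move=> hd; have [k hk ->|k hk ->|h1 h2] := placeP l p q x.
- by left; exists k.
- by right; exists k.
- by have := dbl_out h1 h2; rewrite hd.
Qed.
Let dblN : ~~ dbl None.
Proof. by rewrite /dbl /= orbb mem_left_path; apply/existsP => -[]. Qed.

Let iL (x : elt m) : elt Sl := inl (Some x).
(** Renumbers [q 0] as [l.+1], so that [rev (p k) = qq k.+1] holds for every [k <= l] without
    exception. *)
Let qq (j : nat) : elt m := if j == l.+1 then q 0 else q j.
Let Q (j : nat) : elt Sl := inr (Some (qq j)).
Let Bp (k : nat) : elt Sl := inr (Some (p k)).

Let qqE j : j <= l -> qq j = q j.
Proof. by rewrite /qq; case: eqP => // -> ; rewrite ltnn. Qed.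
Let qql : qq l.+1 = q 0. Proof. by rewrite /qq eqxx. Qed.
Let rev_pqq k : k <= l -> rev (p k) = qq k.+1.
Proof.
by move=> /leq_case [hk|->]; [rewrite qqE // rev_p|rewrite qql rev_pl].
Qed.
Let rev_qq k : k <= l -> rev (qq k.+1) = p k.
Proof. by move=> hk; rewrite -rev_pqq // revK. Qed.
Let qq_ex j : 0 < j -> j <= l.+1 -> exists2 k, k <= l & qq j = q k.
Proof.
move=> h0 /leq_case [hj|->]; last by exists 0; rewrite ?qql.
by exists j; rewrite ?qqE.
Qed.

Let iL_dom x : (iL x \in dom Sl) = (x \in dom m).
Proof. by rewrite inE /iL [Some x \in _]inE /= !andbT. Qed.
Let inr_dom (x : T) : (inr x \in dom Sl) = dbl x.
Proof. by rewrite inE. Qed.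
Let Q_dom j : 0 < j -> j <= l.+1 -> Q j \in dom Sl.
Proof. by move=> h0 hj; have [k hk E] := qq_ex h0 hj; rewrite /Q E inr_dom dbl_q. Qed.
Let Bp_dom k : k <= l -> Bp k \in dom Sl.
Proof. by move=> hk; rewrite inr_dom dbl_p. Qed.

Let revS_p k : k <= l -> rev (iL (p k)) = Q k.+1.
Proof.
move=> hk; have hd : iL (p k) \in dom Sl by rewrite iL_dom Dp.
by rewrite [LHS](carve_rev _ _ _ hd) /= -/(dbl _) dbl_p // rev_pqq.
Qed.
Let revS_Q k : k <= l -> rev (Q k.+1) = iL (p k).
Proof.
move=> hk; have hd := Q_dom (ltn0Sn k) (hk : k.+1 <= l.+1).
by rewrite [LHS](carve_rev _ _ _ hd) /= rev_qq.
Qed.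
Let revS_qq k : k <= l -> rev (iL (qq k.+1)) = Bp k.
Proof.
move=> hk; have [j hj E] := qq_ex (ltn0Sn k) (hk : k.+1 <= l.+1).
have hd : iL (qq k.+1) \in dom Sl by rewrite E iL_dom Dq.
by rewrite [LHS](carve_rev _ _ _ hd) /= -/(dbl _) {1}E dbl_q // rev_qq.
Qed.
Let revS_Bp k : k <= l -> rev (Bp k) = iL (qq k.+1).
Proof.
move=> hk; have hd := Bp_dom hk.
by rewrite [LHS](carve_rev _ _ _ hd) /= rev_pqq.
Qed.
Let revS_out x : x \in dom m -> (forall k, k <= l -> x != p k) ->
  (forall k, k <= l -> x != q k) -> rev (iL x) = iL (rev x).
Proof.
move=> h1 h3 h4; have hd : iL x \in dom Sl by rewrite iL_dom.
by rewrite [LHS](carve_rev _ _ _ hd) /= -/(dbl _) (negPf (dbl_out _ _)).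
Qed.

(* The border of the slit, starting from its corner. *)
Let u (k : nat) : (T + T)%type :=
  if k is k'.+1 then
    if k' <= l then Q (l.+1 - k') else Bp (k' - l.+1)
  else inl None.

Let u_inj : {in gtn (l.+1 + l.+1).+1 &, injective u}.
Proof.
have Qp j k : 0 < j -> j <= l.+1 -> k <= l -> Q j <> Bp k.
  move=> h0 hj hk []; have [i hi ->] := qq_ex h0 hj => E.
  by have := pq hk hi; rewrite E eqxx.
have Qi i j : i <= l -> j <= l -> Q (l.+1 - i) = Q (l.+1 - j) -> i = j.
  have qe k : k <= l -> qq (l.+1 - k) = if k is 0 then q 0 else q (l.+1 - k).
    by case: k => [|k] hk; rewrite ?subn0 ?qql // qqE // subSS leq_subr.
  move=> hi hj [] ; rewrite !qe //; clear -hi hj q_inj; case: i hi => [|i] hi.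
    by case: j hj => // j hj /(q_inj (leq0n _)) E; have := E _; lia.
  by case: j hj => [|j] hj E; have := q_inj _ _ E; lia.
move=> [|i] [|j]; rewrite !unfold_in //= => hi hj.
- by case: ifP.
- by case: ifP.
case: (leqP i l) => hil; case: (leqP j l) => hjl E.
- by rewrite (Qi i j).
- by have [] := Qp (l.+1 - i) (j - l.+1); rewrite ?E //; clear -hil hj; lia.
- by have [] := Qp (l.+1 - j) (i - l.+1); rewrite ?E //; clear -hjl hi; lia.
- by case: E => E; have := p_inj _ _ E; clear -hi hj hil hjl; lia.
Qed.

Let g0 (z : (T + T)%type) : (T + T)%type := if z is inl x then inl (nxt x) else z.
Let g := thread (u 0) (mkseq (fun i => u i.+1) (l.+1 + l.+1)) (inl (Some (q 0))) g0.
Let gS : T + T -> T + T :=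
  thread (inl (left_h0 Y)) ([seq inr x | x <- left_path Y] ++
      [seq inr (rev x) | x <- seq.rev (left_path Y)]) (inl (nxt (left_h0 Y))) g0.

Let gSE : gS = g.
Proof.
rewrite /gS /g hpath; congr (thread _ _ _ _); last by rewrite /= hs nxt_s.
rewrite /mkseq iotaD map_cat add0n; congr (_ ++ _).
  rewrite -map_comp; apply/eq_in_map => k; rewrite mem_iota => hk /=.
  rewrite ifT; last by clear -hk; lia.
  congr (inr (Some _)); case: k hk => [|k] hk; first by rewrite subn0 qql.
  by rewrite subSS qqE // leq_subr.
apply: (@eq_from_nth _ (inl None)); rewrite !size_map ?size_rev ?size_map ?size_iota // => i hi.
rewrite (nth_map None) ?size_rev ?size_map ?size_iota // nth_rev ?size_map ?size_iota //.
rewrite (nth_map 0) ?size_iota; last by clear -hi; lia.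
rewrite (nth_map 0) ?size_iota // !nth_iota //; last by clear -hi; lia.
rewrite add0n /= ifF; last by clear; lia.
have -> : l.+1 + i - l.+1 = i by clear; lia.
congr (inr (Some _)); rewrite -[RHS]rev_qq //; congr rev.
have -> : l.+1 - i.+1 = l - i by clear; lia.
case E: (l - i) => [|k].
  by rewrite (_ : i = l) ?qql //; clear -hi E; lia.
by rewrite qqE; [congr q|]; clear -hi E; lia.
Qed.

Let g_u k : k <= l.+1 + l.+1 ->
  g (u k) = if k < l.+1 + l.+1 then u k.+1 else inl (Some (q 0)).
Proof. exact: thread_mkseq u_inj. Qed.

Let u_Q j : 0 < j -> j <= l.+1 -> u (l.+2 - j) = Q j.
Proof.
move=> h0 hj; have -> : l.+2 - j = (l.+1 - j).+1 by clear -hj; lia.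
by rewrite /= ifT ?subKn //; clear -h0 hj; lia.
Qed.
Let u_Bp k : k <= l -> u (l.+2 + k) = Bp k.
Proof.
move=> hk; rewrite addSn /= ifF; last by clear; lia.
by congr Bp; clear; lia.
Qed.

Let g_iL x : g (iL x) = if x == s then inl None else iL (nxt x).
Proof.
rewrite /g thread_out //=; first by rewrite hs; case: eqP.
by apply/mapP => -[i _]; rewrite /=; case: ifP.
Qed.

Let nxtS z y : z \in dom Sl -> first_after g (mem (dom Sl)) z y -> nxt z = y.
Proof. by rewrite -gSE; apply: carve_nxt. Qed.

Let nxtS1 z : z \in dom Sl -> g z \in dom Sl -> nxt z = g z.
Proof. by move=> h1 h2; apply: nxtS => //; apply: first_after_now. Qed.

Let c_out : (inl None : elt Sl) \notin dom Sl.
Proof. by rewrite inE /left_h0 eqxx !andbF. Qed.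

Let nxtS_iL x : x \in dom m -> x != s -> nxt (iL x) = iL (nxt x).
Proof.
move=> h1 h2; have E : g (iL x) = iL (nxt x) by rewrite g_iL (negPf h2).
by rewrite nxtS1 ?E ?iL_dom ?nxt_dom.
Qed.

Let nxtS_s : nxt (iL s) = Q l.+1.
Proof.
apply: nxtS; first by rewrite iL_dom.
have E : g (iL s) = inl None by rewrite g_iL eqxx.
apply: first_after_next; rewrite E //.
have E2 : g (u 0) = Q l.+1 by rewrite g_u //= subn0.
by rewrite -E2; apply: first_after_now; rewrite [g _]E2; apply: Q_dom.
Qed.

Let nxtS_Q j : 0 < j -> j <= l -> nxt (Q j.+1) = Q j.
Proof.
move=> h0 hj; have E : g (Q j.+1) = Q j.
  rewrite -(u_Q (ltn0Sn j) hj) -(u_Q h0 (leqW hj)) g_u; last by clear -hj; lia.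
  rewrite ifT; last by clear -hj h0; lia.
  by congr u; clear -hj; lia.
by rewrite -E; apply: nxtS1; rewrite ?E Q_dom // leqW.
Qed.

Let nxtS_Q1 : nxt (Q 1) = Bp 0.
Proof.
have E : g (Q 1) = Bp 0.
  rewrite -(u_Q (ltn0Sn 0) (ltn0Sn l)) -(u_Bp (leq0n l)) g_u; last by clear; lia.
  rewrite ifT; last by clear; lia.
  by congr u; clear; lia.
by rewrite -E; apply: nxtS1; rewrite ?E ?Q_dom ?Bp_dom.
Qed.

Let nxtS_Bpl : nxt (Bp l) = iL (q 0).
Proof.
have E : g (Bp l) = iL (q 0).
  rewrite -(u_Bp (leqnn l)) g_u; last by clear; lia.
  by rewrite ifF //; clear; lia.
by rewrite -E; apply: nxtS1; rewrite ?E ?Bp_dom ?iL_dom ?Dq.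
Qed.

Let left_lE : left_l Y = mkseq (fun k => iL (w k)) l.+1.
Proof. by rewrite /left_l hpath /mkseq -map_comp. Qed.
Let left_rE : left_r Y = mkseq (fun k => Q (l.+1 - k)) l.+1.
Proof.
rewrite /left_r hpath /mkseq -map_comp; apply/eq_in_map => k.
rewrite mem_iota => hk /=; congr (inr (Some _)); case: k hk => [|k] hk.
  by rewrite subn0 qql.
by rewrite subSS qqE // leq_subr.
Qed.
Let left_l1E : left_l1 Y = iL (q 0).
Proof. by rewrite /left_l1 left_lE. Qed.
Let left_r1E : left_r1 Y = Q l.+1.
Proof. by rewrite /left_r1 left_rE /= subn0. Qed.

Let sideL : map (@rev Sl) (behead (left_l Y)) = mkseq (fun k => Bp (l - k.+1)) l.
Proof.
rewrite left_lE -(mkseq_cons (fun k => iL (w k))) /= /mkseq -map_comp.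
apply/eq_in_map => k; rewrite mem_iota => hk /=.
rewrite -revS_qq; last exact: leq_subr.
congr (rev (iL _)); rewrite qqE; last by clear -hk; lia.
by congr q; clear -hk; lia.
Qed.
Let sideR : belast (left_r1 Y) (behead (left_r Y)) = mkseq (fun k => Q (l.+1 - k)) l /\
  last (left_r1 Y) (left_r Y) = Q 1.
Proof.
rewrite left_r1E left_rE -(mkseq_cons (fun k => Q (l.+1 - k))) subn0 /=.
set t := mkseq _ _; have := lastI (Q l.+1) t; rewrite /t.
have E : Q l.+1 = (fun k => Q (l.+1 - k)) 0 by rewrite subn0.
rewrite {1}E (mkseq_cons (fun k => Q (l.+1 - k))) mkseq_rcons => /rcons_inj [<- <-].
by split=> //; congr Q; clear; lia.
Qed.

Let LL := mkseq (fun k => Bp (l - k.+1)) l.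
Let RR := mkseq (fun k => Q (l.+1 - k)) l.
Let sewn z := (z \in LL) || (z \in RR).
Let mate z := if z \in LL then nth z RR (index z LL)
  else if z \in RR then nth z LL (index z RR) else z.
Let Sw := left_sewn Y.

Let Q_inj i j : 0 < i -> i <= l.+1 -> 0 < j -> j <= l.+1 -> Q i = Q j -> i = j.
Proof.
move=> hi hi' hj hj' E; have E2 : u (l.+2 - i) = u (l.+2 - j) by rewrite !u_Q.
have := u_inj _ _ E2; rewrite !unfold_in /=; clear -hi hi' hj hj'; lia.
Qed.
Let Bp_inj i j : i <= l -> j <= l -> Bp i = Bp j -> i = j.
Proof. by move=> hi hj []; apply: p_inj. Qed.
Let QBp j k : 0 < j -> j <= l.+1 -> k <= l -> Q j != Bp k.
Proof.
move=> h0 hj hk; have [i hi E] := qq_ex h0 hj; apply/eqP => -[]; rewrite E => E2.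
by have := pq hk hi; rewrite E2 eqxx.
Qed.

Let uniqLL : uniq LL.
Proof.
apply/mkseq_uniqP => i j; rewrite !unfold_in /= => hi hj /Bp_inj E.
have := E (leq_subr _ _) (leq_subr _ _); clear -hi hj; lia.
Qed.
Let uniqRR : uniq RR.
Proof.
apply/mkseq_uniqP => i j; rewrite !unfold_in /= => hi hj /Q_inj E.
suff : l.+1 - i = l.+1 - j by clear -hi hj; lia.
apply: E; clear -hi hj; lia.
Qed.
Let nthLL k : k < l -> nth (Q 1) LL (l - k.+1) = Bp k.
Proof.
move=> hk; have h' : l - k.+1 < l by clear -hk; lia.
by rewrite nth_mkseq //; congr Bp; clear -hk; lia.
Qed.
Let nthRR k : k < l -> nth (Q 1) RR (l - k.+1) = Q k.+2.
Proof.
move=> hk; have h' : l - k.+1 < l by clear -hk; lia.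
by rewrite nth_mkseq //; congr Q; clear -hk; lia.
Qed.
Let szLL : size LL = l. Proof. exact: size_mkseq. Qed.
Let szRR : size RR = l. Proof. exact: size_mkseq. Qed.
Let sub_lt k : k < l -> l - k.+1 < l. Proof. by clear; lia. Qed.
Let in_LL k : k < l -> Bp k \in LL.
Proof. by move=> hk; rewrite -nthLL // mem_nth // szLL sub_lt. Qed.
Let in_RR k : k < l -> Q k.+2 \in RR.
Proof. by move=> hk; rewrite -nthRR // mem_nth // szRR sub_lt. Qed.
Let Q_notin_LL j : 0 < j -> j <= l.+1 -> Q j \notin LL.
Proof.
move=> h0 hj; apply/mapP => -[i _] /eqP; rewrite (negPf (QBp h0 hj _)) //.
exact: leq_subr.
Qed.
Let Bp_notin_RR k : k <= l -> Bp k \notin RR.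
Proof.
move=> hk; apply/mapP => -[i]; rewrite mem_iota => hi /eqP.
by rewrite eq_sym (negPf (QBp _ _ hk)) //; clear -hi; lia.
Qed.
(** [Bp k] and [Q k.+1] are the two sides of one slit edge; sewing with a shift of one step makes
    [Bp k] face [Q k.+2] instead. *)
Let mate_Bp k : k < l -> mate (Bp k) = Q k.+2.
Proof.
move=> hk; rewrite /mate in_LL //.
have -> : index (Bp k) LL = l - k.+1 by rewrite -nthLL // index_uniq // szLL sub_lt.
by rewrite (set_nth_default (Q 1)) ?nthRR // szRR sub_lt.
Qed.
Let mate_Q k : k < l -> mate (Q k.+2) = Bp k.
Proof.
move=> hk; rewrite /mate (negPf (Q_notin_LL _ _)) // in_RR //.
have -> : index (Q k.+2) RR = l - k.+1 by rewrite -nthRR // index_uniq // szRR sub_lt.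
by rewrite (set_nth_default (Q 1)) ?nthLL // szLL sub_lt.
Qed.
Let mate_out z : ~~ sewn z -> mate z = z.
Proof. by rewrite /sewn negb_or /mate => /andP [/negPf -> /negPf ->]. Qed.
Let sewn_Bp k : k < l -> sewn (Bp k).
Proof. by move=> hk; rewrite /sewn in_LL. Qed.
Let sewn_Q k : k < l -> sewn (Q k.+2).
Proof. by move=> hk; rewrite /sewn in_RR // orbT. Qed.
Let sewn_Bpl : ~~ sewn (Bp l).
Proof.
apply/norP; split; last exact: Bp_notin_RR.
apply/mapP => -[k]; rewrite mem_iota => hk /Bp_inj E.
have := E (leqnn l) (leq_subr _ _); clear -hk; lia.
Qed.
Let sewn_Q1 : ~~ sewn (Q 1).
Proof.
apply/norP; split; first exact: Q_notin_LL.
apply/mapP => -[k]; rewrite mem_iota => hk /Q_inj E.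
suff : 1 = l.+1 - k by clear -hk; lia.
apply: E; clear -hk; lia.
Qed.
Let sewn_iL x : ~~ sewn (iL x).
Proof. by apply/norP; split; apply/mapP => -[k]. Qed.

Let domW z : (z \in dom Sw) = (z \in dom Sl) && ~~ sewn z.
Proof. by rewrite [LHS]inE sideR.1 sideL. Qed.

Let revW z : z \in dom Sw ->
  @rev Sw z = if sewn (@rev Sl z) then @rev Sl (mate (@rev Sl z)) else @rev Sl z.
Proof.
move=> hz; rewrite [LHS](carve_rev _ _ _ hz).
by rewrite sideR.1 sideL.
Qed.

Let revl1 : @rev Sl (left_l1 Y) = Bp l.
Proof. by rewrite left_l1E -qql revS_qq. Qed.

Let gW z := tperm (Q l.+1) (Bp l) (@nxt Sl (mate z)).
Let nxtW z y : z \in dom Sw -> first_after gW (mem (dom Sw)) z y -> @nxt Sw z = y.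
Proof.
move=> hz h1; apply: carve_nxt => //; rewrite sideR.1 sideL revl1 left_r1E.
case: h1 => n [-> h1 h2]; exists n; split=> [||i hi] //.
- by rewrite /= inE -/(sewn _) -domW.
- by apply: contra (h2 i hi); rewrite /= inE -/(sewn _) -domW.
Qed.

Let tp_iL x : tperm (Q l.+1) (Bp l) (iL x) = iL x.
Proof. by rewrite tpermD. Qed.

Let dW_iL x : (iL x \in dom Sw) = (x \in dom m).
Proof. by rewrite domW sewn_iL andbT iL_dom. Qed.
Let dW_Bpl : Bp l \in dom Sw. Proof. by rewrite domW sewn_Bpl Bp_dom. Qed.
Let dW_Q1 : Q 1 \in dom Sw. Proof. by rewrite domW sewn_Q1 Q_dom. Qed.

Let nxtW_iL x : x \in dom m -> x != s -> @nxt Sw (iL x) = iL (nxt x).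
Proof.
move=> h1 h2; apply: nxtW; first by rewrite dW_iL.
have E : gW (iL x) = iL (nxt x) by rewrite /gW mate_out ?sewn_iL // nxtS_iL // tp_iL.
by rewrite -E; apply: first_after_now; rewrite E /= dW_iL nxt_dom.
Qed.
Let nxtW_s : @nxt Sw (iL s) = Bp l.
Proof.
apply: nxtW; first by rewrite dW_iL.
have E : gW (iL s) = Bp l by rewrite /gW mate_out ?sewn_iL // nxtS_s tpermL.
by rewrite -E; apply: first_after_now; rewrite E.
Qed.
Let nxtW_Bpl : @nxt Sw (Bp l) = iL (q 0).
Proof.
apply: nxtW => //; have E : gW (Bp l) = iL (q 0).
  by rewrite /gW mate_out // nxtS_Bpl tp_iL.
by rewrite -E; apply: first_after_now; rewrite E /= dW_iL Dq.
Qed.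
(** If [l = 0] nothing is sewn, and the transposition alone closes the loop on itself. Otherwise the
    contour reaches [Bp 0], carries on after its mate [Q 2], and is back at [Q 1]. *)
Let nxtW_Q1 : @nxt Sw (Q 1) = Q 1.
Proof.
apply: nxtW => //; have [l0|l0] := posnP l.
  have E : gW (Q 1) = Q 1.
    by rewrite /gW mate_out // nxtS_Q1 l0 tpermR.
  by rewrite -{2}E; apply: first_after_now; rewrite E.
have E1 : gW (Q 1) = Bp 0.
  rewrite /gW mate_out // nxtS_Q1 tpermD //; first exact: QBp.
  by apply/eqP => /(Bp_inj (leqnn l) (leq0n l)) E; rewrite E in l0.
have E2 : gW (Bp 0) = Q 1.
  rewrite /gW mate_Bp // nxtS_Q // tpermD //; last by rewrite eq_sym QBp.
  by apply/eqP => /Q_inj E; have := E isT (leqnn _) isT isT; clear -l0; lia.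
apply: first_after_next; rewrite E1; first by rewrite /= domW sewn_Bp // andbF.
by rewrite -E2; apply: first_after_now; rewrite E2.
Qed.

Let dW_ex z : z \in dom Sw -> [\/ exists2 x, x \in dom m & z = iL x, z = Bp l | z = Q 1].
Proof.
rewrite domW; case: z => [[x|]|y] /andP [].
- by move=> h1 _; apply: Or31; exists x => //; rewrite -iL_dom.
- by rewrite (negPf c_out).
- rewrite inr_dom; case: y => [y|]; last by rewrite (negPf dblN).
  case/dblP=> -[k hk ->].
    by case: (leq_case hk) => [hk' |-> _]; [rewrite sewn_Bp|apply: Or32].
  case: k hk => [|[|k]] hk.
  + rewrite -qql -/(Q l.+1); have [l0 _|l0] := posnP l.
      by apply: Or33; rewrite l0.
    by rewrite -{1}(prednK l0) sewn_Q // prednK.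
  + by rewrite -qqE // => _; apply: Or33.
  + by rewrite -qqE // sewn_Q //; apply: ltnW.
Qed.

(** [Phi_left] designates its corner by an inverse of [nxt], which requires injectivity of the
    successor. The function [G] is an explicit left inverse on the domain. *)
Lemma left_sewn_nxt_inj : injective (@nxt Sw).
Proof.
have ou z : z \notin dom Sw -> @nxt Sw z = z by move=> /(@carve_inert _ _ _ _ _ z) [].
pose G (z : elt Sl) : elt Sl :=
  if z == Bp l then iL s else if z is inl (Some y) then
    if y == q 0 then Bp l else iL (finv (@nxt m) y) else z.
have iLB y : (iL y == Bp l) = false by [].
have GK z : z \in dom Sw -> G (@nxt Sw z) = z.
  case/dW_ex=> [[x hx ->]|->|->].
  - have [->|hxs] := eqVneq x s; first by rewrite nxtW_s /G eqxx.
    by rewrite nxtW_iL // /G iLB /iL /= (negPf (nxt_h hxs)) (finv_f nxt_inj).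
  - by rewrite nxtW_Bpl /G iLB /iL /= eqxx.
  - by rewrite nxtW_Q1 /G (negPf (QBp _ _ _)).
have clo z : z \in dom Sw -> @nxt Sw z \in dom Sw.
  case/dW_ex=> [[x hx ->]|->|->].
  - by have [->|hxs] := eqVneq x s; rewrite ?nxtW_s // nxtW_iL // dW_iL nxt_dom.
  - by rewrite nxtW_Bpl dW_iL Dq.
  - by rewrite nxtW_Q1.
move=> y z; have [hy|hy] := boolP (y \in dom Sw); have [hz|hz] := boolP (z \in dom Sw).
- by move=> E; rewrite -(GK y hy) E GK.
- by move=> E; have := clo y hy; rewrite E ou // (negPf hz).
- by move=> E; have := clo z hz; rewrite -E ou // (negPf hy).
- by rewrite !ou.
Qed.

Let revW_q0 : @rev Sw (iL (q 0)) = Bp l.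
Proof.
have hd : iL (q 0) \in dom Sw by rewrite dW_iL Dq.
by rewrite (revW hd) -qql revS_qq // (negPf sewn_Bpl).
Qed.
Let revW_q k : k < l -> @rev Sw (iL (q k.+1)) = iL (p k.+1).
Proof.
move=> hk; have hd : iL (q k.+1) \in dom Sw by rewrite dW_iL Dq.
rewrite (revW hd) -(qqE (hk : k.+1 <= l)) (revS_qq (ltnW hk)) (sewn_Bp hk).
by rewrite (mate_Bp hk) (revS_Q hk).
Qed.
Let revW_p k : k < l -> @rev Sw (iL (p k.+1)) = iL (q k.+1).
Proof.
move=> hk; have hd : iL (p k.+1) \in dom Sw by rewrite dW_iL Dp.
rewrite (revW hd) (revS_p hk) (sewn_Q hk) (mate_Q hk) (revS_Bp (ltnW hk)).
by rewrite qqE.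
Qed.
Let revW_p0 : @rev Sw (iL (p 0)) = Q 1.
Proof.
have hd : iL (p 0) \in dom Sw by rewrite dW_iL Dp.
by rewrite (revW hd) (revS_p (leq0n l)) (negPf sewn_Q1).
Qed.
Let revW_Q1 : @rev Sw (Q 1) = iL (p 0).
Proof. by rewrite (revW dW_Q1) (revS_Q (leq0n l)) (negPf (sewn_iL _)). Qed.
Let revW_out x : x \in dom m -> (forall k, k <= l -> x != p k) ->
  (forall k, k <= l -> x != q k) -> @rev Sw (iL x) = iL (rev x).
Proof.
move=> h1 h2 h3; have hd : iL x \in dom Sw by rewrite dW_iL.
by rewrite (revW hd) (revS_out h1 h2 h3) (negPf (sewn_iL _)).
Qed.

Let loopE : left_loop Y = Q 1. Proof. exact: sideR.2. Qed.
Let Mk := left_marked r Y.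
Let Fn := left_final r Y.
Let e : elt Mk := Some (iL (q 0)).
Let eE : left_dangling r Y = e. Proof. by rewrite /left_dangling left_l1E. Qed.
Let rev_e : @rev Mk e = Some (Bp l). Proof. by rewrite -revW_q0. Qed.

Let nxtM z : @nxt Mk (Some z) = if z == Q 1 then None else Some (@nxt Sw z).
Proof. by rewrite -loopE. Qed.
Let nxtM_N : @nxt Mk None = Some (Q 1).
Proof. by rewrite -[RHS](congr1 Some nxtW_Q1) -loopE. Qed.
Let nxtM_inj : injective (@nxt Mk).
Proof.
apply: (insert_inj left_sewn_nxt_inj nxtM).
by rewrite nxtM_N nxtW_Q1.
Qed.

Let nxtM_iL x : @nxt Mk (Some (iL x)) = Some (@nxt Sw (iL x)).
Proof. by rewrite nxtM. Qed.
Let nxtM_Bpl : @nxt Mk (Some (Bp l)) = e.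
Proof. by rewrite nxtM eq_sym (negPf (QBp _ _ _)) // nxtW_Bpl. Qed.

Let domF z : (z \in dom Fn) = [&& z != e, z != Some (Bp l) &
  if z is Some y then y \in dom Sw else true].
Proof. by rewrite [LHS]inE eE rev_e !inE negb_or andbA. Qed.

Let revF z : z \in dom Fn -> @rev Fn z = @rev Mk z.
Proof. exact: carve_rev. Qed.
Let nxtF z y : z \in dom Fn -> first_after (@nxt Mk) (mem (dom Fn)) z y -> @nxt Fn z = y.
Proof. exact: carve_nxt. Qed.

(** The left copy of [q 0] is the dangling edge, which gets deleted; the last right copy [Q 1],
    which borders the new face, takes the place of [q 0]. *)
Definition left_embed (z : U) : elt Fn :=
  if z is Some x then (if x == q 0 then Some (Q 1) else Some (iL x)) else None.

Let em_q0 : left_embed (Some (q 0)) = Some (Q 1). Proof. by rewrite /= eqxx. Qed.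
Let em_out x : x != q 0 -> left_embed (Some x) = Some (iL x).
Proof. by move=> /= /negPf ->. Qed.

Let dF_iL x : x != q 0 -> ((Some (iL x) : elt Fn) \in dom Fn) = (x \in dom m).
Proof.
move=> hx; rewrite domF dW_iL; have -> // : (Some (iL x) : elt Fn) != e.
by apply/eqP => -[E]; rewrite E eqxx in hx.
Qed.
Let dF_Q1 : (Some (Q 1) : elt Fn) \in dom Fn.
Proof.
rewrite domF dW_Q1 andbT; apply/andP; split; first by [].
apply/eqP => -[E]; have := QBp (ltn0Sn 0) (ltn0Sn l) (leqnn l).
by rewrite /Q E eqxx.
Qed.
Let dF_N : (None : elt Fn) \in dom Fn. Proof. by rewrite domF. Qed.
Let e_out : e \notin dom Fn. Proof. by rewrite domF eqxx. Qed.
Let Bpl_out : (Some (Bp l) : elt Fn) \notin dom Fn.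
Proof. by rewrite domF eqxx andbF. Qed.

Let em_dom z : z \in D1 -> left_embed z \in dom Fn.
Proof.
case: z => [x|] hz; last exact: dF_N.
have [->|hx] := eqVneq x (q 0); first by rewrite em_q0 dF_Q1.
by rewrite em_out // dF_iL //; move: hz; rewrite inE.
Qed.

Lemma left_marked_corner : finv (@nxt Mk) (@rev Mk (left_dangling r Y)) = Some (iL s).
Proof. by rewrite eE rev_e -nxtW_s -nxtM_iL (finv_f nxtM_inj). Qed.

Lemma Phi_left_inert : inert (cmap (Phi_left r Y)).
Proof. exact: carve_inert. Qed.

Lemma Phi_left_legit : [/\ nxt (left_loop Y) = left_loop Y,
  is_dart (left_dangling r Y) & cw (left_dangling r Y) = left_dangling r Y].
Proof.
split; first by rewrite loopE nxtW_Q1.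
- rewrite eE /is_dart rev_e; apply/andP; split; last by [].
  by rewrite inE /= dW_iL Dq.
- by rewrite eE /cw rev_e nxtM_Bpl.
Qed.

Lemma Phi_left_slide :
  cornered_iso (@Cornered (@PMap U D1 r1 n1 mc) (Some s)) (Phi_left r Y).
Proof.
suff iso : @map_iso (@PMap U D1 r1 n1 mc) Fn left_embed.
  exists left_embed => //; rewrite [LHS]em_out //; exact: (esym left_marked_corner).
have emo x z : z = Some x -> x != q 0 -> left_embed z = Some (iL x).
  by move=> -> ; apply: em_out.
have pq0 k : k <= l -> p k != q 0 by move=> hk; apply: pq.
have qq0 k : k < l -> q k.+1 != q 0.
  by move=> hk; apply/eqP => /(q_inj hk (leq0n _)).
have hsD : Some s \in D1 by rewrite inE Ds.
have hqD k : k <= l -> Some (q k) \in D1 by move=> hk; rewrite inE Dq.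
have hpD k : k <= l -> Some (p k) \in D1 by move=> hk; rewrite inE Dp.
have r1pE k : k <= l -> r1 (Some (p k)) = Some (q k) by apply: (sl_r1p sl).
have r1qE k : k <= l -> r1 (Some (q k)) = Some (p k).
  by move=> hk; rewrite -(r1pE k hk) (sl_r1K sl).
have em_inj : injective left_embed.
  move=> [x|] [y|]; rewrite /left_embed //; case: eqVneq => // hx.
  - by case: eqVneq => // ->; rewrite hx.
  - by case: eqVneq => // _ [->].
split.
- by move=> z z' _ _; apply: em_inj.
- apply/setP => z; apply/imsetP/idP => [[x hx ->]|]; first exact: em_dom.
  rewrite domF => /and3P [h1 h2]; case: z h1 h2 => [z|] h1 h2; last first.
    by move=> _; exists None; rewrite ?inE.
  case/dW_ex=> [[x hx Ez]|Ez|Ez]; rewrite Ez in h1 h2 *.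
  + exists (Some x); first by rewrite inE.
    by rewrite em_out //; apply: contraNneq h1 => ->.
  + by rewrite eqxx in h2.
  + by exists (Some (q 0)); rewrite ?em_q0 // hqD.
- move=> z hz; change (left_embed (r1 z) = @rev Fn (left_embed z)).
  rewrite (revF (em_dom hz)); case: z hz => [x|] hz; last first.
    by rewrite (sl_r1c0 sl).
  have [k hk E|k hk E|h1 h2] := placeP l p q x.
  + rewrite E (r1pE k hk) (em_out (pq0 k hk)); case: k hk E => [|k] hk E.
      by rewrite em_q0 -revW_p0.
    by rewrite em_out ?qq0 // -revW_p.
  + rewrite E (r1qE k hk) (em_out (pq0 k hk)); case: k hk E => [|k] hk E.
      by rewrite em_q0 -revW_Q1.
    by rewrite em_out ?qq0 // -revW_q.
  + have -> : r1 (Some x) = Some (rev x).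
      have h1' k : k <= l -> Some x != Some (p k).
        by move=> hk; apply/eqP => -[Ex]; have := h1 k hk; rewrite Ex eqxx.
      have h2' k : k <= l -> Some x != Some (q k).
        by move=> hk; apply/eqP => -[Ex]; have := h2 k hk; rewrite Ex eqxx.
      exact: (esym (sl_rE sl (isT : Some x != None) h1' h2')).
    have hr : rev x != q 0.
      by apply: contraNneq (h1 l (leqnn l)) => Ex; rewrite -rev_q0 -Ex revK.
    rewrite !em_out // -?revW_out ?h2 //; by move: hz; rewrite inE.
- move=> z hz; change (left_embed (n1 z) = @nxt Fn (left_embed z)).
  apply/esym/nxtF; first exact: em_dom.
  have nhq : nxt (q 0) != q 0 by apply: nxt_h; rewrite eq_sym.
  case: z hz => [x|] hz; last first.
    rewrite (sl_n1c0 sl) em_q0 -nxtM_N; apply: first_after_now.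
    by rewrite nxtM_N; apply: dF_Q1.
  have [Ex|hxq] := eqVneq x (q 0).
    have E : @nxt Mk (Some (Q 1)) = None by rewrite nxtM eqxx.
    rewrite Ex (sl_n1q sl) em_q0; rewrite -[left_embed None]E.
    by apply: first_after_now; rewrite E; apply: dF_N.
  have [Ex|hxs] := eqVneq x s.
    have -> : n1 (Some x) = Some (nxt (q 0)) by rewrite Ex -(sl_n2q sl).
    rewrite Ex !em_out //.
    have E1 : @nxt Mk (Some (iL s)) = Some (Bp l) by rewrite nxtM_iL nxtW_s.
    have hqs : q 0 != s by rewrite eq_sym.
    have E2 : @nxt Mk e = Some (iL (nxt (q 0))) by rewrite nxtM_iL nxtW_iL ?Dq.
    (* After [s] the contour meets the dangling edge in both directions, as [Bp l] and then [e];
       both are skipped. *)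
    apply: first_after_next; rewrite E1 //.
    apply: first_after_next; rewrite nxtM_Bpl //.
    rewrite -E2; apply: first_after_now; by rewrite E2 /= dF_iL // nxt_dom // Dq.
  have hxD : x \in dom m by move: hz; rewrite inE.
  have -> : n1 (Some x) = Some (nxt x).
    have h1 : Some x != Some (q 0) by apply/eqP => -[E]; rewrite E eqxx in hxq.
    have h2 : Some x != Some s by apply/eqP => -[E]; rewrite E eqxx in hxs.
    exact: (esym (sl_nE sl (isT : Some x != None) h1 h2)).
  have hn := nxt_h hxs; rewrite !em_out //.
  have E : @nxt Mk (Some (iL x)) = Some (iL (nxt x)) by rewrite nxtM_iL nxtW_iL.
  by rewrite -E; apply: first_after_now; rewrite E /= dF_iL // nxt_dom.
- move=> [x|] // hz; rewrite /left_embed; case: eqVneq => [->|//].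
  by rewrite hq0 /= hlab.
Qed.

End PhiLeft.

(** * Existence of slid maps *)

(** Serves as the new reversal: the edges of the path are paired anew, with [u k] facing [v k], and
    all others are kept. *)
Definition rematch (T : eqType) (u v : nat -> T) (n : nat) (f : T -> T) (z : T) : T :=
  if z \in mkseq u n then v (index z (mkseq u n))
  else if z \in mkseq v n then u (index z (mkseq v n)) else f z.

Section Rematch.
Variables (T : eqType) (u v : nat -> T) (n : nat) (f : T -> T).
Hypotheses (ui : forall i j, i < n -> j < n -> u i = u j -> i = j)
  (vi : forall i j, i < n -> j < n -> v i = v j -> i = j)
  (uv : forall i j, i < n -> j < n -> u i != v j).

Lemma index_mkseq (w : nat -> T) k :
  (forall i j, i < n -> j < n -> w i = w j -> i = j) -> k < n ->
  index (w k) (mkseq w n) = k.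
Proof.
move=> wi hk; have hu : uniq (mkseq w n).
  by apply/mkseq_uniqP => i j hi hj; apply: wi.
by rewrite -{1}(nth_mkseq (w 0) w hk) index_uniq // size_mkseq.
Qed.

Lemma mem_mkseq (w : nat -> T) k : k < n -> w k \in mkseq w n.
Proof. by move=> hk; apply: map_f; rewrite mem_iota. Qed.

Lemma rematch_l k : k < n -> rematch u v n f (u k) = v k.
Proof. by move=> hk; rewrite /rematch mem_mkseq // index_mkseq. Qed.

Lemma rematch_r k : k < n -> rematch u v n f (v k) = u k.
Proof.
move=> hk; rewrite /rematch ifF ?mem_mkseq ?index_mkseq //.
apply/mapP => -[i]; rewrite mem_iota => hi E.
by have := uv hi hk; rewrite E eqxx.
Qed.

Lemma rematch_out z : (forall k, k < n -> z != u k) -> (forall k, k < n -> z != v k) ->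
  rematch u v n f z = f z.
Proof.
move=> h1 h2; rewrite /rematch !ifF //; apply/mapP => -[i]; rewrite mem_iota => hi E.
  by have := h2 i hi; rewrite E eqxx.
by have := h1 i hi; rewrite E eqxx.
Qed.

Variant matched z : Prop :=
  | MatchedL k of k < n & z = u k
  | MatchedR k of k < n & z = v k
  | Unmatched of (forall k, k < n -> z != u k) & (forall k, k < n -> z != v k).

Lemma matchedP z : matched z.
Proof.
have [/existsP [k /eqP E]|] := boolP [exists k : 'I_n, z == u k].
  exact: (MatchedL (ltn_ord k) E).
rewrite negb_exists => /forallP hp.
have [/existsP [k /eqP E]|] := boolP [exists k : 'I_n, z == v k].
  exact: (MatchedR (ltn_ord k) E).
rewrite negb_exists => /forallP hq; apply: Unmatched => k hk.
  exact: (hp (Ordinal hk)).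
exact: (hq (Ordinal hk)).
Qed.

(** The last two hypotheses say that [f] exchanges the two families as sets, so that what lies
    outside them is stable under [f]. *)
Lemma rematchK : involutive f ->
  (forall k, k < n -> exists2 j, j < n & f (u k) = v j) ->
  (forall k, k < n -> exists2 j, j < n & f (v k) = u j) ->
  involutive (rematch u v n f).
Proof.
move=> fK fu fv z; case: (matchedP z) => [k hk ->|k hk ->|h1 h2].
- by rewrite rematch_l // rematch_r.
- by rewrite rematch_r // rematch_l.
- rewrite (rematch_out h1 h2) rematch_out ?fK // => k hk; apply/eqP => E.
    have [j hj E2] := fu k hk; have := h2 j hj; by rewrite -E2 -E fK eqxx.
  have [j hj E2] := fv k hk; have := h1 j hj; by rewrite -E2 -E fK eqxx.
Qed.

End Rematch.

(** Composed with the successor, a 3-cycle on [c0], [q 0] and [s] simultaneously detaches or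
    restores the mark [c0] and moves [q 0] from one contour to the other. *)
Definition cycle3 (T : eqType) (x y z w : T) : T :=
  if w == x then y else if w == y then z else if w == z then x else w.

Lemma cycle3_inj (T : eqType) (x y z : T) : x != y -> y != z -> x != z ->
  injective (cycle3 x y z).
Proof.
move=> xy yz xz; have h : cancel (cycle3 x y z) (cycle3 z y x).
  move=> w; rewrite /cycle3; have [->|hx] := eqVneq w x.
    by rewrite (negPf yz) eqxx.
  have [->|hy] := eqVneq w y; first by rewrite eqxx.
  have [->|hz] := eqVneq w z; first by rewrite (negPf xz) (negPf xy) eqxx.
  by rewrite (negPf hx) (negPf hy) (negPf hz).
exact: can_inj h.
Qed.

Lemma all_some (T : Type) (s : seq (option T)) : all isSome s -> exists t, s = map Some t.
Proof.
elim: s => [|[x|] s ih] //=; first by exists [::].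
by case/ih=> t ->; exists (x :: t).
Qed.

Lemma steered_darts (m : pmap) (g : elt m -> elt m) y h p : sound m ->
  steered g y h p -> all (@is_dart m) p.
Proof.
move=> hm; elim: p h => //= e p ih h [[n [_ hd _]] /ih ->].
by rewrite (directed_dart hm hd).
Qed.

Lemma eq_mkseq_lt (T : Type) (f g : nat -> T) n :
  (forall k, k < n -> f k = g k) -> mkseq f n = mkseq g n.
Proof. by move=> h; apply/eq_in_map => k; rewrite mem_iota => hk; apply: h. Qed.

(** Contours contain marks besides half-edges. Another mark on this contour would belong to two
    faces, or be a second mark of the same face; so only [c0] and the single half-edge remain. *)
Lemma monogon (a : seq nat) r (m : pmap) (c0 : elt m) : size a = r ->
  map_of_type (rcons a 1) m -> is_mark r c0 ->
  nxt (nxt c0) = c0 /\ is_dart (nxt c0).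
Proof.
move=> ha [pm t2 t3 t4 t5] hc; have sz : size (rcons a 1) = r.+1 by rewrite size_rcons ha.
have so := plane_sound pm; have [c0d /eqP hb] := andP hc.
have hlab : forall x : elt m, x \in dom m -> (rev x == x) = isSome (lab x) by case: pm.
have fself (x : elt m) i : is_mark i x -> in_face i x.
  move=> hx; rewrite /in_face (proj1 (andP hx)) /=; apply/existsP; exists x.
  by rewrite hx; apply: connect0.
have hrs : r < size (rcons a 1) by rewrite sz.
have [c1 [_ cu]] := t3 r hrs.
have cE x : is_mark r x -> x = c0 by move=> hx; rewrite -(cu x hx) (cu c0 hc).
have inr x : same_face c0 x -> in_face r x.
  move=> hx; rewrite /in_face; have -> /= : x \in dom m.
    by rewrite (fconnect_invariant (F := fun z => z \in dom m) (nxt_dom so) hx).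
  apply/existsP; exists c0; rewrite hc /= /same_face (fconnect_sym (nxt_inj so)).
  exact: hx.
have := t5 r hrs.
rewrite nth_rcons ha ltnn eqxx => /eqP/cards1P [d Ed].
have hd : is_dart d && in_face r d by have := set11 d; rewrite -Ed inE.
have dart_face x : same_face c0 x -> x != c0 -> x = d.
  move=> hx hxc; have hf := inr x hx; have hxd := proj1 (andP hf).
  have hdx : is_dart x.
    rewrite /is_dart hxd hlab //; case E: (lab x) => [i|] //=.
    have hm : is_mark i x by rewrite /is_mark hxd E eqxx.
    have [j [_ hj]] := t4 x hxd.
    have ir : i = r by rewrite -(hj i (fself x i hm)) (hj r hf).
    by rewrite (cE x) ?eqxx // -ir in hxc.
  by apply/set1P; rewrite -Ed inE hdx.
have cd : c0 != d.
  apply: contraTneq (proj1 (andP hd)) => <-.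
  by rewrite /is_dart hlab // hb andbF.
have dc : same_face c0 d.
  case/andP: hd => _ /andP [_ /existsP [y /andP [/cE ->]]].
  by rewrite /same_face (fconnect_sym (nxt_inj so)).
have e1 : nxt c0 != c0.
  apply: contraNneq cd => E; case/fconnect_iter_ex: dc => n ->.
  by elim: n => //= n /eqP <-; rewrite E.
have e2 : nxt c0 = d by apply: dart_face => //; apply: fconnect1.
split; last by rewrite e2; case/andP: hd.
apply/eqP; apply: contraT => h.
have : nxt (nxt c0) = d.
  by apply: dart_face => //; apply: connect_trans (fconnect1 _ _) (fconnect1 _ _).
by rewrite -[RHS]e2 => /(nxt_inj so) E; rewrite E eqxx in e1.
Qed.

(** Both constructions produce instances of this one relation. As it is functional in each direction
    up to isomorphism, compatibility with isomorphisms and mutual inversion follow together. *)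
Definition slid_related (r : nat) (X : cornered) (Y : pointed) : Prop :=
  exists (T : finType) (D1 D2 : {set T}) (r1 n1 r2 n2 : T -> T) (b : T -> option nat)
    (l : nat) (p q : nat -> T) (s c0 : T),
  [/\ slid_pair r D1 D2 r1 n1 r2 n2 b l p q s c0,
      cornered_iso (@Cornered (@PMap T D1 r1 n1 b) s) X,
      pointed_iso (@Pointed (@PMap T D2 r2 n2 b) (p 0) (q 0)) Y,
      sound (cmap X) & sound (vmap Y)].

Lemma pointed_iso_dom X Y : sound (vmap X) -> inert (vmap Y) ->
  vver X \in dom (vmap X) -> pointed_iso X Y -> vver Y \in dom (vmap Y).
Proof.
move=> hX hY hv [f hf [E _]]; have sY := iso_sound hX hf hY.
by rewrite -(same_vertex_dom sY E) (iso_dom hf).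
Qed.

Lemma slid_related_right r X Y X' Y' : slid_related r X Y -> slid_related r X' Y' ->
  cornered_iso X X' -> pointed_iso Y Y'.
Proof.
case=> T [D1 [D2 [r1 [n1 [r2 [n2 [b [l [p [q [s [c0 [sp iX iY sX sY]]]]]]]]]]]]].
case=> T' [D1' [D2' [r1' [n1' [r2' [n2' [b' [l' [p' [q' [s' [c0' [sp' iX' iY' sX' sY']]]]]]]]]]]]].
move=> iso; have s1 := sp_sound1 sp; have s2 := sp_sound2 sp.
have s1' := sp_sound1 sp'; have s2' := sp_sound2 sp'.
set M1 := @PMap T D1 r1 n1 b in iX s1.
set M2 := @PMap T D2 r2 n2 b in iY s2.
set M1' := @PMap T' D1' r1' n1' b' in iX' s1'.
set M2' := @PMap T' D2' r2' n2' b' in iY' s2'.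
have sC : sound (cmap (@Cornered M1 s)) by [].
have sC' : sound (cmap (@Cornered M1' s')) by [].
have sP : sound (vmap (@Pointed M2 (p 0) (q 0))) by [].
have sP' : sound (vmap (@Pointed M2' (p' 0) (q' 0))) by [].
have sl := sp_slid sp; have sl' := sp_slid sp'.
have p0 : p 0 \in D2 by rewrite (sl_D2 sl) !inE (sl_pc0 sl) ?(sl_Dp sl).
have q0 : q 0 \in D2 by rewrite (sl_D2 sl) !inE (sl_qc0 sl) ?(sl_Dq sl).
have p0' : p' 0 \in D2' by rewrite (sl_D2 sl') !inE (sl_pc0 sl') ?(sl_Dp sl').
have iX'' := cornered_iso_sym sC' (sl_Ds sl') iX'.
have [f hf fs] := cornered_iso_trans sC (cornered_iso_trans sC iX iso) iX''.
have P := slid_unique_right sp sp' hf fs.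
have dY := pointed_iso_dom sP (sound_out sY) p0 iY.
have iY2 := pointed_iso_sym sP (sound_out sY) p0 q0 dY iY.
have P2 := pointed_iso_trans sY (sound_out sP) (sound_out sP') dY p0 iY2 P.
exact: (pointed_iso_trans sY (sound_out sP') (sound_out sY') dY p0' P2 iY').
Qed.

Lemma slid_related_left r X Y X' Y' : slid_related r X Y -> slid_related r X' Y' ->
  pointed_iso Y Y' -> cornered_iso X X'.
Proof.
case=> T [D1 [D2 [r1 [n1 [r2 [n2 [b [l [p [q [s [c0 [sp iX iY sX sY]]]]]]]]]]]]].
case=> T' [D1' [D2' [r1' [n1' [r2' [n2' [b' [l' [p' [q' [s' [c0' [sp' iX' iY' sX' sY']]]]]]]]]]]]].
move=> iso; have s1 := sp_sound1 sp; have s2 := sp_sound2 sp.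
have s1' := sp_sound1 sp'; have s2' := sp_sound2 sp'.
set M1 := @PMap T D1 r1 n1 b in iX s1.
set M2 := @PMap T D2 r2 n2 b in iY s2.
set M1' := @PMap T' D1' r1' n1' b' in iX' s1'.
set M2' := @PMap T' D2' r2' n2' b' in iY' s2'.
have sC : sound (cmap (@Cornered M1 s)) by [].
have sC' : sound (cmap (@Cornered M1' s')) by [].
have sP : sound (vmap (@Pointed M2 (p 0) (q 0))) by [].
have sP' : sound (vmap (@Pointed M2' (p' 0) (q' 0))) by [].
have sl := sp_slid sp; have sl' := sp_slid sp'.
have p0 : p 0 \in D2 by rewrite (sl_D2 sl) !inE (sl_pc0 sl) ?(sl_Dp sl).
have p0' : p' 0 \in D2' by rewrite (sl_D2 sl') !inE (sl_pc0 sl') ?(sl_Dp sl').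
have q0' : q' 0 \in D2' by rewrite (sl_D2 sl') !inE (sl_qc0 sl') ?(sl_Dq sl').
have dY := pointed_iso_dom sP (sound_out sY) p0 iY.
have dY' := pointed_iso_dom sP' (sound_out sY') p0' iY'.
have iY2 := pointed_iso_sym sP' (sound_out sY') p0' q0' dY' iY'.
have P1 := pointed_iso_trans sP (sound_out sY) (sound_out sY') p0 dY iY iso.
have P2 := pointed_iso_trans sP (sound_out sY') (sound_out sP') p0 dY' P1 iY2.
have P := slid_unique_left sp sp' P2.
have iX2 := cornered_iso_sym sC (sl_Ds sl) iX.
exact: (cornered_iso_trans sX (cornered_iso_trans sX iX2 P) iX').
Qed.

(** * Realizing both constructions as slid maps *)

Lemma subn_ltF k l : k < l -> l - k.+1 = l -> False.
Proof. lia. Qed.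

Lemma subn_eql i j l : i < l -> j < l -> l - i = l - j -> i.+1 = j.+1.
Proof. lia. Qed.

Lemma subn_cross i j l : i < l -> j < l -> l - j = l - i.+1 -> l - i = l - j.+1 -> False.
Proof. lia. Qed.

(** The slid map is built on the carrier of the given map from the computed path; its properties are
    established there and then carried to [Phi_right r X] along [Phi_right_slide]. *)
Lemma Phi_right_related r a X : 0 < r -> size a = r -> calM a X ->
  [/\ right_legit r X, calMt a (Phi_right r X) & slid_related r X (Phi_right r X)].
Proof.
move=> hr ha; case: X => m s [hm hs]; rewrite [cmap _]/= [ccor _]/= in hm hs.
have pm : plane_map m by case: hm.
have so := plane_sound pm.
have hsd : s \in dom m by case/andP: hs.
have [c0 [hc cu]] : exists! x : elt m, is_mark r x.
  by case: hm => _ _ t3 _ _; apply: t3; rewrite size_rcons ha.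
have [nn hdart] := monogon ha hm hc; set e := nxt c0 in nn hdart *.
have [c0d /eqP hb] := andP hc.
have hlab : forall x : elt m, x \in dom m -> (rev x == x) = isSome (lab x) by case: pm.
have rc0 : rev c0 = c0 by apply/eqP; rewrite hlab // hb.
have e_c0 : e != c0 by apply: contraTneq hdart => ->; rewrite /is_dart rc0 eqxx andbF.
set X := Cornered s.
have hM : sound (right_m1 X) by apply: add_corner_sound.
have c0E : right_c0 r X = Some c0.
  rewrite /right_c0; case: pickP => [[x|]|/(_ (Some c0))].
  - by case/andP; rewrite inE /= => h1 h2; rewrite (cu x) // /is_mark h1.
  - by case/andP.
  - by rewrite /is_mark inE /= c0d hb eqxx.
have hN : None \in dom (right_m1 X) by rewrite inE.
have hC : Some c0 \in dom (right_m1 X) by rewrite inE.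
have geo : @steered (right_m1 X) (@ccw _) None (Some c0) (right_path r X).
  by rewrite /right_path c0E; apply: rightmost_steered.
have [ps hps] : exists ps, right_path r X = map Some ps.
  apply: all_some; apply: sub_all (steered_darts hM geo) => -[x|] //.
  by rewrite (@add_corner_dart m s None).
(* The reverse of the loop is put in front of the path as [p 0], so that [q 0] is the loop [e]
   itself. *)
pose l := size ps; pose p k := nth e (rev e :: ps) k; pose q k := rev (p k).
have hpath : right_path r X = mkseq (fun k => Some (p k.+1)) l.
  rewrite hps -[in LHS](mkseq_nth e ps) /mkseq -map_comp; exact: eq_map.
have legit : right_legit r X.
  split; rewrite c0E.
  - by rewrite /is_mark inE /= c0d hb eqxx.
  - exact: (steered_walk hM (ccw_same_vertex hM) geo).
  - exact: (steered_avoiding hM (ccw_same_vertex hM) hC geo).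
rewrite hpath in geo.
pose F z := @dist (right_m1 X) (Some z) None.
have geod := steered_mkseq_dist hM (ccw_same_vertex hM) hN hC geo.
have cwE x : @cw (right_m1 X) (Some x) = if x == rev s then None else Some (cw x).
  exact: (add_corner_cwS so).
(* The distinguished corner lies in [f_1], which differs from [f_(r+1)] because [r] is positive. *)
have s_ec0 : s != e /\ s != c0.
  case: hm => _ _ _ t4 _.
  have [j [_ hj]] := t4 s hsd; have j0 := hj 0 hs.
  have nr : ~~ in_face r s by apply/negP => /hj; rewrite j0 => E; rewrite -E in hr.
  have fr z : same_face z c0 -> z \in dom m -> in_face r z.
    by move=> h1 h2; rewrite /in_face h2; apply/existsP; exists c0; rewrite hc.
  split; apply: contraNneq nr => ->; apply: fr => //; last exact: connect0.
    by rewrite /same_face -nn; apply: fconnect1.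
  exact: (dart_dom hdart).
have [s_e s_c0] := s_ec0.
have Fc0 : F c0 = l by have := geod 0 isT; rewrite /= rc0 subn0.
have Fq0 : F (q 0) = l.
  rewrite -Fc0 /F -[in RHS](dist_cw hM) cwE ifF.
    by rewrite /cw rc0 /q /p /= (revK so).
  apply/eqP => E; move: s_c0; rewrite -(revK so s) -E rc0 eqxx //.
have Fp0 : F (p 0) = l.
  rewrite -Fc0 /F -(dist_cw hM) cwE ifF; first by rewrite /cw /p /= (revK so) nn.
  by apply/eqP => /(rev_inj so) E; rewrite E eqxx in s_e.
have Fq k : k <= l -> F (q k) = l - k.
  case: k => [|k] hk; first by rewrite Fq0 subn0.
  exact: (geod k.+1 hk).
have geofa k : k < l -> F (p k.+1) = l - k /\ is_dart (p k.+1).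
  move=> hk; case/steered_mkseq: geo => /(_ k hk) fa _.
  have hv := first_after_vertex (ccw_same_vertex hM) fa.
  split; first by rewrite /F -(dist_l hM _ hv); apply: geod; apply: ltnW.
  case: fa => n [_ /(directed_dart hM) + _].
  by rewrite (@add_corner_dart m s None).
have Fp k : k < l -> F (p k.+1) = l - k by case/geofa.
have pdart k : k <= l -> is_dart (p k).
  by case: k => [|k] hk; [rewrite /p /= (dart_rev so)|case: (geofa k hk)].
have rq k : rev (q k) = p k by rewrite /q (revK so).
have qdart k : k <= l -> is_dart (q k) by move=> hk; rewrite (dart_rev so) pdart.
have p_inj i j : i <= l -> j <= l -> p i = p j -> i = j.
  (* Origins do not separate [p 0] from [p 1], which start at the same vertex; the distances of the
     ends do. *)
  have aux k : k < l -> p 0 <> p k.+1.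
    move=> hk E; have := Fp k hk; rewrite -E Fp0 => E2.
    by have := Fq k.+1 hk; rewrite /q -E -/(q 0) Fq0 => /esym /(subn_ltF hk).
  case: i j => [|i] [|j] // hi hj E; [by case: (aux j)|by case: (aux i)|].
  by have := Fp i hi; rewrite E Fp // => /(subn_eql hj hi) ->.
have q_inj i j : i <= l -> j <= l -> q i = q j -> i = j.
  by move=> hi hj /(rev_inj so); apply: p_inj.
have pq i j : i <= l -> j <= l -> p i != q j.
  move=> hi hj; apply/eqP => E; have E2 : q i = p j by rewrite /q E rq.
  case: i j hi hj E E2 => [|i] [|j] hi hj E E2.
  - by have := pdart 0 isT; rewrite /is_dart -[rev _]/(q 0) -E eqxx andbF.
  - by have := Fq j.+1 hj; rewrite -E Fp0 => /esym /(subn_ltF hj).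
  - by have := Fq i.+1 hi; rewrite E2 Fp0 => /esym /(subn_ltF hi).
  - have := Fq j.+1 hj; rewrite -E Fp //; have := Fq i.+1 hi; rewrite E2 Fp // => E4 E3; apply: (subn_cross hi hj E4 E3).
have pc0 i : i <= l -> p i != c0.
  by move=> /pdart; apply: contraTneq => ->; rewrite /is_dart rc0 eqxx andbF.
have qc0 i : i <= l -> q i != c0.
  by move=> /qdart; apply: contraTneq => ->; rewrite /is_dart rc0 eqxx andbF.
have q0e : q 0 = e by rewrite /q /p /= (revK so).
(* [v k] is the reverse of [p k] after the surgery. *)
pose v k := if k < l then q k.+1 else q 0.
have v_ex k : k < l.+1 -> exists2 j, j <= l & v k = q j.
  by move=> _; rewrite /v; case: (ltnP k l) => h; [exists k.+1|exists 0].
have q_ex k : k < l.+1 -> exists2 j, j < l.+1 & q k = v j.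
  case: k => [|k] hk; first by exists l; rewrite /v ?ltnn.
  by exists k; rewrite /v ?ifT //; apply: ltnW.
have v_inj i j : i < l.+1 -> j < l.+1 -> v i = v j -> i = j.
  move=> hi hj; rewrite /v; case: (ltnP i l) => h1; case: (ltnP j l) => h2 /q_inj E.
  - by have := E h1 h2; case.
  - by have := E h1 isT.
  - by have := E isT h2.
  - by apply/eqP; rewrite eqn_leq (leq_trans _ h2) // (leq_trans _ h1).
have pv i j : i < l.+1 -> j < l.+1 -> p i != v j.
  by move=> hi hj; have [k hk ->] := v_ex j hj; apply: pq.
pose r2 := rematch p v l.+1 (@rev m).
pose n2 z := nxt (cycle3 c0 e s z).
have sl : slid (dom m) (dom m :\ c0) (@rev m) (@nxt m) r2 n2 l p q s c0.
  split=> //.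
  - exact: (revK so).
  - apply: (@rematchK _ p v l.+1 _ p_inj v_inj pv (revK so)) => k hk; first exact: q_ex.
    by have [j hj ->] := v_ex k hk; exists j; rewrite ?rq.
  - exact: (nxt_inj so).
  - move=> x y /(nxt_inj so); apply: cycle3_inj; by rewrite // eq_sym.
  - move=> k hk; have hk' : k < l.+1 := ltnW hk.
    by rewrite /r2 (@rematch_l _ p v l.+1 _ p_inj) // /v hk.
  - by rewrite /r2 (@rematch_l _ p v l.+1 _ p_inj) // /v ltnn.
  - by rewrite /r2 rematch_out // => k hk; rewrite eq_sym ?pc0 //;
      have [j hj ->] := v_ex k hk; apply: qc0.
  - move=> z _ h1 h2; rewrite /r2 rematch_out // => k hk.
    by have [j hj ->] := v_ex k hk; apply: h2.
  - by rewrite q0e nn.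
  - by rewrite /n2 /cycle3 (negPf s_c0) (negPf s_e) eqxx q0e.
  - by rewrite /n2 /cycle3 q0e (negPf e_c0) eqxx.
  - by rewrite /n2 /cycle3 eqxx nn.
  - by move=> z h1 h2 h3; rewrite /n2 /cycle3 -q0e (negPf h1) (negPf h2) (negPf h3).
  - by rewrite q0e.
  - by move=> i hi; apply: dart_dom (pdart i hi).
  - by move=> i hi; apply: dart_dom (qdart i hi).
  - exact: (sound_out so).
clearbody r2 n2 v.
have q0lab : lab (q 0) = None.
  have := qdart 0 isT; rewrite /is_dart => /andP [h1]; rewrite hlab //; by case: (lab _).
have rg : right_geo (dom m) (@rev m) (@nxt m) (@lab m) l p s c0.
  move: geo; rewrite /right_geo.
  by rewrite (eq_mkseq_lt (g := fun k => markp l p k.+1)) // => k hk; rewrite /markp hk.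
have markU y : y \in dom m -> lab y = Some r -> y = c0.
  by move=> h1 h2; rewrite (cu y) // /is_mark h1 h2 eqxx.
have em : @PMap (elt m) (dom m) (@rev m) (@nxt m) (@lab m) = m by case: (m).
have pm' : plane_map (@PMap (elt m) (dom m) (@rev m) (@nxt m) (@lab m)) by rewrite em.
have [pm2 dir lg] := slid_right sl pm' rg.
have m1E : sound (@PMap (elt m) (dom m) (@rev m) (@nxt m) (@lab m)) by rewrite em.
set M2 := @PMap _ _ r2 n2 _ in pm2 dir.
have type1 : map_of_type (rcons a 1) (@PMap (elt m) (dom m) (@rev m) (@nxt m) (@lab m)).
  by rewrite em.
have [type2 face2] := slid_type_right sl hb markU q0lab hr ha type1 hs pm2.
have D2p : p 0 \in dom m :\ c0 by rewrite !inE pc0 // (dart_dom (pdart 0 isT)).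
have iY := Phi_right_slide sl c0E hpath q0lab.
have iYi := @Phi_right_inert r m s.
have dY := pointed_iso_dom (plane_sound pm2 : sound (vmap (@Pointed M2 (p 0) (q 0)))) iYi D2p iY.
have hMt : calMt a (Phi_right r X).
  apply: (calMt_iso iYi dY iY); split=> //.
  exact: (etrans (slid_dart (b := @lab m) sl (q 0)) (qdart 0 isT)).
split=> //; exists (elt m), (dom m), (dom m :\ c0), (@rev m), (@nxt m), r2, n2, (@lab m), l, p, q, s, c0.
split=> //.
- by split=> //; apply: plane_sound.
- by exists id => //; apply: (map_iso_id m).
- by case: hMt => -[/plane_sound].
Qed.

Lemma sub_subn_pred l k : k < l -> l - (l - k).-1 = k.+1.
Proof. lia. Qed.

Lemma subSS_sub l k : k <= l -> l.+1 - (l - k) = k.+1.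
Proof. lia. Qed.

Lemma Phi_left_related r a Y : 0 < r -> size a = r -> calMt a Y ->
  [/\ left_legit r Y, calM a (Phi_left r Y) & slid_related r (Phi_left r Y) Y].
Proof.
move=> hr ha; case: Y => m v h [hm hv hd hf hdir].
rewrite [vmap _]/= [vver _]/= [vhe _]/= in hm hv hd hf hdir.
have pm : plane_map m by case: hm.
have so := plane_sound pm.
have hlab : forall x : elt m, x \in dom m -> (rev x == x) = isSome (lab x) by case: pm.
have hh := dart_dom hd.
set s := finv (@nxt m) h.
have ns : nxt s = h := f_finv (nxt_inj so) h.
have hsd : s \in dom m by rewrite -(nxt_dom so) ns.
(* Otherwise the contour of [f_1] would be reduced to the half-edge [h], whereas it also contains
   the mark of [f_1]. *)
have s_h : s != h.
  apply/eqP => E; rewrite E in ns.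
  have /andP [_ /existsP [y /andP [/andP [yd /eqP yl] yh]]] := hf.
  have yE : y = h.
    by case/fconnect_iter_ex: yh => n ->; elim: n => //= n ->.
  by move: hd; rewrite /is_dart -yE hlab // yl andbF.
have hl : lab h = None.
  by move: hd; rewrite /is_dart hh hlab //; case: (lab h).
set Y := @Pointed m v h.
have hM : sound (left_m1 Y) by apply: add_corner_sound.
have hN : None \in dom (left_m1 Y) by rewrite inE.
have hV : Some v \in dom (left_m1 Y) by rewrite inE.
have geo : @steered (left_m1 Y) (@cw _) (Some v) None (left_path Y).
  exact: leftmost_steered.
have distM (x : elt m) : x \in dom m -> @dist (left_m1 Y) (Some x) (Some v) = dist x v.
  by move=> hx; rewrite (add_corner_dist so hsd) // inE.
have [ps hps] : exists ps, left_path Y = map Some ps.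
  apply: all_some; apply: sub_all (steered_darts hM geo) => -[x|] //.
  by rewrite (@add_corner_dart m s None).
have szp : size ps = dist h v.
  rewrite -(size_map Some) -hps (steered_size hM (@cw_same_vertex _) hV hN geo).
  by rewrite (add_corner_dist so hsd) //= ns.
have szl : size ps = (size ps).-1.+1.
  by rewrite prednK // szp; apply: leq_ltn_trans hdir.
(* The half-edge [h] comes right after its corner clockwise and is directed toward [v], so the
   leftmost geodesic starts with it. *)
have ps0 : nth h ps 0 = h.
  case: ps hps szp szl => [|e ps] // hps _ _; rewrite hps in geo; case: geo => geo _.
  have : first_after (@cw (left_m1 Y)) (fun z => directed_toward z (Some v)) None (Some h).
    have E : @cw (left_m1 Y) None = Some h by rewrite -[in RHS]ns.
    by rewrite -E; apply: first_after_now; rewrite E (add_corner_directed so hsd).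
  by move/(first_after_uniq geo) => -[].
set l := (size ps).-1 in szl.
have hpath0 : left_path Y = mkseq (fun k => Some (nth h ps k)) l.+1.
  by rewrite hps -[in LHS](mkseq_nth h ps) szl /mkseq -map_comp.
have geo0 := geo; rewrite hpath0 in geo0.
have wd k : k < l.+1 -> [/\ is_dart (nth h ps k), dist (nth h ps k) v = l.+1 - k
    & dist (rev (nth h ps k)) v = l - k].
  move=> hk; have [/(_ k hk) fa _] := proj1 (steered_mkseq _ _ _ _ _) geo0.
  have hdt : is_dart (nth h ps k).
    by case: fa => n [_ /(directed_dart hM) + _]; rewrite (@add_corner_dart m s None).
  have gd := steered_mkseq_dist hM (@cw_same_vertex _) hV hN geo0.
  split=> //; first rewrite -distM ?(dart_dom hdt) //.
    by rewrite -(dist_l hM _ (first_after_vertex (@cw_same_vertex _) fa)) gd // ltnW.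
  rewrite -distM ?(rev_dom so) ?(dart_dom hdt) //; exact: (gd k.+1 hk).
(* The path is numbered from its target, so that [u k] ends at distance [k] from [v]. The cyclic
   shift [pi] gives [q 0 = u l], which is [h], and [q k.+1 = u k]. *)
pose u k := nth h ps (l - k); pose pi k := if k is k'.+1 then k' else l.
pose p k := rev (u k); pose q k := u (pi k).
have hpi k : k <= l -> pi k <= l by case: k => // k /ltnW.
have u_l : u l = h by rewrite /u subnn ps0.
have hpath : left_path Y = mkseq (fun k => Some (if k is k'.+1 then q (l - k') else q 0)) l.+1.
  rewrite hps -[in LHS](mkseq_nth h ps) szl /mkseq -map_comp.
  apply/eq_in_map => -[|k]; rewrite mem_iota => hk; first by rewrite /= ps0 -u_l.
  rewrite /= /q; have lk : 0 < l - k by rewrite subn_gt0.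
  by rewrite -(prednK lk) /= /u sub_subn_pred.
have geod k : k <= l -> [/\ is_dart (u k), dist (u k) v = k.+1 & dist (rev (u k)) v = k].
  move=> hk; have hk' : l - k < l.+1 by rewrite ltnS leq_subr.
  by have [h1 h2 h3] := wd _ hk'; split=> //; rewrite ?h2 ?h3 ?subSS_sub ?subKn.
rewrite hpath in geo.
have udom k : k <= l -> u k \in dom m by case/geod => /dart_dom.
have u_inj i j : i <= l -> j <= l -> u i = u j -> i = j.
  by move=> hi hj E; have [_ + _] := geod i hi; have [_ + _] := geod j hj; rewrite E => -> [].
have pi_inj i j : i <= l -> j <= l -> pi i = pi j -> i = j.
  case: i j => [|i] [|j] //= hi hj E; first by rewrite -E ltnn in hj.
    by rewrite E ltnn in hi.
  by rewrite E.
have q_inj i j : i <= l -> j <= l -> q i = q j -> i = j.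
  by move=> hi hj /u_inj E; apply: pi_inj => //; apply: E; apply: hpi.
have p_inj i j : i <= l -> j <= l -> p i = p j -> i = j.
  by move=> hi hj /(rev_inj so); apply: u_inj.
have up i j : i <= l -> j <= l -> rev (u i) != u j.
  move=> hi hj; apply/eqP => E; have [_ d1 d2] := geod i hi; have [_ d3 d4] := geod j hj.
  move: d2 d4; rewrite E d3 -E (revK so) d1 => <- /eqP.
  by rewrite -addn2 -{2}[j]addn0 eqn_add2l.
have pq i j : i <= l -> j <= l -> p i != q j.
  by move=> hi hj; apply: up => //; apply: hpi.
pose U := option (elt m).
pose D1 : {set U} := [set z | if z is Some x then x \in dom m else true].
pose D2 : {set U} := [set z | if z is Some x then x \in dom m else false].
pose mc (z : U) := if z is Some x then lab x else Some r.
pose P k : U := Some (p k); pose Q k : U := Some (q k).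
pose rv : U -> U := omap (@rev m).
pose r1 := rematch P Q l.+1 rv.
pose n1 (z : U) : U := omap (@nxt m) (cycle3 None (Some s) (Some h) z).
have P_inj i j : i < l.+1 -> j < l.+1 -> P i = P j -> i = j by move=> hi hj [] /p_inj; apply.
have Q_inj i j : i < l.+1 -> j < l.+1 -> Q i = Q j -> i = j by move=> hi hj [] /q_inj; apply.
have PQ i j : i < l.+1 -> j < l.+1 -> P i != Q j.
  by move=> hi hj; apply/eqP => -[E]; have := pq i j hi hj; rewrite E eqxx.
have rvK : involutive rv by case=> [x|] //=; rewrite (revK so).
have rvP k : k < l -> rv (P k) = Q k.+1 by rewrite /rv /= /p (revK so).
have rvPl : rv (P l) = Q 0 by rewrite /rv /= /p (revK so).
have rvQ k : k <= l -> rv (Q k) = P (pi k) by [].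
have PN k : P k != None by [].
have QN k : Q k != None by [].
have Q0 : Q 0 = Some h by rewrite /Q /q /= u_l.
have hs : Some h != Some s by apply: contraNneq s_h => -[->].
have nxt_omap_inj : injective (omap (@nxt m)).
  by move=> [x|] [y|] //= [/(nxt_inj so) ->].
have [Dp Dq] : (forall k, k <= l -> P k \in D1) /\ (forall k, k <= l -> Q k \in D1).
  by split=> k hk; rewrite /P /Q inE ?(rev_dom so); apply: udom; rewrite ?hpi.
have sl : slid D1 D2 r1 n1 rv (omap (@nxt m)) l P Q (Some s) None.
  split=> //.
  - apply: (@rematchK _ P Q l.+1 _ P_inj Q_inj PQ rvK) => k.
      rewrite ltnS leq_eqVlt => /predU1P [->|hk]; first by exists 0.
      by exists k.+1; rewrite // rvP.
    by move=> hk; exists (pi k); rewrite ?ltnS ?hpi.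
  - by move=> x y /nxt_omap_inj; apply: cycle3_inj => //; apply: contraNneq s_h => -[->].
  - by move=> k hk; rewrite /r1 (@rematch_l _ P Q l.+1 _ P_inj).
  - by rewrite /r1 rematch_out.
  - by move=> z _ h1 h2; rewrite /r1 rematch_out.
  - by rewrite /n1 /cycle3 Q0 (negPf hs) eqxx.
  - by rewrite Q0 /n1 /cycle3 /= ns.
  - by rewrite Q0 /= ns.
  - by rewrite Q0 /n1 /cycle3 /= eqxx.
  - move=> z h1 h2 h3; rewrite /n1 /cycle3 (negPf h1) (negPf h3).
    by rewrite -Q0 (negPf h2).
  - by rewrite Q0 eq_sym.
  - by rewrite inE.
  - by apply/setP => -[x|]; rewrite !inE.
  - move=> z hz; have hzD w : w \in D1 -> z != w by apply: contraTneq => <-.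
    rewrite /r1 rematch_out => [|k hk|k hk]; rewrite ?hzD ?Dp ?Dq //.
    have [x Ex hx] : exists2 x, z = Some x & x \notin dom m.
      by case: (z) hz => [x|]; rewrite inE // => hx; exists x.
    have [rx nx] := sound_out so hx.
    rewrite /n1 /cycle3 (negPf (hzD None _)) ?inE // (negPf (hzD (Some s) _)) ?inE //.
    by rewrite (negPf (hzD (Some h) _)) ?inE // Ex /rv /= rx nx.
(* The given map, copied onto a carrier with room for the mark to be restored. *)
pose m2 := @PMap U D2 rv (omap (@nxt m)) mc.
have f2 : @map_iso m m2 Some.
  split=> //; first by move=> x y _ _ [].
  apply/setP => -[x|]; rewrite inE; first by rewrite mem_imset //; apply: Some_inj.
  by apply/imsetP => -[].
have i2 : inert m2 by case=> [x|]; rewrite inE //= => /(sound_out so) [-> ->].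
have pm2 := iso_plane so f2 i2 pm; have so2 := plane_sound pm2.
have type2 := iso_type so f2 i2 hm.
have face2 : @in_face m2 0 (Q 0) by rewrite Q0 (iso_in_face so f2).
have p0 : p 0 \in dom m by rewrite (rev_dom so) udom.
(* The vertex [v] may be denoted by any of its elements; the slid map denotes it by the origin of
   [p 0], reached at the end of the path. *)
have v_p0 : same_vertex v (p 0).
  by rewrite (same_vertex_sym so) -(dist_eq0 so) //; have [_ _ ->] := geod 0 isT.
have hS2 : Some s \in dom m2 by rewrite inE.
have lg : left_geo D2 rv (omap (@nxt m)) mc l P Q (Some s).
  have hM2 := add_corner_sound so2 hS2 None.
  have hF := iso_add_corner f2 None hsd.
  have v_p0' : @same_vertex (left_m1 Y) (Some v) (Some (p 0)) by rewrite (add_corner_vertex so).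
  have cwd x : x \in dom (left_m1 Y) -> cw x \in dom (left_m1 Y) by rewrite (cw_dom hM).
  have hP0 : Some (p 0) \in dom (left_m1 Y) by rewrite inE.
  have := iso_steered hM hF (sound_out hM2) (g := @cw _) (g' := @cw _)
    cwd (iso_cw hM hF) hP0 hN (steered_target hM v_p0' geo).
  rewrite /left_geo /mkseq -map_comp.
  by congr steered; apply: eq_map => -[].
have sl_mark : mc None = Some r by [].
have markU y : y \in D1 -> mc y = Some r -> y = None.
  case: y => [x|] //; rewrite inE /= => xd xl; case: hm => _ t2 _ _ _.
  have := t2 x r; rewrite /is_mark xd xl eqxx => /(_ isT).
  by rewrite size_incr_nth ha hr ltnn.
have [pm1 rg] := slid_left sl pm2 isT lg.
have Q0lab : mc (Q 0) = None by rewrite Q0.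
have [type1 face1] := slid_type_left sl sl_mark markU Q0lab hr ha type2 face2 pm1.
have iX := Phi_left_slide r sl (erefl _) (congr1 (odflt h) Q0) hl hpath.
have iXi := @Phi_left_inert r m v h.
have hMX : calM a (Phi_left r Y) by apply: (calM_iso iXi iX); split.
have [g1 g2 g3] := Phi_left_legit r sl (erefl _) hpath.
split=> //.
  split=> //.
  - by rewrite hpath; apply: (steered_walk hM (@cw_same_vertex _) geo).
  - by rewrite hpath; apply: (steered_avoiding hM (@cw_same_vertex _) hN geo).
  - by rewrite hpath.
exists U, D1, D2, r1, n1, rv, (omap (@nxt m)), mc, l, P, Q, (Some s), None.
split=> //.
- by split=> //; apply: plane_sound.
- have sY : sound (vmap Y) by [].
  apply: (pointed_iso_sym sY (i2 : inert (vmap (@Pointed m2 (P 0) (Q 0))))) => //.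
    by rewrite inE.
  exists Some => //; split; last by rewrite Q0.
  by rewrite (iso_vertex so f2).
- by case: hMX => -[/plane_sound].
Qed.

Theorem theorem7 (r : nat) (a : seq nat)
    (hr : 1 <= r) (hsize : size a = r)
    (hpos : all (fun x => 0 < x) (rcons a 1))
    (hodd : count odd (rcons a 1) = 2) :
  (* Phi_right is well defined from M to M~, up to isomorphism *)
  [/\ forall X : cornered, calM a X -> right_legit r X /\ calMt a (Phi_right r X)
    & forall X X' : cornered, calM a X -> calM a X' ->
        cornered_iso X X' -> pointed_iso (Phi_right r X) (Phi_right r X')] /\
  (* Phi_left is well defined from M~ to M, up to isomorphism *)
  [/\ forall Y : pointed, calMt a Y -> left_legit r Y /\ calM a (Phi_left r Y)
    & forall Y Y' : pointed, calMt a Y -> calMt a Y' ->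
        pointed_iso Y Y' -> cornered_iso (Phi_left r Y) (Phi_left r Y')] /\
  (* they are inverse bijections *)
  [/\ forall X : cornered, calM a X -> cornered_iso (Phi_left r (Phi_right r X)) X
    & forall Y : pointed, calMt a Y -> pointed_iso (Phi_right r (Phi_left r Y)) Y].
Proof.
have pointed_refl Y : pointed_iso Y Y.
  by exists id; [apply: map_iso_id|split; [apply: same_vertex_refl|]].
have cornered_refl X : cornered_iso X X by exists id => //; apply: map_iso_id.
have R := fun X => @Phi_right_related r a X hr hsize.
have L := fun Y => @Phi_left_related r a Y hr hsize.
split; last split; split.
- by move=> X /R [].
- move=> X X' /R [_ _ h] /R [_ _ h']; exact: slid_related_right h h'.
- by move=> Y /L [].
- move=> Y Y' /L [_ _ h] /L [_ _ h']; exact: slid_related_left h h'.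
(* Both [X] and its image under the two maps are related to the same pointed map [Phi_right r X],
   hence isomorphic. *)
- move=> X /R [_ /L [_ _ h'] h]; exact: slid_related_left h' h (pointed_refl _).
- move=> Y /L [_ /R [_ _ h'] h]; exact: slid_related_right h' h (cornered_refl _).
Qed.
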